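(* Let $(\Omega,\mathcal{F},\mathbb{P},\theta)$ be a measurable metric dynamical system and let $\mathbf{V}$ be a $(p,\rho)$-rough driver cocycle over $(\Omega,\mathcal{F},\mathbb{P},\theta)$ on $\mathbb{R}^m$, for some $2\le p<3$ and $p/3<\rho\le1$. Then there exists a unique continuous random dynamical system $\varphi:[0,\infty)\times\Omega\times\mathbb{R}^m\to\mathbb{R}^m$ over $(\Omega,\mathcal{F},\mathbb{P},\theta)$ which induces the solution flow of the equation $d\psi=\mathbf{V}(\psi;dt)$, i.e. such that for every $\omega\in\Omega$ the maps $\psi_{ts}(\omega):=\varphi_{t-s}(\theta_s\omega)$, $0\le s\le t$, form the flow solving $d\psi=\mathbf{V}(\omega)(\psi;dt)$ on $[0,T]$ for every $T>0$.
   Context: Vector fields are identified with first order differential operators, $Vf=V^i\partial_if$. $\mathcal{C}_b^\alpha$ is the space of bounded, $\lfloor\alpha\rfloor$-times differentiable maps with bounded derivatives whose $\lfloor\alpha\rfloor$-th derivative is $(\alpha-\lfloor\alpha\rfloor)$-Hölder, with natural norm $\|\cdot\|_{\mathcal{C}^\alpha}$. Let $2\le p<3$, $p-2<\rho\le1$, $I$ a compact interval. A weak geometric $(p,\rho)$-rough driver on $I$ is a family $\mathbf{V}_{s,t}=(V_{s,t},\mathbb{V}_{s,t})$, $s\le t\in I$, where $V_{s,t}=V_t-V_s$ are increments of a time dependent vector field and $\mathbb{V}_{s,t}$ are second order differential operators, such that (a) $V_{s,t}\in\mathcal{C}_b^{2+\rho}(\mathbb{R}^m,\mathbb{R}^m)$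 with $\sup_{s<t\in I}\|V_{s,t}\|_{\mathcal{C}^{2+\rho}}/|t-s|^{1/p}<\infty$; (b) $W_{s,t}:=\mathbb{V}_{s,t}-\frac12V_{s,t}V_{s,t}$ are vector fields with $\sup_{s<t\in I}\|W_{s,t}\|_{\mathcal{C}^{1+\rho}}/|t-s|^{2/p}<\infty$; (c) $\mathbb{V}_{s,t}=\mathbb{V}_{u,t}+V_{s,u}V_{u,t}+\mathbb{V}_{s,u}$ for $s\le u\le t\in I$. $d_{p,\rho;I}(\mathbf{V},\mathbf{V}')=\sup_{s<t\in I}\big\{\frac{\|V_{s,t}-V'_{s,t}\|_{\mathcal{C}^{2+\rho}}}{|t-s|^{1/p}}\vee\sqrt{\frac{\|W_{s,t}-W'_{s,t}\|_{\mathcal{C}^{1+\rho}}}{|t-s|^{2/p}}}\big\}$. If $V:I\to\mathcal{C}_b^{2+\rho}(\mathbb{R}^m,\mathbb{R}^m)$ is continuous of bounded variation, its canonical lift is given by $W_{s,t}=\frac12\big(\int_s^tV^i_{s,u}\partial_iV_{du}-\int_s^t\partial_iV_{s,u}V^i_{du}\big)$, $\mathbb{V}_{s,t}=W_{s,t}+\frac12V_{s,t}V_{s,t}$. A geometric $(p,\rho)$-rough driver on $I$ is a $d_{p,\rho;I}$-limit of canonical lifts of such $V_n$. A geometric rough driver on $\mathbb{R}$ is a family indexed by $s\le t\in\mathbb{R}$ whose restriction to each compact interval $I\ni0$ is one; $\mathcal{D}_g^{p,\rho}$ is the set of these with metric $d_{p,\rho}=\sum_{k\ge1}2^{-k}(d_{p,\rho;[-k,k]}\wedge1)$.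 A measurable metric dynamical system is a probability space with maps $\theta_t:\Omega\to\Omega$, $t\in\mathbb{R}$, such that $(\omega,t)\mapsto\theta_t\omega$ is $\mathcal{F}\otimes\mathcal{B}(\mathbb{R})/\mathcal{F}$-measurable, $\theta_0=\mathrm{Id}$, $\theta_{s+t}=\theta_s\circ\theta_t$, $\mathbb{P}\circ\theta_t^{-1}=\mathbb{P}$. A $(p,\rho)$-rough driver cocycle is a $\mathcal{D}_g^{p,\rho}$-valued random variable $\mathbf{V}$ with $\mathbf{V}_{s,s+t}(\omega)=\mathbf{V}_{0,t}(\theta_s\omega)$ for every $\omega\in\Omega$, $s\in\mathbb{R}$, $t\ge0$. A flow on $I$ is a family $(\psi_{ts})_{s\le t\in I}$ of maps of $\mathbb{R}^m$ with $\psi_{ss}=\mathrm{Id}$ and $\psi_{tu}\circ\psi_{us}=\psi_{ts}$ for $s\le u\le t$. It solves $d\psi=\mathbf{V}(\psi;dt)$ on $I$ if there are $\delta>0$ and a constant $C$, possibly depending on $\mathbf{V}$, with $\|f\circ\psi_{ts}-\{f+V_{s,t}f+\mathbb{V}_{s,t}f\}\|_\infty\le C\|f\|_{\mathcal{C}^3}|t-s|^{3/p}$ for all $f\in\mathcal{C}_b^3$ and all $s\le t\in I$ with $t-s\le\delta$. For $\rho>p/3$ every weak geometric $(p,\rho)$-rough driver has a solution flow, consisting of homeomorphisms. A continuous random dynamical system on $\mathbb{R}^m$ over $(\Omega,\mathcal{F},\mathbb{P},\theta)$ is a measurable $\varphi:[0,\infty)\times\Omega\times\mathbb{R}^m\to\mathbb{R}^m$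 with $\varphi_0(\omega)=\mathrm{Id}$, $\varphi_{t+s}(\omega)=\varphi_t(\theta_s\omega)\circ\varphi_s(\omega)$ for all $s,t\ge0$, $\omega\in\Omega$, and $(t,x)\mapsto\varphi_t(\omega,x)$ continuous for every $\omega$. *)

(* Defs.v *)
From HB Require Import structures.
From mathcomp Require Export all_boot all_order all_algebra.
From mathcomp Require Export all_classical all_reals all_analysis.

Set Implicit Arguments.
Unset Strict Implicit.
Unset Printing Implicit Defensive.

Import Order.TTheory GRing.Theory Num.Theory.
Import numFieldNormedType.Exports.

Local Open Scope classical_set_scope.
Local Open Scope ring_scope.

(* Points of R^m are row vectors 'rV[R]_m, normed by the library's (maximum)
   norm; every definition below is insensitive to the choice of norm. *)

(* Supremum of a set of nonnegative extended reals; unlike ereal_sup it is 0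
   on the empty set. *)
Definition sup0 (R : realType) (A : set (\bar R)) : \bar R :=
  ereal_sup (0%E |` A).

(** * The spaces C_b^alpha *)

Section Holder.
Context {R : realType} {m : nat}.

Definition basis_vec (i : 'I_m) : 'rV[R]_m := delta_mx 0 i.

(* Iterated partial derivative d_{i_1} ... d_{i_k} f. *)
Definition pder {W : normedModType R} (l : seq 'I_m) (f : 'rV[R]_m -> W) :
    'rV[R]_m -> W :=
  foldr (fun i (g : 'rV[R]_m -> W) x => 'D_(basis_vec i) g x) f l.

(* f is n times (Frechet) differentiable: D^k f is differentiable for every
   k < n; since R^m is finite dimensional this may be tested on the components
   of D^k f, which are the partial derivatives of order k. *)
Definition ndifferentiable {W : normedModType R} (n : nat)
    (f : 'rV[R]_m -> W) : Prop :=
  forall l : seq 'I_m, (size l < n)%N -> forall x, differentiable (pder l f) x.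

Definition Calpha_norm {W : normedModType R} (alpha : R)
    (f : 'rV[R]_m -> W) : \bar R :=
  let n := Num.truncn alpha in
  (\sum_(k < n.+1) sup0 [set y | exists (l : seq 'I_m) (x : 'rV[R]_m),
       size l = k /\ y = (`|pder l f x|)%:E]
   + sup0 [set z | exists (l : seq 'I_m) (x y : 'rV[R]_m),
       [/\ size l = n, x != y
         & z = (`|pder l f x - pder l f y|
                 / `|x - y| `^ (alpha - n%:R))%:E]])%E.

Definition Cb {W : normedModType R} (alpha : R) (f : 'rV[R]_m -> W) : Prop :=
  ndifferentiable (Num.truncn alpha) f /\ (Calpha_norm alpha f < +oo)%E.

End Holder.

(** * Vector fields and differential operators *)

Section Operators.
Context {R : realType} {m : nat}.

Definition vfield : Type := 'rV[R]_m -> 'rV[R]_m.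

(* Operators are only meaningful on twice differentiable functions. *)
Definition operator : Type := ('rV[R]_m -> R) -> 'rV[R]_m -> R.

(* The differential operator V f = V^i d_i f. *)
Definition vop (V : vfield) : operator := fun f x =>
  \sum_(i < m) V x 0 i * 'D_(basis_vec i) (f : 'rV[R]_m -> R^o) x.

Definition op_eq (L L' : operator) : Prop :=
  forall f : 'rV[R]_m -> R, ndifferentiable 2 (f : 'rV[R]_m -> R^o) ->
  forall x, L f x = L' f x.

(* The only candidate vector field v with L = vop v: its components are the
   values of L on the coordinate functions. *)
Definition field_of (L : operator) : vfield := fun x =>
  \row_(i < m) L (fun y => y 0 i) x.

Definition is_vector_field (L : operator) : Prop := op_eq L (vop (field_of L)).

End Operators.

Arguments vfield : clear implicits.
Arguments operator : clear implicits.

(** * Rough drivers *)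

(* Only the values at s <= t are meaningful. *)
Record driver (R : realType) (m : nat) := Driver {
  inc : R -> R -> vfield R m ;
  inc2 : R -> R -> operator R m }.

Section Drivers.
Context {R : realType} {m : nat}.
Implicit Types (D : driver R m) (a b p rho s t : R).

Definition Wop D s t : operator R m := fun f x =>
  inc2 D s t f x - 2^-1 * vop (inc D s t) (vop (inc D s t) f) x.

Definition Wfield D s t : vfield R m := field_of (Wop D s t).

Definition driver_norm1 a b p rho (F : R -> R -> vfield R m) : \bar R :=
  sup0 [set z | exists s t, [/\ a <= s, s < t, t <= b
    & z = (Calpha_norm (2 + rho) (F s t) * ((`|t - s| `^ p^-1)^-1)%:E)%E]].

Definition driver_norm2 a b p rho (F : R -> R -> vfield R m) : \bar R :=
  sup0 [set z | exists s t, [/\ a <= s, s < t, t <= b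
    & z = (Calpha_norm (1 + rho) (F s t)
           * ((`|t - s| `^ (2 / p))^-1)%:E)%E]].

Definition weak_geometric a b p rho D : Prop :=
  [/\ exists v : R -> vfield R m,
        forall s t, a <= s -> s <= t -> t <= b ->
          inc D s t = (fun x => v t x - v s x),
      (forall s t, a <= s -> s <= t -> t <= b -> Cb (2 + rho) (inc D s t))
        /\ (driver_norm1 a b p rho (inc D) < +oo)%E,
      (forall s t, a <= s -> s <= t -> t <= b ->
          is_vector_field (Wop D s t) /\ Cb (1 + rho) (Wfield D s t))
        /\ (driver_norm2 a b p rho (Wfield D) < +oo)%E
    & forall s u t, a <= s -> s <= u -> u <= t -> t <= b ->
        op_eq (inc2 D s t)
          (fun f x => inc2 D u t f x
                      + vop (inc D s u) (vop (inc D u t) f) x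
                      + inc2 D s u f x)].

Definition driver_dist_on a b p rho D D' : \bar R :=
  sup0 [set z | exists s t, [/\ a <= s, s < t, t <= b
    & z = (maxe
       (Calpha_norm (2 + rho) (fun x => (inc D s t x - inc D' s t x)%R)
          * ((`|t - s| `^ p^-1)^-1)%:E)
       (poweR
         (Calpha_norm (1 + rho) (fun x => (Wfield D s t x - Wfield D' s t x)%R)
            * ((`|t - s| `^ (2 / p))^-1)%:E) 2^-1))%E]].

(** * Canonical lifts *)

(* Riemann-Stieltjes integral of f with respect to g over [a, b]. A partition
   a = t_0 < t_1 < ... < t_n = b is the list t_1, ..., t_n. *)
Definition is_RS_integral a b (f g : R -> R) (l : R) : Prop :=
  forall e, 0 < e -> exists2 d, 0 < d &
  forall (ts : seq R) (xi : nat -> R), itv_partition a b ts ->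
    (forall i, (i < size ts)%N ->
       nth b (a :: ts) i.+1 - nth b (a :: ts) i < d /\
       nth b (a :: ts) i <= xi i <= nth b (a :: ts) i.+1) ->
    `|\sum_(i < size ts)
        f (xi i) * (g (nth b (a :: ts) i.+1) - g (nth b (a :: ts) i)) - l| < e.

Definition RS_integral a b (f g : R -> R) : R :=
  get [set l | is_RS_integral a b f g l].

Definition lift_W (v : R -> vfield R m) s t : vfield R m := fun x =>
  \row_(j < m) (2^-1 *
    (\sum_(i < m)
        RS_integral s t (fun u => (v u x - v s x) 0 i)
                        (fun u => 'D_(basis_vec i) (v u) x 0 j)
   - \sum_(i < m)
        RS_integral s t
          (fun u => 'D_(basis_vec i) (fun y => v u y - v s y) x 0 j)
          (fun u => v u x 0 i))).

Definition canonical_lift (v : R -> vfield R m) : driver R m :=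
  let V s t : vfield R m := fun x => v t x - v s x in
  {| inc := V ;
     inc2 := fun s t f x =>
       vop (lift_W v s t) f x + 2^-1 * vop (V s t) (vop (V s t) f) x |}.

(* v : [a, b] -> C_b^{2 + rho} is continuous and of bounded variation. *)
Definition continuous_BV_path a b rho (v : R -> vfield R m) : Prop :=
  [/\ forall t, a <= t <= b -> Cb (2 + rho) (v t),
      forall t, a <= t <= b -> forall e : R, 0 < e -> exists2 d : R, 0 < d &
        forall u, a <= u <= b -> `|u - t| < d ->
          (Calpha_norm (2 + rho) (fun x => (v u x - v t x)%R) < e%:E)%E
    & exists M : R, forall ts : seq R, itv_partition a b ts ->
        (\sum_(i < size ts) Calpha_norm (2 + rho)
           (fun x => (v (nth b (a :: ts) i.+1) x - v (nth b (a :: ts) i) x)%R)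
         <= M%:E)%E].

(* The limit is taken among weak geometric rough drivers: a continuous path of
   bounded variation need not be 1/p-Hoelder, so its lift may fail to be one. *)
Definition geometric_on a b p rho D : Prop :=
  weak_geometric a b p rho D /\
  exists v : nat -> R -> vfield R m,
    (forall n, continuous_BV_path a b rho (v n)) /\
    driver_dist_on a b p rho (canonical_lift (v n)) D @[n --> \oo] --> 0%E.

Definition geometric_drivers p rho : set (driver R m) :=
  [set D | forall a b, a <= 0 -> 0 <= b -> geometric_on a b p rho D].

Definition driver_dist p rho D D' : \bar R :=
  (\sum_(1 <= k <oo)
     ((2^-1 ^+ k)%:E * mine (driver_dist_on (- k%:R) k%:R p rho D D') 1%:E))%E.

Definition driver_open p rho : set (set (driver R m)) :=
  [set U | U `<=` geometric_drivers p rho /\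
     forall D, U D -> exists2 e : R, 0 < e &
       forall D', geometric_drivers p rho D' ->
         (driver_dist p rho D D' < e%:E)%E -> U D'].

Definition driver_borel p rho : set (set (driver R m)) :=
  <<s geometric_drivers p rho, driver_open p rho >>.

(** * Solution flows *)

(* psi t s is the map psi_{ts} from time s to time t. *)
Definition is_flow a b (psi : R -> R -> vfield R m) : Prop :=
  (forall s, a <= s <= b -> psi s s = id) /\
  (forall s u t, a <= s -> s <= u -> u <= t -> t <= b ->
     psi t u \o psi u s = psi t s).

Definition solves a b p D (psi : R -> R -> vfield R m) : Prop :=
  exists delta C : R, 0 < delta /\
    forall f : 'rV[R]_m -> R, Cb 3 (f : 'rV[R]_m -> R^o) ->
    forall s t, a <= s -> s <= t -> t <= b -> t - s <= delta ->
      (sup0 [set y | exists x : 'rV[R]_m,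
         y = (`|f (psi t s x)
                - (f x + vop (inc D s t) f x + inc2 D s t f x)|)%:E]
       <= C%:E * Calpha_norm 3 (f : 'rV[R]_m -> R^o)
          * (`|t - s| `^ (3 / p))%:E)%E.

Definition solution_flow a b p D (psi : R -> R -> vfield R m) : Prop :=
  is_flow a b psi /\ solves a b p D psi.

End Drivers.

(** * Random dynamical systems *)

(* The real line and R^m carry their Borel sigma-algebras. *)
Definition borel_rV (R : realType) (m : nat) :=
  g_sigma_algebraType (@open 'rV[R]_m).

Definition measurable_metric_DS (R : realType) (d : measure_display)
    (Omega : measurableType d) (P : probability Omega R)
    (theta : R -> Omega -> Omega) : Prop :=
  [/\ measurable_fun [set: Omega * measurableTypeR R]
        (fun z : Omega * measurableTypeR R => theta z.2 z.1),
      theta 0 = id,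
      forall s t, theta (s + t) = theta s \o theta t
    & forall t A, measurable A -> P (theta t @^-1` A) = P A].

Definition driver_cocycle (R : realType) (m : nat) (p rho : R)
    (d : measure_display) (Omega : measurableType d)
    (theta : R -> Omega -> Omega) (V : Omega -> driver R m) : Prop :=
  [/\ forall omega, geometric_drivers p rho (V omega),
      forall B, driver_borel p rho B -> measurable (V @^-1` B)
    & forall omega (s t : R), 0 <= t ->
        inc (V omega) s (s + t) = inc (V (theta s omega)) 0 t /\
        op_eq (inc2 (V omega) s (s + t)) (inc2 (V (theta s omega)) 0 t)].

(* phi t omega is only meaningful for t >= 0. *)
Definition continuous_RDS (R : realType) (m : nat)
    (d : measure_display) (Omega : measurableType d)
    (theta : R -> Omega -> Omega)
    (phi : R -> Omega -> 'rV[R]_m -> 'rV[R]_m) : Prop :=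
  [/\ measurable_fun
        [set z : measurableTypeR R * Omega * borel_rV R m | 0 <= (z.1.1 : R)]
        (fun z : measurableTypeR R * Omega * borel_rV R m =>
           phi z.1.1 z.1.2 z.2 : borel_rV R m),
      forall omega, phi 0 omega = id,
      forall s t omega, 0 <= s -> 0 <= t ->
        phi (t + s) omega = phi t (theta s omega) \o phi s omega
    & forall omega,
        {within [set z : R * 'rV[R]_m | 0 <= z.1],
          continuous (fun z : R * 'rV[R]_m => phi z.1 omega z.2)}].

Definition induces_solution_flow (R : realType) (m : nat) (p : R)
    (d : measure_display) (Omega : measurableType d)
    (theta : R -> Omega -> Omega) (V : Omega -> driver R m)
    (phi : R -> Omega -> 'rV[R]_m -> 'rV[R]_m) : Prop :=
  forall omega (T : R), 0 < T ->
    solution_flow 0 T p (V omega) (fun t s => phi (t - s) (theta s omega)).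

(* Main.v *)
From mathcomp Require Import ring lra.
Require Import Defs.
Import Order.TTheory GRing.Theory Num.Theory.
Import numFieldNormedType.Exports.
Local Open Scope classical_set_scope.
Local Open Scope ring_scope.
Set Implicit Arguments.
Unset Strict Implicit.
Unset Printing Implicit Defensive.

(** For a fixed driver the solution flow is built from Davie's scheme: one step
    from [s] to [t] moves [x] to [x + V x + B x], where [V] is the increment of
    the driver and [B] is obtained by applying its second order operator to the
    coordinate functions, so that [B = W + DV.V / 2] ([davie]). By Chen's
    relation two consecutive steps miss the single step only by Taylor
    remainders. Since [V] is of class [2 + rho] and [W] of class [1 + rho], the
    error has order [3 / p] in the supremum norm and order [3 * rho / p] in the
    Lipschitz seminorm ([davie_almost_flow]); both exponents exceed 1 because
    [p / 3 < rho].

    Errors of order above 1 are summable over any partition. Cutting a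
    partition at the midpoint of its interval and inducting on the number of
    steps shows that compositions of the scheme stay near one step, and that
    they are Lipschitz with a constant independent of the partition
    ([compose_near], [compose_diff]). The position error [h `^ (3 / p)] enters
    the second estimate through a [rho]-Hoelder derivative, and the condition
    [1 < 3 * rho / p] is used there. With a uniform Lipschitz constant,
    telescoping over a partition proves that the compositions converge as the
    mesh tends to 0, that the limit is a flow, and that any path which locally
    follows the scheme up to order [3 / p] is a flow line ([flow_comp],
    [flow_unique]). A Taylor expansion shows that the limit solves the equation
    ([davie_flow_solves]). Conversely a solution flow follows the scheme up to
    order [3 / p]: this is seen by testing it on arctangents of coordinates
    ([solves_near]). Hence the solution flow is unique and equal to the limit.

    For the random dynamical system put [phi t w x] equal to the solution at
    time [t] started from [x] at time 0 for the driver [V w]. The cocycle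
    property of the driver makes the scheme for [theta s w] the time shift of
    the scheme for [w], so the flow property becomes the cocycle property of
    [phi] for every [w]. For fixed times and starting point the scheme depends
    continuously on the driver ([compose_davie_open]), hence is measurable in
    [w], and so is its limit; being continuous in time and space, [phi] is
    jointly measurable ([caratheodory]). *)

(** * Differential calculus along segments *)

Section Calculus.
Context {R : realType} {m : nat}.
Implicit Types (f g : 'rV[R]_m -> R) (x y h k : 'rV[R]_m).

Definition pd (i : 'I_m) f : 'rV[R]_m -> R :=
  fun x => 'D_(basis_vec i) (f : 'rV[R]_m -> R^o) x.

Definition smooth f := forall x, differentiable (f : 'rV[R]_m -> R^o) x.

(** The derivative of [f] at [x] along [h], written with partial derivatives so
    that [vop V f x] is [grad f x (V x)]. *)
Definition grad f x h : R := \sum_(j < m) h 0 j * pd j f x.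

Lemma rV_norm_le (v : 'rV[R]_m) (c : R) :
  0 <= c -> (forall j, `|v 0 j| <= c) -> `|v| <= c.
Proof.
move=> c0 H; rewrite /Num.Def.normr/= mx_normrE bigmax_le// => -[i j] _ /=.
by rewrite ord1.
Qed.

Lemma rV_coord_le (v : 'rV[R]_m) j : `|v 0 j| <= `|v|.
Proof.
rewrite [leRHS]/Num.Def.normr/= mx_normrE.
exact: (le_bigmax _ (fun ij : 'I_1 * 'I_m => `|v ij.1 ij.2|) (0, j)).
Qed.

Lemma derive_grad f x h : differentiable (f : 'rV[R]_m -> R^o) x ->
  'D_h (f : 'rV[R]_m -> R^o) x = grad f x h.
Proof.
move=> df; rewrite deriveE// [X in 'd f x X]row_sum_delta linear_sum.
apply: eq_bigr => j _; rewrite linearZ /pd deriveE//.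
Qed.

Lemma is_derive_seg f x h (t : R) : smooth f ->
  is_derive t (1:R) (fun s : R => f (x + s *: h) : R^o) (grad f (x + t *: h) h).
Proof.
move=> df.
have dg : is_diff t (fun s : R => x + s *: h) ( *:%R^~ h : R -> 'rV[R]_m).
  have -> : ( *:%R^~ h : R -> 'rV[R]_m) = 0 + ( *:%R^~ h : R -> 'rV[R]_m).
    by apply/funext => u; rewrite /= add0r.
  exact: (@is_diffD R _ _ (cst x) ( *:%R^~ h : R -> 'rV[R]_m)).
have [dfg dE] := @is_diff_comp R _ _ _ _ _ (f : _ -> R^o) _ t dg
  (differentiableP (df (x + t *: h))).
apply: DeriveDef; first exact: diff_derivable.
rewrite (deriveE _ dfg).
transitivity (('d (f : _ -> R^o) (x + t *: h) \o *:%R^~ h) (1 : R)).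
  by rewrite -dE.
by rewrite /= scale1r -derive_grad// deriveE.
Qed.

Lemma MVT_unit (g dg : R -> R) : (forall t : R, is_derive t (1:R) (g : R -> R^o) (dg t)) ->
  exists2 c, 0 <= c <= 1 & g 1 - g 0 = dg c.
Proof.
move=> H; have [|c] := @MVT_segment R g dg 0 1 ler01 (fun t _ => H t).
  apply: continuous_subspaceT => t; apply: differentiable_continuous.
  by apply/derivable1_diffP; have := H t; case.
by rewrite in_itv /= subr0 mulr1 => c01 E; exists c.
Qed.

Lemma MVT_bound (g dg : R -> R) (B : R) :
  (forall t : R, is_derive t (1:R) (g : R -> R^o) (dg t)) ->
  (forall t, 0 <= t <= 1 -> `|dg t| <= B) -> `|g 1 - g 0| <= B.
Proof. by move=> H HB; have [c c01 ->] := MVT_unit H; exact: HB. Qed.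

Lemma sum_const_le (F : 'I_m -> R) (c : R) :
  (forall j, `|F j| <= c) -> `|\sum_j F j| <= m%:R * c.
Proof.
move=> H; apply: le_trans (ler_norm_sum _ _ _) _.
apply: le_trans (ler_sum _ (fun j _ => H j)) _.
by rewrite sumr_const card_ord mulr_natl.
Qed.

Lemma grad_le f x h (c : R) :
  (forall j, `|pd j f x| <= c) -> `|grad f x h| <= m%:R * (c * `|h|).
Proof.
move=> H; apply: sum_const_le => j; rewrite normrM mulrC.
by apply: ler_pM => //; exact: rV_coord_le.
Qed.

Lemma gradB f x h k : grad f x (h - k) = grad f x h - grad f x k.
Proof.
by rewrite /grad -sumrB; apply: eq_bigr => j _; rewrite !mxE mulrBl.
Qed.

Lemma gradD f x h k : grad f x (h + k) = grad f x h + grad f x k.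
Proof.
by rewrite /grad -big_split; apply: eq_bigr => j _; rewrite !mxE mulrDl.
Qed.

Lemma gradZ f x h (a : R) : grad f x (a *: h) = a * grad f x h.
Proof.
by rewrite /grad mulr_sumr; apply: eq_bigr => j _; rewrite !mxE mulrA.
Qed.

Lemma grad_sub_le f x y h (c : R) :
  (forall j, `|pd j f x - pd j f y| <= c) ->
  `|grad f x h - grad f y h| <= m%:R * (c * `|h|).
Proof.
move=> H; rewrite /grad -sumrB; apply: sum_const_le => j.
rewrite -mulrBr normrM mulrC.
by apply: ler_pM => //; exact: rV_coord_le.
Qed.

Lemma segB x y : x + 1 *: (y - x) = y.
Proof. by rewrite scale1r addrC subrK. Qed.

Lemma seg0 x h : x + (0:R) *: h = x.
Proof. by rewrite scale0r addr0. Qed.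

Lemma smooth_lip f (c : R) : smooth f -> (forall j x, `|pd j f x| <= c) ->
  forall x y, `|f x - f y| <= m%:R * (c * `|x - y|).
Proof.
move=> sf H x y.
have := @MVT_bound (fun s => f (y + s *: (x - y)))
   (fun s => grad f (y + s *: (x - y)) (x - y)) (m%:R * (c * `|x - y|)).
rewrite segB seg0; apply => t; first exact: is_derive_seg.
by move=> _; exact: grad_le.
Qed.

Definition holder (r c : R) f := forall x y, `|f x - f y| <= c * (`|x - y| `^ r).

Lemma convex_norm_le (h k : 'rV[R]_m) (t z : R) : 0 <= t <= 1 ->
  `|h| <= z -> `|k| <= z -> `|h + t *: (k - h)| <= z.
Proof.
move=> /andP[t0 t1] hz kz.
have -> : h + t *: (k - h) = (1 - t) *: h + t *: k.
  by rewrite scalerBr scalerBl scale1r addrCA addrC.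
apply: le_trans (ler_normD _ _) _; rewrite !normrZ (ger0_norm t0).
rewrite ger0_norm ?subr_ge0//.
have := ler_wpM2l t0 kz; have := ler_wpM2l (_ : 0 <= 1 - t) hz.
rewrite subr_ge0 => /(_ t1); lra.
Qed.

Lemma is_derive_sub_fun (F G : R -> R) (dF dG t : R) :
  is_derive t (1:R) (F : R -> R^o) dF -> is_derive t (1:R) (G : R -> R^o) dG ->
  is_derive t (1:R) (fun s => F s - G s : R^o) (dF - dG).
Proof. by move=> HF HG; exact: (@is_deriveB R _ _ (F : R -> R^o) (G : R -> R^o)). Qed.

(** Applied with [f] a coordinate of one step of the scheme, this compares the
    distance of two trajectories before and after a perturbation of both of them.
    Moving along the two segments with the same parameter, the derivative of the
    difference is [grad f] at one point along the mixed difference, plus a change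
    of base point that costs only the Hoelder constant. *)
Lemma smooth_4pt f (c l r : R) : smooth f -> (forall j x, `|pd j f x| <= c) ->
  0 <= r -> 0 <= l -> (forall j, holder r l (pd j f)) ->
  forall x y x' y' z, `|x - x'| <= z -> `|y - y'| <= z ->
  `|(f x - f y) - (f x' - f y')|
   <= m%:R * (c * `|(x - y) - (x' - y')|) + m%:R * (l * (z `^ r) * `|x - y|).
Proof.
move=> sf H r0 l0 Hl x y x' y' z xz yz.
pose P s := y + s *: (x - y); pose Q s := y' + s *: (x' - y').
have := @MVT_bound (fun s => f (P s) - f (Q s))
   (fun s => grad f (P s) (x - y) - grad f (Q s) (x' - y')).
rewrite /P /Q !segB !seg0.
have -> : f x - f x' - (f y - f y') = f x - f y - (f x' - f y') by ring.
apply => t.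
  by apply: is_derive_sub_fun; exact: is_derive_seg.
move=> t01; rewrite -/(P t) -/(Q t).
have PQ : `|P t - Q t| <= z.
  have -> : P t - Q t = (y - y') + t *: ((x - x') - (y - y')).
    by apply/rowP => j; rewrite !mxE; ring.
  exact: convex_norm_le.
have -> : grad f (P t) (x - y) - grad f (Q t) (x' - y') =
  grad f (Q t) ((x - y) - (x' - y')) + (grad f (P t) (x - y) - grad f (Q t) (x - y)).
  by rewrite [grad f (Q t) (_ - _ - _)]gradB [RHS]addrC subrKA.
apply: le_trans (ler_normD _ _) _; apply: lerD; first exact: grad_le.
apply: grad_sub_le => j; apply: le_trans (Hl _ _ _) _.
by apply: ler_wpM2l => //; apply: ge0_ler_powR; rewrite ?nnegrE //; exact: le_trans PQ.
Qed.

Lemma smooth_taylor1 f (l r : R) : smooth f ->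
  0 <= r -> 0 <= l -> (forall j, holder r l (pd j f)) ->
  forall x h z, `|h| <= z -> `|f (x + h) - f x - grad f x h| <= m%:R * (l * (z `^ r) * `|h|).
Proof.
move=> sf r0 l0 Hl x h z hz.
have [c /andP[c0 c1]] := MVT_unit (fun t => @is_derive_seg f x h t sf).
rewrite scale1r seg0 => ->.
apply: grad_sub_le => j; apply: le_trans (Hl _ _ _) _.
apply: ler_wpM2l => //; apply: ge0_ler_powR; rewrite ?nnegrE //.
  exact: le_trans hz.
rewrite addrC addKr normrZ ger0_norm//.
by apply: le_trans hz; rewrite ler_piMl.
Qed.

Lemma is_derive_mul_fun (F G : R -> R) (dF dG : R) (t : R) :
  is_derive t (1:R) (F : R -> R^o) dF -> is_derive t (1:R) (G : R -> R^o) dG ->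
  is_derive t (1:R) (fun s => F s * G s : R^o) (dF * G t + F t * dG).
Proof.
move=> HF HG.
have := @is_deriveM R _ (F : R -> R^o) G t 1 _ _ HF HG.
by move=> H; apply: (is_derive_eq H); rewrite /GRing.scale /=; ring.
Qed.

Lemma is_derive_affine (a b t : R) : is_derive t (1:R) (fun s => a + s * b : R^o) b.
Proof.
have H := is_deriveD (is_derive_cst (a : R^o) t 1) (is_deriveZ b (is_derive_id t 1)).
have -> : (fun s => a + s * b : R^o) = cst a + (b *: (id : R -> R^o)).
  by apply/funext => s /=; rewrite /GRing.scale /= mulrC.
by apply: (is_derive_eq H); rewrite add0r /GRing.scale /= mulr1.
Qed.

Lemma is_derive_scaled f x h (t : R) : smooth f ->
  is_derive t (1:R) (fun s : R => f (x + s *: h) - f x - s * grad f x h : R^o)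
     (grad f (x + t *: h) h - grad f x h).
Proof.
move=> sf; apply: is_derive_sub_fun; last first.
  have -> : (fun s : R => s * grad f x h : R^o) = (fun s => 0 + s * grad f x h).
    by apply/funext => s; rewrite add0r.
  exact: is_derive_affine.
rewrite -[X in is_derive _ _ _ X]subr0.
by apply: is_derive_sub_fun; first exact: is_derive_seg.
Qed.

(** The remainder is differentiated in the length of the increments rather than in
    the base point: this leaves first derivatives of [f] at four points, so that
    [smooth_4pt] applies to each [pd j f]. The exponent gained over the naive
    Lipschitz bound is what makes the defect of the scheme summable. *)
Lemma taylor_rem_lip f (c l r : R) : smooth f -> (forall i, smooth (pd i f)) ->
  0 <= c -> (forall i j x, `|pd j (pd i f) x| <= c) ->
  0 <= r -> 0 <= l -> (forall i j, holder r l (pd j (pd i f))) ->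
  forall x h y k z, `|h| <= z -> `|k| <= z ->
  `|(f (x + h) - f x - grad f x h) - (f (y + k) - f y - grad f y k)|
   <= m%:R ^+ 2 * (l * (z `^ r) * z * `|x - y|)
      + 2 * m%:R ^+ 2 * (c * z * `|h - k|).
Proof.
move=> sf sdf c0 Hc r0 l0 Hl x h y k z hz kz.
have := @MVT_bound
  (fun s => (f (x + s *: h) - f x - s * grad f x h)
          - (f (y + s *: k) - f y - s * grad f y k))
  (fun s => (grad f (x + s *: h) h - grad f x h)
          - (grad f (y + s *: k) k - grad f y k)).
rewrite !scale1r !seg0 !mul1r !mul0r !subrr !subr0; apply => [t|t t01].
  by apply: is_derive_sub_fun; exact: is_derive_scaled.
have /andP[t0 t1] := t01.
have z0 : 0 <= z by apply: le_trans hz.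
have tz u : `|u| <= z -> `|t *: u| <= z.
  move=> uz; rewrite normrZ ger0_norm//; apply: le_trans uz.
  by rewrite ler_piMl.
have -> : (grad f (x + t *: h) h - grad f x h) - (grad f (y + t *: k) k - grad f y k)
 = (grad f (x + t *: h) (h - k) - grad f x (h - k))
  - \sum_j k 0 j * ((pd j f x - pd j f y) - (pd j f (x + t *: h) - pd j f (y + t *: k))).
  rewrite !gradB.
  have -> : \sum_j k 0 j * ((pd j f x - pd j f y) - (pd j f (x + t *: h) - pd j f (y + t *: k)))
   = grad f x k - grad f y k - (grad f (x + t *: h) k - grad f (y + t *: k) k).
    by rewrite /grad -!sumrB; apply: eq_bigr => j _; ring.
  move: (grad f x h) (grad f x k) (grad f y k) (grad f (x + t *: h) h).
  by move: (grad f (x + t *: h) k) (grad f (y + t *: k) k) => *; ring.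
apply: le_trans (ler_normB _ _) _.
have H1 : `|grad f (x + t *: h) (h - k) - grad f x (h - k)| <=
   m%:R * (m%:R * (c * z) * `|h - k|).
  apply: grad_sub_le => j; apply: le_trans (smooth_lip (sdf j) (Hc j) _ _) _.
  apply: ler_wpM2l => //; apply: ler_wpM2l => //.
  by rewrite addrC addKr; exact: tz.
have H2 : `|\sum_j k 0 j * ((pd j f x - pd j f y) - (pd j f (x + t *: h) - pd j f (y + t *: k)))|
  <= m%:R * (z * (m%:R * (c * `|h - k|) + m%:R * (l * (z `^ r) * `|x - y|))).
  apply: sum_const_le => j; rewrite normrM; apply: ler_pM => //.
    by apply: le_trans kz; exact: rV_coord_le.
  apply: le_trans (@smooth_4pt _ _ _ r (sdf j) (Hc j) r0 l0 (Hl j) _ _ _ _ z _ _) _.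
  - by rewrite opprD addrA subrr sub0r normrN; exact: tz.
  - by rewrite opprD addrA subrr sub0r normrN; exact: tz.
  - apply: lerD => //; apply: ler_wpM2l => //; apply: ler_wpM2l => //.
    have -> : x - y - (x + t *: h - (y + t *: k)) = - (t *: (h - k)).
      by apply/rowP => i; rewrite !mxE; ring.
    by rewrite normrN normrZ ger0_norm// ler_piMl.
have := lerD H1 H2; by move=> H; apply: le_trans H _; rewrite le_eqVlt; apply/orP; left; apply/eqP; ring.
Qed.

(** The term [2^-1 * ...] is the second order part of [2^-1 * vop V (vop V f)]
    when [h] is the value of [V]; this is why the sum is kept in this form. *)
Lemma taylor2 f (l : R) : smooth f -> (forall i, smooth (pd i f)) ->
  0 <= l -> (forall i j, holder 1 l (pd j (pd i f))) ->
  forall x h, `|f (x + h) - f x - grad f x h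
     - 2^-1 * (\sum_i h 0 i * grad (pd i f) x h)| <= m%:R ^+ 2 * (l * `|h| ^+ 3).
Proof.
move=> sf sdf l0 Hl x h.
pose Q := \sum_i h 0 i * grad (pd i f) x h.
have := @MVT_bound
  (fun s => (f (x + s *: h) - f x - s * grad f x h) - (2^-1 * Q) * (s * s))
  (fun s => (grad f (x + s *: h) h - grad f x h) - s * Q).
rewrite !scale1r !seg0 !mul1r !mul0r !subrr !mulr0 mulr1 !subr0.
apply => [t|t t01].
  apply: is_derive_sub_fun; first exact: is_derive_scaled.
  have -> : (fun s => 2^-1 * Q * (s * s) : R^o) = (2^-1 * Q) *: ((id : R -> R^o) * (id : R -> R^o)).
    by apply/funext => s.
  by apply: is_derive_eq; rewrite /GRing.scale /=; field.
have /andP[t0 t1] := t01.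
have -> : grad f (x + t *: h) h - grad f x h - t * Q =
  \sum_i h 0 i * (pd i f (x + t *: h) - pd i f x - grad (pd i f) x (t *: h)).
  rewrite /Q mulr_sumr -!sumrB; apply: eq_bigr => i _; rewrite gradZ; ring.
have -> : m%:R ^+ 2 * (l * `|h| ^+ 3) = m%:R * (`|h| * (m%:R * (l * `|h| * `|h|))) :> R by ring.
apply: sum_const_le => i; rewrite normrM; apply: ler_pM => //; first exact: rV_coord_le.
have th : `|t *: h| <= `|h| by rewrite normrZ ger0_norm// ler_piMl.
apply: le_trans (smooth_taylor1 (sdf i) ler01 l0 (Hl i) x th) _.
rewrite powRr1//; apply: ler_wpM2l => //; apply: ler_wpM2l => //.
by rewrite mulr_ge0.
Qed.

End Calculus.

(** * Almost flows: uniform estimates *)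

Section PathSplit.
Context {R : realType}.
Implicit Types (s t c : R) (l : seq R).

Lemma path_le_last s l : path <=%R s l -> s <= last s l.
Proof.
elim: l s => [//|u l IH] s /= /andP[su ul]; exact: le_trans su (IH _ ul).
Qed.

(** Taken with [c] the midpoint of the interval, this cuts a partition into two
    parts, each at most half as long, and one step between them, which straddles
    the midpoint. *)
Lemma path_split s c l : path <=%R s l -> l != [::] -> s <= c -> c <= last s l ->
  exists l1 u l2, [/\ l = l1 ++ u :: l2, last s l1 <= c & c <= u].
Proof.
elim: l s => [//|v l IH] s /= /andP[sv vl] _ sc cl.
have [cv|vc] := leP c v; first by exists [::], v, l.
case: l => [|w l] in IH vl cl *; first by move: cl vc => /= ; lra.
have [l1 [u [l2 [E H1 H2]]]] := IH v vl isT (ltW vc) cl.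
by exists (v :: l1), u, l2; rewrite E.
Qed.
End PathSplit.

Lemma powR_le1 (R : realType) (h q : R) : 0 <= h -> h <= 1 -> 0 <= q -> h `^ q <= 1.
Proof.
move=> h0 h1 q0; have -> : 1 = 1 `^ q :> R by rewrite powR1.
by apply: ge0_ler_powR; rewrite ?nnegrE.
Qed.

Lemma small_powR (R : realType) (c q eta : R) : 0 <= c -> 0 < q -> 0 < eta ->
  exists2 d : R, 0 < d <= 1 & forall h, 0 <= h <= d -> c * h `^ q <= eta.
Proof.
move=> c0 q0 e0; pose d := Num.min 1 ((eta / (c + 1)) `^ q^-1).
have b0 : 0 < eta / (c + 1) by rewrite divr_gt0//; lra.
exists d; first by rewrite lt_min ltr01 powR_gt0//= ge_min lexx.
move=> h /andP[h0 hd].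
have : h `^ q <= eta / (c + 1).
  have -> : eta / (c + 1) = ((eta / (c + 1)) `^ q^-1) `^ q.
    by rewrite -powRrM mulVf ?gt_eqF// powRr1// ltW.
  apply: ge0_ler_powR; rewrite ?nnegrE ?powR_ge0//; first exact: ltW.
  by apply: le_trans hd _; rewrite ge_min lexx orbT.
move=> H; apply: le_trans (ler_wpM2l c0 H) _.
rewrite mulrA ler_pdivrMr; last by lra.
have := ltW e0; nra.
Qed.

(** Bookkeeping for the step [v, w] that straddles the midpoint of [s, t],
    gathered in one lemma since every induction below cuts an interval in this
    way. *)
Lemma mid_times (R : realType) (a b s v w t delta : R) : a <= s -> t <= b ->
  t - s <= delta -> delta <= 1 -> s <= v -> v <= w -> w <= t ->
  v <= (s + t) / 2 -> (s + t) / 2 <= w ->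
  ([/\ s <= t, s <= v, v <= w, w <= t & t - s <= 1]
    /\ [/\ a <= v, v <= t, a <= w, v <= b & w <= b]) /\
  ([/\ v - s <= delta, w - v <= delta, t - w <= delta, t - v <= 1 &
      [/\ 0 <= v - s, 0 <= t - w, v - s <= (t - s) / 2 & t - w <= (t - s) / 2]]
    /\ [/\ v - s <= t - s, w - v <= t - s, t - w <= t - s, t - v <= t - s & 0 <= t - s]).
Proof. by move=> *; split; split; split; try split; lra. Qed.

Section AlmostFlow.
Context {R : realType} {E : normedModType R}.
Implicit Types (x y : E) (s t u : R) (l : seq R).

Fixpoint compose (mu : R -> R -> E -> E) s l x : E :=
  if l is u :: l' then compose mu u l' (mu s u x) else x.

Lemma compose_cat mu s l1 l2 x :
  compose mu s (l1 ++ l2) x = compose mu (last s l1) l2 (compose mu s l1 x).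
Proof. by elim: l1 s x => //= u l1 IH s x; rewrite IH. Qed.

(** Two-parameter maps that compose up to errors of order [al > 1] in the supremum
    norm and of order [al * r > 1] in the Lipschitz seminorm. The four-point
    condition says that [mu s t - id] has a derivative that is small and
    [r]-Hoelder; with errors of order [al] in the positions it produces errors of
    order [al * r] in the differences, hence the second exponent. For a rough
    driver [al] is [3 / p] and [r] is [rho], so [1 < al * r] is the hypothesis [p
    / 3 < rho]. *)
Record almost_flow (a b q al r K : R) (mu : R -> R -> E -> E) : Prop := AlmostFlow {
  af_id : forall s x, a <= s -> s <= b -> mu s s x = x;
  af_near : forall s t x, a <= s -> s <= t -> t <= b -> t - s <= 1 ->
    `|mu s t x - x| <= K * (t - s) `^ q;
  af_lip : forall s t x y, a <= s -> s <= t -> t <= b -> t - s <= 1 ->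
    `|mu s t x - mu s t y| <= (1 + K * (t - s) `^ q) * `|x - y|;
  af_4pt : forall s t x y x' y' z, a <= s -> s <= t -> t <= b -> t - s <= 1 ->
    `|x - x'| <= z -> `|y - y'| <= z ->
    `|(mu s t x - mu s t y) - (mu s t x' - mu s t y')|
      <= (1 + K * (t - s) `^ q) * `|(x - y) - (x' - y')| + K * `|x - y| * z `^ r;
  af_def : forall s u t x, a <= s -> s <= u -> u <= t -> t <= b -> t - s <= 1 ->
    `|mu u t (mu s u x) - mu s t x| <= K * (t - s) `^ al;
  af_dlip : forall s u t x y, a <= s -> s <= u -> u <= t -> t <= b -> t - s <= 1 ->
    `|(mu u t (mu s u x) - mu s t x) - (mu u t (mu s u y) - mu s t y)|
      <= K * (t - s) `^ (al * r) * `|x - y| }.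

(** Compositions over an arbitrary partition of a short interval stay close to the
    one-step map. Halving an interval multiplies its [al * r]-th power by at most
    [P]; the two halves, transported through further steps that expand distances by
    at most [1 + eta], together cost a factor [2 * P * (1 + eta) ^+ 3 <= rr < 1],
    and what remains of the constant absorbs the new errors. *)
Section ShortTime.
Variables (a b q al r K : R) (mu : R -> R -> E -> E) (P eta rr C1 G C2 delta : R).
Hypotheses (r0 : 0 < r) (be1 : 1 < al * r) (K0 : 0 <= K).
Hypothesis (F : almost_flow a b q al r K mu).
Hypotheses (al1 : 1 < al) (be_al : al * r <= al).
Hypotheses (P0 : 0 < P) (P1 : 2 * P < 1) (eta_bounds : 0 < eta <= 2^-1).
Hypotheses (eta_rr : 2 * P * (1 + eta) ^+ 3 <= rr).
Hypothesis halfpow : forall e h h' : R,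
  al * r <= e -> 0 <= h' -> h' <= h / 2 -> h' `^ e <= P * h `^ e.
Hypotheses (C1_ge0 : 0 <= C1) (C1E : C1 * rr + 2 * K = C1).
Hypotheses (d01 : 0 < delta <= 1) (dK : forall h, 0 <= h <= delta -> K * h `^ q <= eta).

Let P_le1 : P <= 1.
Proof. by have := P0; have := P1; lra. Qed.

Let eta_le1 : eta <= 1.
Proof. by have /andP[_ h] := eta_bounds; lra. Qed.

Let eta1_le2 : 1 + eta <= 2.
Proof. by have := eta_le1; lra. Qed.

Let eta_two : 2 * (1 + eta) ^+ 2 * P <= rr.
Proof.
have /andP[e0 e1] := eta_bounds.
apply: le_trans eta_rr; rewrite [leRHS](_ : _ = 2 * (1 + eta) ^+ 2 * P * (1 + eta)); last by ring.
by rewrite ler_peMr// ?lerDl ?ltW// mulr_gt0// mulr_gt0// exprn_gt0//; lra.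
Qed.

Let short_lip s t x y : a <= s -> s <= t -> t <= b -> t - s <= delta ->
  `|mu s t x - mu s t y| <= (1 + eta) * `|x - y|.
Proof.
move=> as_ st tb td; have /andP[d0 d1] := d01.
apply: le_trans (af_lip F x y as_ st tb (le_trans td d1)) _.
by apply: ler_wpM2r => //; rewrite lerD2l dK// subr_ge0 st.
Qed.

Let short_4pt s t x y x' y' z : a <= s -> s <= t -> t <= b -> t - s <= delta ->
    `|x - x'| <= z -> `|y - y'| <= z ->
    `|(mu s t x - mu s t y) - (mu s t x' - mu s t y')|
      <= (1 + eta) * `|(x - y) - (x' - y')| + K * `|x - y| * z `^ r.
Proof.
move=> as_ st tb td xz yz; have /andP[d0 d1] := d01.
apply: le_trans (af_4pt F as_ st tb (le_trans td d1) xz yz) _.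
by apply: lerD => //; apply: ler_wpM2r => //; rewrite lerD2l dK// subr_ge0 st.
Qed.

Let split3 n s l : (size l <= n.+1)%N -> path <=%R s l -> l != [::] ->
  a <= s -> last s l <= b -> last s l - s <= delta ->
  exists l1 v w l2, let t := last s l in [/\ l = l1 ++ w :: l2, v = last s l1 /\ last w l2 = t,
    [/\ path <=%R s l1, path <=%R w l2, (size l1 <= n)%N & (size l2 <= n)%N],
    [/\ s <= t, s <= v, v <= w, w <= t & t - s <= 1]
    /\ [/\ a <= v, v <= t, a <= w, v <= b & w <= b] &
    [/\ v - s <= delta, w - v <= delta, t - w <= delta, t - v <= 1 &
      [/\ 0 <= v - s, 0 <= t - w, v - s <= (t - s) / 2 & t - w <= (t - s) / 2]]
    /\ [/\ v - s <= t - s, w - v <= t - s, t - w <= t - s, t - v <= t - s & 0 <= t - s]].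
Proof.
move=> sz pl l0 as_ lb ld; have st := path_le_last pl; have /andP[d0 d1] := d01.
have [||l1 [w [l2 [lE H1 H2]]]] := @path_split _ s ((s + last s l) / 2) l pl l0; try lra.
exists l1, (last s l1), w, l2; move: (pl); rewrite lE cat_path /= => /and3P[p1 p2 p3].
have sv := path_le_last p1; have wt := path_le_last p3.
have tE : last w l2 = last s l by rewrite lE last_cat.
rewrite tE in wt; rewrite -lE.
have [? ?] := mid_times as_ lb ld d1 sv p2 wt H1 H2.
split => //=; split => //; move: sz;
  by rewrite lE size_cat /= addnS ltnS => H; apply: leq_trans H; rewrite ?leq_addr ?leq_addl.
Qed.

(** Induction on the number of steps: the two halves contribute at most [rr] times
    the bound and the two defects contribute [2 * K], which [C1E] makes fit. *)
Lemma compose_near n s l x : (size l <= n)%N -> a <= s -> path <=%R s l -> last s l <= b ->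
  last s l - s <= delta ->
  `|compose mu s l x - mu s (last s l) x| <= C1 * (last s l - s) `^ al.
Proof.
elim: n s l x => [|n IH] s l x sz as_ pl lb ld.
  move: sz lb; rewrite leqn0 size_eq0 => /eqP -> /= sb.
  by rewrite (af_id F) // subrr normr0 mulr_ge0// powR_ge0.
have [l0|l0] := eqVneq l [::].
  by move: lb; rewrite l0 /= => sb; rewrite (af_id F) // subrr normr0 mulr_ge0// powR_ge0.
have [l1 [v [w [l2 [lE [vE lt] [p1 p2 s1 s2]
  [[st sv vw wt t1] [av vt aw vb wb]] [[vd wd td tv1 [hv0 hw0 hv hw]] [hv1 hw1 htw htv h0]]]]]]] :=
  split3 sz pl l0 as_ lb ld.
set t := last s l in lb ld lt wt hv hw st t1 vt td tv1 hw0 hv1 hw1 htw htv h0 *.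
set h := t - s in ld hv hw t1 hv1 hw1 htw htv h0 *.
have e1p : 0 <= 1 + eta by have /andP[e0 e1] := eta_bounds; rewrite addr_ge0 // ltW.
have al0 : 0 <= al by apply: ltW; exact: lt_trans al1.
have /andP[d0 d1] := d01.
have /andP[e0 e1] := eta_bounds.
rewrite lE compose_cat /= -vE.
set X1 := compose mu s l1 x; set X2 := mu v w X1.
set Y1 := mu s v x.
have B1 : `|X1 - Y1| <= C1 * (P * h `^ al).
  have := IH s l1 x s1 as_ p1; rewrite -vE -/X1 -/Y1 => H.
  apply: le_trans (H _ _) _ => //.
  by apply: ler_wpM2l => //; exact: halfpow.
have B2 : `|mu v w X1 - mu v w Y1| <= (1 + eta) * (C1 * (P * h `^ al)).
  apply: le_trans (short_lip _ _ _ _ _ _) _ => //.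
  exact: ler_wpM2l.
have B3 : `|mu w t X2 - mu w t (mu v w Y1)| <= (1 + eta) * ((1 + eta) * (C1 * (P * h `^ al))).
  apply: le_trans (short_lip _ _ _ _ _ _) _ => //.
  exact: ler_wpM2l.
have B4 : `|compose mu w l2 X2 - mu w t X2| <= C1 * (P * h `^ al).
  have := IH w l2 X2 s2; rewrite lt => H.
  apply: le_trans (H _ _ _ _) _ => //.
  by apply: ler_wpM2l => //; exact: halfpow.
have B5 : `|mu w t (mu v w Y1) - mu v t Y1| <= K * h `^ al.
  apply: le_trans (af_def F _ _ _ _ _ _) _ => //.
  by apply: ler_wpM2l => //; apply: ge0_ler_powR => //; rewrite nnegrE // subr_ge0.
have B6 : `|mu v t Y1 - mu s t x| <= K * h `^ al.
  exact: (af_def F).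
set T := h `^ al in B1 B2 B3 B4 B5 B6 *.
have T0 : 0 <= T by exact: powR_ge0.
have -> : compose mu w l2 X2 - mu s t x = (compose mu w l2 X2 - mu w t X2)
  + (mu w t X2 - mu w t (mu v w Y1)) + (mu w t (mu v w Y1) - mu v t Y1)
  + (mu v t Y1 - mu s t x).
  by rewrite !addrA !subrK.
apply: le_trans (ler_normD _ _) _; apply: le_trans (lerD (ler_normD _ _) (lexx _)) _.
apply: le_trans (lerD (lerD (ler_normD _ _) (lexx _)) (lexx _)) _.
apply: le_trans (lerD (lerD (lerD B4 B3) B5) B6) _.
rewrite -[in leRHS]C1E.
have Q0 : 0 <= C1 * T by rewrite mulr_ge0.
have H1 : P + (1 + eta) * (1 + eta) * P <= rr.
  apply: le_trans eta_two.
  have := mulr_ge0 (ltW P0) (ltW e0).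
  have := mulr_ge0 (ltW P0) (mulr_ge0 (ltW e0) (ltW e0)).
  by rewrite expr2; lra.
have := ler_wpM2r Q0 H1; lra.
Qed.

Hypotheses (C2_ge0 : 0 <= C2) (G0 : 0 <= G) (C2E : C2 * rr + (16 * K * G + 3 * K) = C2).
Hypothesis dC : forall h, 0 <= h <= delta -> C2 * h `^ (al * r) <= eta.

Hypothesis powG : forall c h : R, 0 <= c -> c <= 2 -> 0 <= h ->
  (c * (C1 * h `^ al)) `^ r <= G * h `^ (al * r).

(** The same induction as in [compose_near], for the difference of two
    trajectories. By [compose_near] the composed positions are within [C1 * h `^
    al] of the one-step positions, and the four-point condition turns this into [h
    `^ (al * r)] times the distance of the starting points. *)
Lemma compose_diff n s l x y : (size l <= n)%N -> a <= s -> path <=%R s l -> last s l <= b ->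
  last s l - s <= delta ->
  `|(compose mu s l x - compose mu s l y) - (mu s (last s l) x - mu s (last s l) y)|
    <= C2 * (last s l - s) `^ (al * r) * `|x - y|.
Proof.
elim: n s l x y => [|n IH] s l x y sz as_ pl lb ld.
  move: sz lb; rewrite leqn0 size_eq0 => /eqP -> /= sb.
  by rewrite !(af_id F) // subrr normr0 !mulr_ge0// powR_ge0.
have [l0|l0] := eqVneq l [::].
  by move: lb; rewrite l0 /= => sb; rewrite !(af_id F) // subrr normr0 !mulr_ge0// powR_ge0.
have [l1 [v [w [l2 [lE [vE lt] [p1 p2 s1 s2]
  [[st sv vw wt t1] [av vt aw vb wb]] [[vd wd td tv1 [hv0 hw0 hv hw]] [hv1 hw1 htw htv h0]]]]]]] :=
  split3 sz pl l0 as_ lb ld.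
set t := last s l in lb ld lt wt hv hw st t1 vt td tv1 hw0 hv1 hw1 htw htv h0 *.
set h := t - s in ld hv hw t1 hv1 hw1 htw htv h0 *.
have e1p : 0 <= 1 + eta by have /andP[e0 e1] := eta_bounds; rewrite addr_ge0 // ltW.
have al0 : 0 <= al by apply: ltW; exact: lt_trans al1.
have /andP[d0 d1] := d01.
have /andP[e0 e1] := eta_bounds.
have be0 : 0 <= al * r by apply: ltW; apply: lt_trans be1.
rewrite lE !compose_cat /= -vE.
set M := `|x - y|.
set X1 := compose mu s l1 x; set X2 := mu v w X1; set X3 := mu w t X2.
set Y1 := compose mu s l1 y; set Y2 := mu v w Y1; set Y3 := mu w t Y2.
set X0 := mu s v x; set Y0 := mu s v y.
have M0 : 0 <= M by exact: normr_ge0.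
have near1 z : `|compose mu s l1 z - mu s v z| <= C1 * h `^ al.
  have := @compose_near n s l1 z s1 as_ p1; rewrite -vE => H.
  apply: le_trans (H _ _) _ => //.
  by apply: ler_wpM2l => //; apply: ge0_ler_powR => //; rewrite nnegrE // subr_ge0.
have D1 : `|(X1 - Y1) - (X0 - Y0)| <= C2 * (P * h `^ (al * r)) * M.
  have := IH s l1 x y s1 as_ p1; rewrite -vE => H.
  apply: le_trans (H _ _) _ => //.
  by apply: ler_wpM2r => //; apply: ler_wpM2l => //; exact: halfpow.
have L0 : `|X0 - Y0| <= (1 + eta) * M by apply: short_lip => //; lra.
have Cbe : C2 * (P * h `^ (al * r)) <= eta.
  apply: le_trans (dC (h := h) _); last by rewrite h0 ld.
  by apply: ler_wpM2l => //; rewrite ler_piMl ?powR_ge0.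
have L1 : `|X1 - Y1| <= (1 + 2 * eta) * M.
  have -> : X1 - Y1 = (X0 - Y0) + ((X1 - Y1) - (X0 - Y0)) by rewrite subrKC.
  apply: le_trans (ler_normD _ _) _; apply: le_trans (lerD L0 D1) _.
  have := ler_wpM2r M0 Cbe; lra.
have L2 : `|X2 - Y2| <= (1 + eta) * ((1 + 2 * eta) * M).
  apply: le_trans (short_lip _ _ _ _ _ _) _ => //.
  exact: ler_wpM2l.
have eeM : eta * M <= M by rewrite ler_piMl.
have eeM2 := le_trans (ler_wpM2l (ltW e0) eeM) eeM.
set T := h `^ (al * r) in D1 Cbe *.
have T0 : 0 <= T by exact: powR_ge0.
have KGT0 : 0 <= K * (G * T) by rewrite !mulr_ge0.
have D2 : `|(X2 - Y2) - (mu v w X0 - mu v w Y0)| <=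
    (1 + eta) * (C2 * (P * T) * M) + 3 * M * (K * (G * T)).
  have n1 z : `|compose mu s l1 z - mu s v z| <= 1 * (C1 * h `^ al) by rewrite mul1r.
  apply: le_trans (short_4pt _ _ _ _ (n1 x) (n1 y)) _ => //.
  apply: lerD; first exact: ler_wpM2l.
  have L1' : `|X1 - Y1| <= 3 * M by lra.
  rewrite (_ : 3 * M * (K * (G * T)) = K * (3 * M) * (G * T)); last by ring.
  apply: ler_pM; rewrite ?mulr_ge0 ?powR_ge0//; first by apply: ler_wpM2l.
  by apply: powG => //; rewrite ler1n.
have D3 : `|(X3 - Y3) - (mu w t (mu v w X0) - mu w t (mu v w Y0))| <=
    (1 + eta) * ((1 + eta) * (C2 * (P * T) * M) + 3 * M * (K * (G * T))) + 10 * M * (K * (G * T)).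
  have n2 z : `|mu v w (compose mu s l1 z) - mu v w (mu s v z)| <= (1 + eta) * (C1 * h `^ al).
    apply: le_trans (short_lip _ _ _ _ _ _) _ => //.
    exact: ler_wpM2l.
  apply: le_trans (short_4pt _ _ _ _ (n2 x) (n2 y)) _ => //.
  apply: lerD; first exact: ler_wpM2l.
  have L2' : `|X2 - Y2| <= 10 * M by lra.
  rewrite (_ : 10 * M * (K * (G * T)) = K * (10 * M) * (G * T)); last by ring.
  apply: ler_pM; rewrite ?mulr_ge0 ?powR_ge0//; first by apply: ler_wpM2l.
  exact: powG.
have D4 : `|(compose mu w l2 X2 - compose mu w l2 Y2) - (X3 - Y3)| <=
    C2 * (P * T) * ((1 + eta) * ((1 + 2 * eta) * M)).
  have := IH w l2 X2 Y2 s2; rewrite lt => H.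
  apply: le_trans (H _ _ _ _) _ => //.
  apply: ler_pM; rewrite ?mulr_ge0 ?powR_ge0//.
  by apply: ler_wpM2l => //; exact: halfpow.
have D5 : `|(mu w t (mu v w X0) - mu v t X0) - (mu w t (mu v w Y0) - mu v t Y0)|
    <= 2 * (K * T * M).
  apply: le_trans (af_dlip F _ _ _ _ _ _ _) _ => //.
  rewrite (_ : 2 * (K * T * M) = K * T * (2 * M)); last by ring.
  apply: ler_pM; rewrite ?mulr_ge0 ?powR_ge0//; last first.
    by apply: le_trans L0 _; apply: ler_wpM2r.
  by apply: ler_wpM2l => //; apply: ge0_ler_powR => //; rewrite nnegrE // subr_ge0.
have D6 : `|(mu v t X0 - mu s t x) - (mu v t Y0 - mu s t y)| <= K * T * M.
  exact: (af_dlip F).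
have -> : (compose mu w l2 X2 - compose mu w l2 Y2) - (mu s t x - mu s t y) =
  ((compose mu w l2 X2 - compose mu w l2 Y2) - (X3 - Y3))
  + ((X3 - Y3) - (mu w t (mu v w X0) - mu w t (mu v w Y0)))
  + ((mu w t (mu v w X0) - mu v t X0) - (mu w t (mu v w Y0) - mu v t Y0))
  + ((mu v t X0 - mu s t x) - (mu v t Y0 - mu s t y)).
  have swap (c1 c2 c3 c4 : E) : c1 - c2 - (c3 - c4) = c1 - c3 - (c2 - c4).
    by rewrite !opprD !opprK addrACA.
  by rewrite (swap _ (mu v t X0)) (swap _ (mu s t x)) !subrKA.
apply: le_trans (ler_normD _ _) _; apply: le_trans (lerD (ler_normD _ _) (lexx _)) _.
apply: le_trans (lerD (lerD (ler_normD _ _) (lexx _)) (lexx _)) _.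
apply: le_trans (lerD (lerD (lerD D4 D3) D5) D6) _.
rewrite -[in leRHS]C2E.
have Q0 : 0 <= C2 * T * M by rewrite !mulr_ge0.
have H1 : P * ((1 + eta) * (1 + 2 * eta)) + P * ((1 + eta) * (1 + eta)) <= rr.
  apply: le_trans eta_rr.
  have := mulr_ge0 (ltW P0) (ltW e0).
  have := mulr_ge0 (ltW P0) (mulr_ge0 (ltW e0) (ltW e0)).
  have := mulr_ge0 (ltW P0) (mulr_ge0 (ltW e0) (mulr_ge0 (ltW e0) (ltW e0))).
  by rewrite !exprS expr0; lra.
have H2 := ler_wpM2r Q0 H1.
have KM : 0 <= K * (G * T) * M by rewrite mulr_ge0.
have ek : eta * (K * (G * T) * M) <= K * (G * T) * M by rewrite ler_piMl.
have -> : (C2 * rr + (16 * K * G + 3 * K)) * T * M =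
   rr * (C2 * T * M) + (16 * (K * (G * T) * M) + 3 * (K * T * M)) by ring.
have -> : C2 * (P * T) * ((1 + eta) * ((1 + 2 * eta) * M)) +
   ((1 + eta) * ((1 + eta) * (C2 * (P * T) * M) + 3 * M * (K * (G * T))) +
    10 * M * (K * (G * T))) + 2 * (K * T * M) + K * T * M
  = (P * ((1 + eta) * (1 + 2 * eta)) + P * ((1 + eta) * (1 + eta))) * (C2 * T * M)
    + 13 * (K * (G * T) * M) + 3 * (eta * (K * (G * T) * M)) + 3 * (K * T * M) by ring.
lra.
Qed.

Lemma compose_lip2 s l x y : a <= s -> path <=%R s l -> last s l <= b ->
  last s l - s <= delta -> `|compose mu s l x - compose mu s l y| <= 2 * `|x - y|.
Proof.
move=> as_ pl lb ld; have H := @compose_diff (size l) s l x y (leqnn _) as_ pl lb ld.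
have sl := path_le_last pl.
have L : `|mu s (last s l) x - mu s (last s l) y| <= (1 + eta) * `|x - y|.
  by apply: short_lip.
set A := mu s _ x - _ in L H; set B := _ - compose mu s l y in H *.
have -> : B = A + (B - A) by rewrite subrKC.
apply: le_trans (ler_normD _ _) _; apply: le_trans (lerD L H) _.
rewrite -mulrDl; apply: ler_wpM2r => //.
have hd : 0 <= last s l - s <= delta by rewrite subr_ge0 sl.
have := dC hd.
have /andP[e0 e1] := eta_bounds; lra.
Qed.

End ShortTime.

Section Bounds.
Variables (a b q al r K : R) (mu : R -> R -> E -> E).
Hypotheses (q0 : 0 < q) (r0 : 0 < r) (r1 : r <= 1) (be1 : 1 < al * r) (K0 : 0 <= K).
Hypothesis (F : almost_flow a b q al r K mu).

Let al1 : 1 < al.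
Proof.
have al0 : 0 < al by rewrite -(pmulr_lgt0 _ r0); exact: lt_trans be1.
by apply: lt_le_trans be1 _; rewrite ler_piMr// ltW.
Qed.

(* With k = 2 * P < 1, one has (1 + eta)^3 <= 1 + 7 * eta for eta <= 1, and k *
   (1 + 7 * eta) <= k + (1 - k) / 2 = rr when 14 * eta = 1 - k. *)
Let P : R := 2^-1 `^ (al * r).
Let eta : R := (1 - 2 * P) / 14.
Let rr : R := (1 + 2 * P) / 2.

Let P_bounds : 0 < P /\ 2 * P < 1.
Proof.
split; first by rewrite powR_gt0.
have h2 : (0:R) < 2^-1 by rewrite invr_gt0 ltr0n.
rewrite /P -(mulr_powRB1 (ltW h2)); last exact: lt_trans be1.
have : 2^-1 `^ (al * r - 1) < 1 `^ (al * r - 1) :> R.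
  by apply: gt0_ltr_powR; rewrite ?nnegrE /= ?subr_gt0 ?invf_lt1 ?ltr1n ?ltr0n // ltW.
rewrite powR1; lra.
Qed.

Let eta_bounds : 0 < eta <= 2^-1.
Proof. by have [] := P_bounds; rewrite /eta => *; apply/andP; split; lra. Qed.

Let rr_lt1 : rr < 1.
Proof. by have [] := P_bounds; rewrite /rr => *; lra. Qed.

Let eta_rr : 2 * P * (1 + eta) ^+ 3 <= rr.
Proof.
have [P0 P1] := P_bounds; have /andP[e0 e1] := eta_bounds.
have H : (1 + eta) ^+ 3 <= 1 + 7 * eta.
  have -> : (1 + eta) ^+ 3 = 1 + 3 * eta + 3 * (eta * eta) + eta * (eta * eta) by ring.
  have h1 : eta * eta <= eta by apply: ler_piMr; lra.
  have h2 := le_trans (ler_wpM2l (ltW e0) h1) h1.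
  lra.
have P20 : 0 <= 2 * P by rewrite mulr_ge0// ltW.
apply: le_trans (ler_wpM2l P20 H) _.
  have : 2 * P * (7 * eta) <= 7 * eta by apply: ler_piMl; lra.
by rewrite mulrDr mulr1 => h; rewrite /rr /eta in h *; lra.
Qed.

Let halfpow (e h h' : R) : al * r <= e -> 0 <= h' -> h' <= h / 2 -> h' `^ e <= P * h `^ e.
Proof.
move=> ae h0 hh; have e0 : 0 <= e by apply: le_trans ae; apply: ltW; apply: lt_trans be1.
have hp : 0 <= h by lra.
have : h' `^ e <= (h / 2) `^ e by apply: ge0_ler_powR; rewrite ?nnegrE//; lra.
move=> H; apply: le_trans H _; rewrite powRM ?invr_ge0// mulrC ler_wpM2r ?powR_ge0//.
by rewrite /P; apply: ger_powR => //; rewrite invr_gt0 ltr0n /= invf_le1 ?ler1n ?ltr0n.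
Qed.

Let be_al : al * r <= al.
Proof. by rewrite ler_piMr// ltW// (lt_trans _ al1). Qed.

Let C1 : R := 2 * K / (1 - rr).

Let C1_ge0 : 0 <= C1.
Proof. by have := rr_lt1; rewrite /C1 => ?; rewrite divr_ge0 ?mulr_ge0//; lra. Qed.

Let C1E : C1 * rr + 2 * K = C1.
Proof. by have := rr_lt1; rewrite /C1 => ?; field; lra. Qed.

(** The constant 2 is arbitrary above 1; what matters is that the Lipschitz bound
    does not depend on the number of partition points. *)
Lemma compose_estimates : exists delta C : R, [/\ 0 < delta <= 1, 0 <= C,
  forall s l x, a <= s -> path <=%R s l -> last s l <= b -> last s l - s <= delta ->
    `|compose mu s l x - mu s (last s l) x| <= C * (last s l - s) `^ al
  & forall s l x y, a <= s -> path <=%R s l -> last s l <= b -> last s l - s <= delta ->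
    `|compose mu s l x - compose mu s l y| <= 2 * `|x - y|].
Proof.
have /andP[e0 _] := eta_bounds; have [P0 P1] := P_bounds.
pose G := (2 * C1) `^ r; pose C2 := (16 * K * G + 3 * K) / (1 - rr).
have rl := rr_lt1; have G0 : 0 <= G by exact: powR_ge0.
have C2_ge0 : 0 <= C2.
  apply: divr_ge0; last by lra.
  by apply: addr_ge0; [apply: mulr_ge0 => //; apply: mulr_ge0|apply: mulr_ge0].
have C2E : C2 * rr + (16 * K * G + 3 * K) = C2 by rewrite /C2; field; lra.
have powG c h : 0 <= c -> c <= 2 -> 0 <= h ->
  (c * (C1 * h `^ al)) `^ r <= G * h `^ (al * r).
  move=> c0 c2 h0; rewrite mulrA (powRM _ (mulr_ge0 c0 C1_ge0) (powR_ge0 _ _)).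
  rewrite powRrM; apply: ler_wpM2r; first exact: powR_ge0.
  apply: ge0_ler_powR; first exact: ltW.
  - by rewrite nnegrE; apply: mulr_ge0.
  - by rewrite nnegrE; apply: mulr_ge0.
  - exact: ler_wpM2r.
have [d1 d101 H1] := @small_powR R K q eta K0 q0 e0.
have [d2 d201 H2] := @small_powR R _ (al * r) eta C2_ge0 (lt_trans ltr01 be1) e0.
pose delta := Num.min d1 d2.
have dd : 0 < delta <= 1.
  move: d101 d201 => /andP[a1 b1] /andP[a2 b2].
  by rewrite /delta lt_min a1 a2 ge_min b1.
have dK h : 0 <= h <= delta -> K * h `^ q <= eta.
  by rewrite /delta le_min => /and3P[h0 hd _]; apply: H1; rewrite h0.
have dC h : 0 <= h <= delta -> C2 * h `^ (al * r) <= eta.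
  by rewrite /delta le_min => /and3P[h0 _ hd]; apply: H2; rewrite h0.
exists delta, C1; split => //.
- move=> s l x as_ pl lb ld.
  exact: (compose_near K0 F al1 be_al P0 eta_bounds eta_rr halfpow C1_ge0 C1E dd dK
          _ (leqnn (size l))).
- move=> s l x y.
  exact: (compose_lip2 be1 K0 F al1 be_al P0 P1 eta_bounds eta_rr halfpow C1_ge0 C1E
          dd dK C2_ge0 G0 C2E dC powG).
Qed.

End Bounds.
End AlmostFlow.

(** * The flow of an almost flow *)

Section Partitions.
Context {R : realType}.
Implicit Types (s t u v e : R) (l : seq R).

Definition step e : rel R := fun u v => (u <= v) && (v - u <= e).

Lemma step_path_le e s l : path (step e) s l -> path <=%R s l.
Proof. by apply: sub_path => u v /andP[]. Qed.

Lemma step_path_weaken e e' s l : e <= e' -> path (step e) s l -> path (step e') s l.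
Proof.
by move=> ee; apply: sub_path => u v /andP[uv ve]; rewrite /step uv (le_trans ve).
Qed.

Lemma path_le_all s l u : path <=%R s l -> u \in s :: l -> s <= u <= last s l.
Proof.
elim: l s => [|v l IH] s /=; first by rewrite inE => _ /eqP ->; rewrite lexx.
move=> /andP[sv vl]; rewrite inE => /orP[/eqP ->|/(IH _ vl)/andP[vu ->]].
  by rewrite lexx (le_trans sv)// path_le_last.
by rewrite (le_trans sv).
Qed.

Lemma path_le_lastE s l t : path <=%R s l -> t \in s :: l -> all (<=%R^~ t) l ->
  s <= t -> last s l = t.
Proof.
move=> sl tl /allP lt st; apply/eqP; rewrite eq_le.
have /andP[_ ->] := path_le_all sl tl; rewrite andbT.
by have := mem_last s l; rewrite inE => /orP[/eqP ->//|/lt].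
Qed.

Lemma subseq_cons_split u l l' : subseq (u :: l) l' ->
  exists l1 l2, l' = l1 ++ u :: l2 /\ subseq l l2.
Proof.
elim: l' => [//|v l' IH]; rewrite [subseq _ _]/=.
have [<- sub|uv /IH[l1 [l2 [-> sub]]]] := eqVneq; first by exists [::], l'.
by exists (v :: l1), l2.
Qed.

(** Sorting the concatenation keeps repeated points, which are harmless because a
    step of length zero is the identity. *)
Lemma common_refinement s l1 l2 : path <=%R s l1 -> path <=%R s l2 ->
  last s l1 = last s l2 -> exists l, [/\ path <=%R s l, last s l = last s l1,
    subseq l1 l & subseq l2 l].
Proof.
move=> p1 p2 l12; exists (sort <=%R (l1 ++ l2)).
have tot : total (<=%R : rel R) by exact: le_total.
have B u : u \in l1 ++ l2 -> s <= u <= last s l1.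
  rewrite mem_cat => /orP[] ul; [|rewrite l12].
    by apply: path_le_all p1 _; rewrite inE ul orbT.
  by apply: path_le_all p2 _; rewrite inE ul orbT.
have P : path <=%R s (sort <=%R (l1 ++ l2)).
  rewrite path_sortedE; last exact: le_trans.
  rewrite (sort_sorted tot) andbT; apply/allP => u; rewrite mem_sort => /B /andP[]//.
split=> //.
- apply: path_le_lastE => //.
  + rewrite inE mem_sort mem_cat; have := mem_last s l1; rewrite inE.
    by case/orP => ->; rewrite ?orbT.
  + by apply/allP => u; rewrite mem_sort => /B /andP[].
  + exact: path_le_last.
- apply: sorted_subseq_sort => //; [exact: le_trans|exact: prefix_subseq|exact: path_sorted p1].
- apply: sorted_subseq_sort => //; [exact: le_trans|exact: suffix_subseq|exact: path_sorted p2].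
Qed.

Definition uniform_part s t (n : nat) : seq R :=
  [seq s + (t - s) * (k.+1%:R / n.+1%:R) | k <- iota 0 n.+1].

Lemma uniform_part_last s t n : last s (uniform_part s t n) = t.
Proof.
rewrite /uniform_part -[X in iota _ X]addn1 iotaD map_cat last_cat /= add0n.
by rewrite divff ?pnatr_eq0// mulr1 subrKC.
Qed.

Lemma uniform_part_path s t n : s <= t -> path (step ((t - s) / n.+1%:R)) s (uniform_part s t n).
Proof.
move=> st; apply/(pathP s) => i; rewrite size_map size_iota => iltn.
have N0 : n.+1%:R != 0 :> R by rewrite pnatr_eq0.
have E (j : nat) : (j <= n.+1)%N -> nth s (s :: uniform_part s t n) j = s + (t - s) * (j%:R / n.+1%:R).
  case: j => [|j] jn; first by rewrite mul0r mulr0 addr0.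
  by rewrite /= (nth_map 0%N) ?size_iota// nth_iota.
have -> : nth s (uniform_part s t n) i = nth s (s :: uniform_part s t n) i.+1 by [].
rewrite !E//; last exact: ltnW.
have -> : i.+1%:R = i%:R + 1 :> R by rewrite -natr1.
have d0 : 0 <= (t - s) / n.+1%:R by rewrite divr_ge0// subr_ge0.
rewrite /step -subr_ge0.
rewrite (_ : _ - _ = (t - s) / n.+1%:R); first by rewrite d0 lexx.
by field; rewrite addrC natr1.
Qed.
End Partitions.

Section Refinement.
Context {R : realType} {E : normedModType R}.
Variables (a b al C delta : R) (mu : R -> R -> E -> E).
Hypotheses (al1 : 1 < al) (d01 : 0 < delta <= 1) (C0 : 0 <= C).
Hypothesis mu_id : forall s x, a <= s -> s <= b -> mu s s x = x.
Hypothesis near_mu : forall s l x, a <= s -> path <=%R s l -> last s l <= b ->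
  last s l - s <= delta -> `|compose mu s l x - mu s (last s l) x| <= C * (last s l - s) `^ al.
Hypothesis lip_mu : forall s l x y, a <= s -> path <=%R s l -> last s l <= b ->
  last s l - s <= delta -> `|compose mu s l x - compose mu s l y| <= 2 * `|x - y|.
Implicit Types (x y : E) (s t u v e : R) (l : seq R).

(** Each block of length at least [delta / 2] and at most [delta] costs a factor
    2; a mesh at most [delta / 2] guarantees that such blocks can be cut off. *)
Lemma compose_lip_long N s l x y : a <= s -> path (step (delta / 2)) s l -> last s l <= b ->
  last s l - s <= N%:R * (delta / 2) ->
  `|compose mu s l x - compose mu s l y| <= 2 ^+ N.+1 * `|x - y|.
Proof.
have /andP[d0 d1] := d01.
elim: N s l x y => [|N IH] s l x y as_ pl lb ls.
  by rewrite expr1; apply: lip_mu => //; [exact: step_path_le pl|lra].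
have pl' := step_path_le pl.
have [lsd|lsd] := leP (last s l - s) delta.
  apply: le_trans (lip_mu _ _ as_ pl' lb lsd) _; apply: ler_wpM2r => //.
  by rewrite exprS ler_peMr// exprn_ege1// ler1n.
have l0 : l != [::] by apply/eqP => l0; move: lsd; rewrite l0 /= subrr; lra.
have [||l1 [u [l2 [lE lc cu]]]] := @path_split _ s (s + delta / 2) l pl' l0; try lra.
move: pl lb ls; rewrite lE cat_path /= => /and3P[p1 /andP[ul1 ul2] p2].
rewrite last_cat /= => lb ls.
rewrite -cat_rcons compose_cat compose_cat last_rcons.
have ul := path_le_last (step_path_le p2).
have sl1 := path_le_last (step_path_le p1).
have p1' : path <=%R s (rcons l1 u) by rewrite rcons_path (step_path_le p1).
apply: le_trans (IH _ _ _ _ _ p2 lb _) _; [lra| |].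
  by move: ls; rewrite -natr1; lra.
rewrite [leRHS](_ : _ = 2 ^+ N.+1 * (2 * `|x - y|)); last by rewrite exprSr mulrA.
rewrite ler_wpM2l ?exprn_ge0//; apply: lip_mu; rewrite ?last_rcons //; lra.
Qed.

Lemma compose_lip : exists2 L, 0 <= L & forall s l x y, a <= s ->
  path (step (delta / 2)) s l -> last s l <= b ->
  `|compose mu s l x - compose mu s l y| <= L * `|x - y|.
Proof.
have /andP[d0 d1] := d01.
pose N := (Num.truncn ((b - a) / (delta / 2))).+1.
exists (2 ^+ N.+1); first by rewrite exprn_ge0.
move=> s l x y as_ pl lb; apply: compose_lip_long => //.
have : (b - a) / (delta / 2) < N%:R by exact: truncnS_gt.
rewrite ltr_pdivrMr; lra.
Qed.

Lemma powR_step h e : 0 <= h -> h <= e -> h `^ al <= e `^ (al - 1) * h.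
Proof.
move=> h0 he; rewrite -(@mulr_powRB1 _ h)//; last by apply: lt_trans al1.
rewrite mulrC; apply: ler_wpM2r => //; apply: ge0_ler_powR; rewrite ?nnegrE ?subr_ge0 //.
  exact: ltW.
exact: le_trans he.
Qed.

Section WithLip.
Variable L : R.
Hypotheses (L0 : 0 <= L) (lip : forall s l x y, a <= s ->
  path (step (delta / 2)) s l -> last s l <= b ->
  `|compose mu s l x - compose mu s l y| <= L * `|x - y|).

(** Telescoping: replacing the chain by the scheme one step at a time, each
    replacement costs the local error times the uniform Lipschitz constant, and
    the local errors sum to [e `^ (al - 1)] times the length. *)
Lemma chain_compose C' e (y : R -> E) s l : 0 <= C' -> e <= delta / 2 -> a <= s ->
  path (step e) s l -> last s l <= b ->
  (forall u v, s <= u -> u <= v -> v <= last s l -> v - u <= e ->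
     `|y v - mu u v (y u)| <= C' * (v - u) `^ al) ->
  `|y (last s l) - compose mu s l (y s)| <= L * (C' * (e `^ (al - 1) * (last s l - s))).
Proof.
move=> C'0 ed; elim: l s => [|u l IH] s as_ /=.
  by rewrite !subrr normr0 !mulr0.
move=> /andP[/andP[su ue] pl] lb H.
have ul := path_le_last (step_path_le pl).
have -> : y (last u l) - compose mu u l (mu s u (y s)) =
  (y (last u l) - compose mu u l (y u)) + (compose mu u l (y u) - compose mu u l (mu s u (y s))).
  by rewrite subrKA.
apply: le_trans (ler_normD _ _) _.
have H1 := IH u (le_trans as_ su) pl lb
  (fun u' v' uu uv vl ve => H _ _ (le_trans su uu) uv vl ve).
have H2 := lip (y u) (mu s u (y s)) (le_trans as_ su) (step_path_weaken ed pl) lb.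
have H3 := H _ _ (lexx s) su ul ue.
have H4 := @powR_step (u - s) e _ ue; rewrite subr_ge0 in H4.
have H5 := ler_wpM2l L0 (le_trans H3 (ler_wpM2l C'0 (H4 su))).
apply: le_trans (lerD H1 (le_trans H2 H5)) _.
by rewrite le_eqVlt; apply/orP; left; apply/eqP; ring.
Qed.

(** The telescoping of [chain_compose], where the finer partition plays the role
    of the chain: inside one step of [l] it is near the one-step map by [near_mu]. *)
Lemma refine_compose e s l l' x : e <= delta / 2 -> a <= s ->
  path (step e) s l -> path <=%R s l' -> subseq l l' -> last s l' = last s l -> last s l <= b ->
  `|compose mu s l' x - compose mu s l x| <= L * (C * (e `^ (al - 1) * (last s l - s))).
Proof.
have /andP[d0 d1] := d01.
move=> ed; elim: l s l' x => [|u l IH] s l' x as_ /=.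
  move=> _ p' _ l's sb; rewrite subrr !mulr0.
  have := near_mu x as_ p'; rewrite l's subrr mu_id// powR0 ?mulr0; first by apply => //; apply: ltW.
  by rewrite gt_eqF// (lt_trans _ al1).
move=> /andP[/andP[su ue] pl] p' /subseq_cons_split[l1 [l2 [l'E sub]]].
move: p'; rewrite l'E last_cat cat_path /= => /and3P[p1 lu p2] lE lb.
have ul := path_le_last (step_path_le pl).
rewrite -cat_rcons compose_cat last_rcons; set z := compose mu s (rcons l1 u) x.
rewrite (_ : _ - _ = (compose mu u l2 z - compose mu u l z)
  + (compose mu u l z - compose mu u l (mu s u x))); last by rewrite subrKA.
apply: le_trans (ler_normD _ _) _.
have H1 := IH u l2 z (le_trans as_ su) pl p2 sub lE lb.
have H2 := lip z (mu s u x) (le_trans as_ su) (step_path_weaken ed pl) lb.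
have H3 : `|z - mu s u x| <= C * (u - s) `^ al.
  have := near_mu (s := s) (l := rcons l1 u) x as_; rewrite last_rcons; apply; try lra.
  by rewrite rcons_path p1.
have H4 := @powR_step (u - s) e _ ue; rewrite subr_ge0 in H4.
have H5 := ler_wpM2l L0 (le_trans H3 (ler_wpM2l C0 (H4 su))).
apply: le_trans (lerD H1 (le_trans H2 H5)) _.
by rewrite le_eqVlt; apply/orP; left; apply/eqP; ring.
Qed.

(** Both partitions are compared with a common refinement. *)
Lemma compose_close eps : 0 < eps -> exists2 e, 0 < e <= delta / 2 &
  forall s l1 l2 x, a <= s -> path (step e) s l1 -> path (step e) s l2 ->
    last s l1 = last s l2 -> last s l1 <= b ->
    `|compose mu s l1 x - compose mu s l2 x| <= eps.
Proof.
move=> eps0; have /andP[d0 d1] := d01.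
have B0 : 0 <= L * C * `|b - a| by rewrite !mulr_ge0.
have al10 : 0 < al - 1 by rewrite subr_gt0.
have eps20 : 0 < eps / 2 by rewrite divr_gt0.
have [e1 /andP[e10 _] H] := small_powR B0 al10 eps20.
exists (Num.min e1 (delta / 2)).
  by rewrite lt_min e10 ge_min lexx orbT andbT; lra.
set e := Num.min _ _ => s l1 l2 x as_ p1 p2 l12 lb.
have ed : e <= delta / 2 by rewrite /e ge_min lexx orbT.
have e0 : 0 <= e by rewrite /e le_min; apply/andP; split; lra.
have B : L * (C * (e `^ (al - 1) * (last s l1 - s))) <= eps / 2.
  apply: le_trans (H e _); last by rewrite e0 /e ge_min lexx.
  rewrite (_ : L * (C * _) = L * C * (last s l1 - s) * e `^ (al - 1)); last by ring.
  apply: ler_wpM2r; first exact: powR_ge0.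
  apply: ler_wpM2l; first exact: mulr_ge0.
  by rewrite ger0_norm; have := path_le_last (step_path_le p1); lra.
have [l [pl lE s1 s2]] := common_refinement (step_path_le p1) (step_path_le p2) l12.
have R1 := refine_compose x ed as_ p1 pl s1 lE lb.
have R2 := @refine_compose e s l2 l x ed as_ p2 pl s2.
rewrite lE l12 in R2; rewrite l12 in lb B; have {}R2 := R2 erefl lb.
rewrite l12 in R1.
rewrite (_ : _ - _ = (compose mu s l x - compose mu s l2 x) - (compose mu s l x - compose mu s l1 x)).
  by apply: le_trans (ler_normB _ _) _; lra.
by rewrite opprB [RHS]addrC subrKA.
Qed.
End WithLip.
End Refinement.

Section Flow.
Context {R : realType} {m : nat}.
Local Notation E := 'rV[R]_m.
Implicit Types (x y : E) (s t u v e : R) (l : seq R).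

(** Uniform partitions only serve to fix a sequence: by [flow_close] any
    partitions with mesh tending to 0 give the same limit. *)
Definition flow (mu : R -> R -> E -> E) s t x : E :=
  lim (compose mu s (uniform_part s t n) x @[n --> \oo]).

Variables (a b q al r K : R) (mu : R -> R -> E -> E).
Hypotheses (q0 : 0 < q) (r0 : 0 < r) (r1 : r <= 1) (be1 : 1 < al * r) (K0 : 0 <= K).
Hypothesis (F : almost_flow a b q al r K mu).

Let al1 : 1 < al.
Proof.
have al0 : 0 < al by rewrite -(pmulr_lgt0 _ r0); exact: lt_trans be1.
by apply: lt_le_trans be1 _; rewrite ler_piMr// ltW.
Qed.

Lemma uniform_part_fine e s t : 0 < e -> s <= t ->
  \forall n \near \oo, path (step e) s (uniform_part s t n).
Proof.
move=> e0 st; near=> n; apply: step_path_weaken (uniform_part_path n st).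
rewrite ler_pdivrMr ?ltr0n// -ler_pdivrMl// mulrC.
apply: le_trans (_ : n%:R <= _); last by rewrite ler_nat.
near: n; exact: nbhs_infty_ger.
Unshelve. all: by end_near. Qed.

Lemma flow_cvg s t x : a <= s -> s <= t -> t <= b ->
  compose mu s (uniform_part s t n) x @[n --> \oo] --> flow mu s t x.
Proof.
move=> as_ st tb.
have [delta [C [d01 C0 near_mu lip_mu]]] := compose_estimates q0 r0 r1 be1 K0 F.
have [L L0 lip] := compose_lip d01 lip_mu.
apply/cauchy_cvgP/cauchy_exP => eps eps0.
have eps20 : 0 < eps / 2 by rewrite divr_gt0.
have [e /andP[e0 _] H] := compose_close al1 d01 C0 (af_id F) near_mu L0 lip eps20.
have [N _ HN] := uniform_part_fine e0 st.
exists (compose mu s (uniform_part s t N) x); exists N => // j Nj /=.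
rewrite mx_norm_ball /ball_ /=.
apply: le_lt_trans (H _ _ _ _ as_ (HN _ (leqnn _)) (HN _ Nj) _ _) _; rewrite ?uniform_part_last//.
lra.
Qed.

Arguments flow_cvg {s t} x _ _ _.

Lemma flow_close eps : 0 < eps -> exists2 e, 0 < e & forall s l x,
  a <= s -> path (step e) s l -> last s l <= b ->
  `|compose mu s l x - flow mu s (last s l) x| <= eps.
Proof.
move=> eps0.
have [delta [C [d01 C0 near_mu lip_mu]]] := compose_estimates q0 r0 r1 be1 K0 F.
have [L L0 lip] := compose_lip d01 lip_mu.
have [e /andP[e0 _] H] := compose_close al1 d01 C0 (af_id F) near_mu L0 lip eps0.
exists e => // s l x as_ pl lb.
have st := path_le_last (step_path_le pl).
have cv := flow_cvg x as_ st lb.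
apply/ler_addgt0Pr => eps' eps'0.
have /cvgrPdist_le/(_ _ eps'0) := cv.
move=> cv'; near \oo => n.
have P1 : path (step e) s (uniform_part s (last s l) n) by near: n; exact: uniform_part_fine.
have P2 : `|flow mu s (last s l) x - compose mu s (uniform_part s (last s l) n) x| <= eps' by near: n.
have P3 := H _ _ _ x as_ pl P1; rewrite uniform_part_last in P3; have {}P3 := P3 erefl lb.
rewrite -(subrKA (compose mu s (uniform_part s (last s l) n) x)).
apply: le_trans (ler_normD _ _) _; rewrite lerD// distrC//.
Unshelve. all: by end_near. Qed.

Lemma flow_id s x : a <= s -> s <= b -> flow mu s s x = x.
Proof.
move=> as_ sb; apply/eqP; rewrite -subr_eq0 -normr_le0; apply/ler_addgt0Pr => e e0; rewrite add0r.
have [e' e'0 H] := flow_close e0.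
by have := H s [::] x as_ isT sb; rewrite /= distrC.
Qed.

Lemma flow_lip : exists2 L, 0 <= L & forall s t x y, a <= s -> s <= t -> t <= b ->
  `|flow mu s t x - flow mu s t y| <= L * `|x - y|.
Proof.
have [delta [C [d01 C0 near_mu lip_mu]]] := compose_estimates q0 r0 r1 be1 K0 F.
have [L L0 lip] := compose_lip d01 lip_mu.
have /andP[d0 _] := d01; have d20 : 0 < delta / 2 by rewrite divr_gt0.
exists L => // s t x y as_ st tb.
have cx := flow_cvg x as_ st tb; have cy := flow_cvg y as_ st tb.
have cxy := cvg_norm (cvgB cx cy).
apply: (cvgr_to_le (cxy _ _)).
near=> n; apply: lip; rewrite ?uniform_part_last//; near: n; exact: uniform_part_fine.
Unshelve. all: by end_near. Qed.

Lemma flow_near : exists delta C : R, [/\ 0 < delta, 0 <= C & forall s t x, a <= s -> s <= t ->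
  t <= b -> t - s <= delta -> `|flow mu s t x - mu s t x| <= C * (t - s) `^ al].
Proof.
have [delta [C [d01 C0 near_mu lip_mu]]] := compose_estimates q0 r0 r1 be1 K0 F.
have /andP[d0 _] := d01; exists delta, C; split=> // s t x as_ st tb ts.
have cx := cvg_norm (cvgB (flow_cvg x as_ st tb) (cvg_cst (mu s t x))).
apply: (cvgr_to_le (cx _ _ _)).
near=> n; have := near_mu s (uniform_part s t n) x as_; rewrite uniform_part_last; apply => //.
exact: step_path_le (uniform_part_path n st).
Unshelve. all: by end_near. Qed.

(** Concatenating partitions of [s, u] and [u, t] gives a fine partition of [s,
    t], and the scheme composes exactly along concatenations. *)
Lemma flow_comp s u t x : a <= s -> s <= u -> u <= t -> t <= b ->
  flow mu u t (flow mu s u x) = flow mu s t x.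
Proof.
move=> as_ su ut tb; apply/eqP; rewrite -subr_eq0 -normr_le0; apply/ler_addgt0Pr => e e0; rewrite add0r.
have [L L0 lip] := flow_lip.
have L20 : 0 < e / (L + 2) by rewrite divr_gt0//; lra.
have [e' e'0 H] := flow_close L20.
near \oo => n.
have P1 : path (step e') s (uniform_part s u n) by near: n; exact: uniform_part_fine.
have P2 : path (step e') u (uniform_part u t n) by near: n; exact: uniform_part_fine.
have H1 := H s _ x as_ P1; rewrite uniform_part_last in H1.
have H2 := H u _ (compose mu s (uniform_part s u n) x) (le_trans as_ su) P2; rewrite uniform_part_last in H2.
have H3 := H s (uniform_part s u n ++ uniform_part u t n) x as_.
rewrite cat_path last_cat compose_cat !uniform_part_last P1 P2 in H3.
have {}H1 := H1 (le_trans ut tb); have {}H2 := H2 tb; have {}H3 := H3 isT tb.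
have H4 := lip u t (flow mu s u x) (compose mu s (uniform_part s u n) x) (le_trans as_ su) ut tb.
set z := compose mu s (uniform_part s u n) x in H1 H2 H3 H4.
rewrite distrC in H1; have {}H4 := le_trans H4 (ler_wpM2l L0 H1).
rewrite -(subrKA (flow mu u t z)) -(subrKA (compose mu u (uniform_part u t n) z) (flow mu u t z)).
apply: le_trans (ler_normD _ _) _; apply: le_trans (lerD (lexx _) (ler_normD _ _)) _.
rewrite distrC in H2; apply: le_trans (lerD H4 (lerD H2 H3)) _.
rewrite (_ : _ + _ = (L + 2) * (e / (L + 2))); last by ring.
by rewrite mulrC divfK// gt_eqF//; lra.
Unshelve. all: by end_near. Qed.

(** This is the uniqueness mechanism: a solution flow is compared with the scheme
    itself, by [chain_compose], and not with another solution. *)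
Lemma flow_unique delta' C' (y : R -> E) s t : 0 < delta' -> 0 <= C' -> a <= s -> s <= t -> t <= b ->
  (forall u v, s <= u -> u <= v -> v <= t -> v - u <= delta' ->
     `|y v - mu u v (y u)| <= C' * (v - u) `^ al) ->
  y t = flow mu s t (y s).
Proof.
move=> d'0 C'0 as_ st tb H; apply/eqP; rewrite -subr_eq0 -normr_le0; apply/ler_addgt0Pr => eps eps0; rewrite add0r.
have [delta [C [d01 C0 near_mu lip_mu]]] := compose_estimates q0 r0 r1 be1 K0 F.
have [L L0 lip] := compose_lip d01 lip_mu.
have /andP[d0 _] := d01.
have eps20 : 0 < eps / 2 by rewrite divr_gt0.
have [e1 e10 H1] := flow_close eps20.
have B0 : 0 <= L * C' * (t - s) by rewrite !mulr_ge0 ?subr_ge0.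
have al10 : 0 < al - 1 by rewrite subr_gt0.
have [e2 /andP[e20 _] H2] := small_powR B0 al10 eps20.
pose e := Num.min (Num.min e1 e2) (Num.min delta' (delta / 2)).
have e0 : 0 < e by rewrite !lt_min e10 e20 d'0 divr_gt0.
have [ee1 ee2 ed' ed] : [/\ e <= e1, e <= e2, e <= delta' & e <= delta / 2].
  by rewrite /e !ge_min !lexx !orbT.
near \oo => n.
have P : path (step e) s (uniform_part s t n) by near: n; exact: uniform_part_fine.
have Q1 := H1 s _ (y s) as_ (step_path_weaken ee1 P); rewrite uniform_part_last in Q1.
have {}Q1 := Q1 tb.
have Q2 := @chain_compose _ _ _ b al delta mu al1 L L0 lip C' e y s _ C'0 ed as_ P.
rewrite uniform_part_last in Q2.
have {}Q2 := Q2 tb.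
have Q3 : L * (C' * (e `^ (al - 1) * (t - s))) <= eps / 2.
  rewrite (_ : L * _ = L * C' * (t - s) * e `^ (al - 1)); last by ring.
  by apply: H2; rewrite ltW.
rewrite -(subrKA (compose mu s (uniform_part s t n) (y s))).
apply: le_trans (ler_normD _ _) _.
suff : `|y t - compose mu s (uniform_part s t n) (y s)| <= eps / 2 by lra.
apply: le_trans Q3; apply: Q2 => u v su uv vt ve; apply: H => //.
exact: le_trans ve ed'.
Unshelve. all: by end_near. Qed.

End Flow.

(** * Hoelder classes *)

Section Sup0.
Context {R : realType}.

Lemma sup0_ge0 (A : set (\bar R)) : (0 <= sup0 A)%E.
Proof. by apply: ereal_sup_ubound; left. Qed.

Lemma sup0_ub (A : set (\bar R)) z : A z -> (z <= sup0 A)%E.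
Proof. by move=> Az; apply: ereal_sup_ubound; right. Qed.

Lemma sup0_le (A : set (\bar R)) z : (0 <= z)%E -> (forall y, A y -> (y <= z)%E) -> (sup0 A <= z)%E.
Proof. by move=> z0 H; apply: ge_ereal_sup => y [->|/H]. Qed.
End Sup0.

Section NormBounds.
Context {R : realType} {m : nat} {W : normedModType R}.
Variables (alpha N : R) (f : 'rV[R]_m -> W).
Hypothesis fN : (Calpha_norm alpha f <= N%:E)%E.
Local Notation n := (Num.truncn alpha).

Lemma Calpha_pder_le l x : (size l <= n)%N -> `|pder l f x| <= N.
Proof.
move=> ln; rewrite -lee_fin; apply: le_trans fN; rewrite /Calpha_norm.
apply: le_trans (leeDl _ (sup0_ge0 _)).
have ln' : (size l < n.+1)%N by [].
rewrite (bigD1 (Ordinal ln')) //=.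
apply: le_trans (leeDl _ _); last by apply: sume_ge0 => i _; exact: sup0_ge0.
by apply: sup0_ub; exists l, x.
Qed.

Lemma Calpha_pder_holder l x y : size l = n ->
  `|pder l f x - pder l f y| <= N * `|x - y| `^ (alpha - n%:R).
Proof.
move=> ln; have N0 : 0 <= N.
  by apply: le_trans (Calpha_pder_le (l := [::]) x (leq0n _)).
have [->|xy] := eqVneq x y; first by rewrite subrr normr0 mulr_ge0// powR_ge0.
have p0 : 0 < `|x - y| `^ (alpha - n%:R) by rewrite powR_gt0// normr_gt0 subr_eq0.
rewrite -ler_pdivrMr// -lee_fin; apply: le_trans fN; rewrite /Calpha_norm.
apply: le_trans (leeDr _ _); last by apply: sume_ge0 => i _; exact: sup0_ge0.
by apply: sup0_ub; exists l, x, y.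
Qed.

End NormBounds.

Section Regularity.
Context {R : realType} {m : nat}.
Implicit Types (f g : 'rV[R]_m -> R) (F : vfield R m).

(** [pder] at the scalar type, where the value type has to be read as the normed
    module [R^o]. *)
Definition pderR (l : seq 'I_m) f : 'rV[R]_m -> R := pder l (f : _ -> R^o).

(** For [rho = 1] the norm of order [k + rho] controls [k + 1] bounded derivatives
    in place of a Hoelder seminorm; this predicate, with Lipschitz derivatives of
    order [k], is common to both cases. *)
Definition regular (k : nat) (rho N : R) f :=
  [/\ forall l, (size l < k)%N -> smooth (pderR l f),
      forall l x, (size l <= k)%N -> `|pderR l f x| <= N
    & forall l, size l = k -> holder rho N (pderR l f)].

Lemma truncn_lt1 (k : nat) (rho : R) : 0 < rho < 1 -> Num.truncn (k%:R + rho) = k.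
Proof.
move=> /andP[r0 r1]; apply: truncn_def; rewrite -natr1; apply/andP; split; lra.
Qed.

Lemma regular_of_bounds (k : nat) (rho N : R) f : 0 < rho <= 1 -> 0 <= N ->
  let n := Num.truncn (k%:R + rho) in
  (forall l, (size l < n)%N -> smooth (pderR l f)) ->
  (forall l x, (size l <= n)%N -> `|pderR l f x| <= N) ->
  (forall l x y, size l = n -> `|pderR l f x - pderR l f y| <= N * `|x - y| `^ (k%:R + rho - n%:R)) ->
  regular k rho (m.+1%:R * N) f.
Proof.
move=> /andP[r0 r1] N0 n sm bd ho.
have NN : N <= m.+1%:R * N by rewrite ler_peMl// ler1n.
have [rho1|rho1] := eqVneq rho 1.
  have nE : n = k.+1 by rewrite /n rho1 natr1 natrK.
  split.
  - by move=> l lk; apply: sm; rewrite nE; apply: leq_trans lk _.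
  - by move=> l x lk; apply: le_trans (bd l x _) NN; rewrite nE; apply: leq_trans lk _.
  - move=> l lk x y; rewrite rho1 powRr1//.
    apply: le_trans (smooth_lip (c := N) _ _ x y) _.
    + by apply: sm; rewrite nE lk.
    + by move=> j z; apply: (bd (j :: l)); rewrite /= nE lk.
    + by rewrite mulrA ler_wpM2r// ler_wpM2r// ler_nat.
have nE : n = k by apply: truncn_lt1; rewrite r0 lt_neqAle rho1.
split.
- by move=> l lk; apply: sm; rewrite nE.
- by move=> l x lk; apply: le_trans (bd l x _) NN; rewrite nE.
- move=> l lk x y; apply: le_trans (ho l x y _) _; first by rewrite nE.
  by rewrite nE [k%:R + rho]addrC addrK ler_wpM2r// powR_ge0.
Qed.

(** Derivatives of a vector field are taken in the space of vectors, whereas mean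
    value arguments are scalar. *)
Lemma pder_coord n F l i : ndifferentiable n F -> (size l <= n)%N ->
  (fun x => pder l F x 0 i) = pderR l (fun x => F x 0 i).
Proof.
move=> dF; elim: l => [//|j l IH] ln; have {}IH := IH (ltnW ln).
apply/funext => x; transitivity ('D_(basis_vec j) (pderR l (fun x => F x 0 i) : _ -> R^o) x) => //.
by rewrite -IH /= derive_mx ?mxE//; exact/diff_derivable/dF.
Qed.

Lemma differentiable_coord_fun F x i : differentiable F x ->
  differentiable (fun y => F y 0 i : R^o) x.
Proof.
move=> dF.
exact: (@differentiable_comp _ _ _ _ F (fun M : 'rV[R]_m => M 0 i : R^o) x dF
  (differentiable_coord _ _ _)).
Qed.

Lemma regular_vfield (k : nat) (rho N : R) F : 0 < rho <= 1 -> 0 <= N ->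
  ndifferentiable (Num.truncn (k%:R + rho)) F -> (Calpha_norm (k%:R + rho) F <= N%:E)%E ->
  forall i, regular k rho (m.+1%:R * N) (fun x => F x 0 i).
Proof.
move=> r01 N0 dF FN i; apply: regular_of_bounds => //.
- move=> l ln x; rewrite -(pder_coord i dF (ltnW ln)); apply: differentiable_coord_fun.
  exact: dF.
- move=> l x ln; rewrite -(pder_coord i dF ln).
  apply: le_trans (Calpha_pder_le FN x ln); exact: rV_coord_le.
- move=> l x y ln; rewrite -(pder_coord i dF (eq_leq ln)).
  apply: le_trans (Calpha_pder_holder FN x y ln).
  rewrite (_ : pder l F x 0 i - _ = (pder l F x - pder l F y) 0 i); last by rewrite !mxE.
  exact: rV_coord_le.
Qed.

Lemma regular_scalar (k : nat) (rho N : R) f : 0 < rho <= 1 -> 0 <= N ->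
  ndifferentiable (Num.truncn (k%:R + rho)) (f : _ -> R^o) ->
  (Calpha_norm (k%:R + rho) (f : _ -> R^o) <= N%:E)%E ->
  regular k rho (m.+1%:R * N) f.
Proof.
move=> r01 N0 df fN; apply: regular_of_bounds => //.
- by move=> l x ln; apply: (Calpha_pder_le fN).
- by move=> l x y ln; apply: (Calpha_pder_holder fN).
Qed.

End Regularity.

Section C1rho.
Context {R : realType} {m : nat}.
Implicit Types (f g : 'rV[R]_m -> R).
Variable r : R.
Hypothesis r01 : 0 < r <= 1.

(** One constant bounds the function, its derivatives and all Hoelder quotients,
    so that sums and products only multiply constants. The Hoelder bound on [f]
    itself is what makes the class closed under products. *)
Definition C1rho (c : R) f :=
  [/\ smooth f, (forall x, `|f x| <= c), (forall j x, `|pd j f x| <= c),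
      holder r c f & forall j, holder r c (pd j f)].

Lemma C1rho_weaken c c' f : c <= c' -> C1rho c f -> C1rho c' f.
Proof.
move=> cc [sf bf bd hf hd]; split=> //.
- by move=> x; apply: le_trans cc.
- by move=> j x; apply: le_trans cc.
- by move=> x y; apply: le_trans (hf x y) _; rewrite ler_wpM2r// powR_ge0.
- by move=> j x y; apply: le_trans (hd j x y) _; rewrite ler_wpM2r// powR_ge0.
Qed.

Lemma bounded_lip_holder f (c : R) : smooth f -> 0 <= c -> (forall x, `|f x| <= c) ->
  (forall j x, `|pd j f x| <= c) -> holder r (m.+2%:R * c) f.
Proof.
move=> sf c0 bf bd x y; have /andP[r0 r1] := r01.
have [xy|xy] := leP `|x - y| 1.
  have [->|xy0] := eqVneq x y; first by rewrite !subrr !normr0 !mulr_ge0 ?powR_ge0.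
  apply: le_trans (smooth_lip sf bd x y) _.
  have H : `|x - y| <= `|x - y| `^ r.
    by apply: ger1_powR; rewrite ?r1 // normr_gt0 subr_eq0 xy0.
  rewrite mulrA; apply: ler_pM => //; first by rewrite mulr_ge0.
  by rewrite ler_wpM2r// ler_nat -addn2 leq_addr.
have H : 1 <= `|x - y| `^ r.
  by rewrite -(powRr0 `|x - y|); apply: ler_powR; apply: ltW.
apply: le_trans (ler_normB _ _) _; apply: le_trans (lerD (bf x) (bf y)) _.
rewrite (_ : c + c = (2 * c) * 1); last by ring.
apply: ler_pM => //; first by rewrite mulr_ge0.
by rewrite ler_wpM2r// ler_nat.
Qed.

Lemma pdD j f g x : smooth f -> smooth g -> pd j (fun y => f y + g y) x = pd j f x + pd j g x.
Proof.
move=> sf sg; rewrite /pd (@deriveD R _ _ (f : _ -> R^o) g) //; exact/diff_derivable.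
Qed.

Lemma pdM j f g x : smooth f -> smooth g ->
  pd j (fun y => f y * g y) x = f x * pd j g x + g x * pd j f x.
Proof.
move=> sf sg; rewrite /pd (@deriveM R _ (f : _ -> R^o) g) //; exact/diff_derivable.
Qed.

Lemma pdZ j (a : R) f x : smooth f -> pd j (fun y => a * f y) x = a * pd j f x.
Proof.
move=> sf; rewrite /pd (@deriveZ R _ _ (f : _ -> R^o) a) //; exact/diff_derivable.
Qed.

Lemma smoothD f g : smooth f -> smooth g -> smooth (fun y => f y + g y).
Proof. by move=> sf sg x; apply: (@differentiableD _ _ _ (f : _ -> R^o) (g : _ -> R^o)). Qed.

Lemma smoothM f g : smooth f -> smooth g -> smooth (fun y => f y * g y).
Proof. by move=> sf sg x; apply: (@differentiableM _ _ (f : _ -> R^o) (g : _ -> R^o)). Qed.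

Lemma smoothZ (a : R) f : smooth f -> smooth (fun y => a * f y).
Proof. by move=> sf x; apply: (@differentiableZ _ _ _ (f : _ -> R^o) a). Qed.

Lemma C1rhoD c c' f g : C1rho c f -> C1rho c' g -> C1rho (c + c') (fun y => f y + g y).
Proof.
move=> [sf bf bdf hf hdf] [sg bg bdg hg hdg].
split; first exact: smoothD.
- by move=> x; apply: le_trans (ler_normD _ _) _; apply: lerD.
- by move=> j x; rewrite pdD//; apply: le_trans (ler_normD _ _) _; apply: lerD.
- move=> x y; rewrite opprD addrACA mulrDl.
  by apply: le_trans (ler_normD _ _) _; apply: lerD.
- move=> j x y; rewrite !pdD// opprD addrACA mulrDl.
  by apply: le_trans (ler_normD _ _) _; apply: lerD; [exact: hdf|exact: hdg].
Qed.

Lemma C1rhoZ c a f : C1rho c f -> C1rho (`|a| * c) (fun y => a * f y).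
Proof.
move=> [sf bf bdf hf hdf]; split; first exact: smoothZ.
- by move=> x; rewrite normrM ler_wpM2l.
- by move=> j x; rewrite pdZ// normrM ler_wpM2l.
- by move=> x y; rewrite -mulrBr normrM -mulrA ler_wpM2l.
- by move=> j x y; rewrite !pdZ// -mulrBr normrM -mulrA ler_wpM2l//; exact: hdf.
Qed.

Lemma prod_holder (c c' : R) f g : 0 <= c -> 0 <= c' ->
  (forall x, `|f x| <= c) -> (forall x, `|g x| <= c') -> holder r c f -> holder r c' g ->
  forall x y, `|f x * g x - f y * g y| <= 2 * (c * c') * `|x - y| `^ r.
Proof.
move=> c0 c'0 bf bg hf hg x y.
rewrite (_ : _ - _ = f x * (g x - g y) + (f x - f y) * g y); last by ring.
apply: le_trans (ler_normD _ _) _; rewrite !normrM.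
have p0 : 0 <= `|x - y| `^ r by exact: powR_ge0.
have H1 : `|f x| * `|g x - g y| <= c * (c' * `|x - y| `^ r) by apply: ler_pM.
have H2 : `|f x - f y| * `|g y| <= c * `|x - y| `^ r * c' by apply: ler_pM.
apply: le_trans (lerD H1 H2) _; rewrite le_eqVlt; apply/orP; left; apply/eqP; ring.
Qed.

Lemma C1rhoM c c' f g : 0 <= c -> 0 <= c' ->
  C1rho c f -> C1rho c' g -> C1rho (4 * (c * c')) (fun y => f y * g y).
Proof.
move=> c0 c'0 [sf bf bdf hf hdf] [sg bg bdg hg hdg].
have cc : 0 <= c * c' by rewrite mulr_ge0.
split; first exact: smoothM.
- by move=> x; rewrite normrM; apply: le_trans (_ : c * c' <= _); [exact: ler_pM|lra].
- move=> j x; rewrite pdM//; apply: le_trans (ler_normD _ _) _; rewrite !normrM.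
  have H1 : `|f x| * `|pd j g x| <= c * c' by apply: ler_pM.
  have H2 : `|g x| * `|pd j f x| <= c' * c by apply: ler_pM.
  lra.
- move=> x y; apply: le_trans (prod_holder c0 c'0 bf bg hf hg x y) _.
  by rewrite ler_wpM2r ?powR_ge0//; lra.
- move=> j x y; rewrite !pdM// opprD addrACA.
  apply: le_trans (ler_normD _ _) _.
  have H1 := prod_holder c0 c'0 bf (bdg j) hf (hdg j) x y.
  have H2 := prod_holder c'0 c0 bg (bdf j) hg (hdf j) x y.
  apply: le_trans (lerD H1 H2) _; rewrite le_eqVlt; apply/orP; left; apply/eqP; ring.
Qed.

Lemma C1rho0 : C1rho 0 (fun=> 0).
Proof.
have pd0 j x : pd j (fun=> 0 : R) x = 0 :> R by rewrite /pd derive_cst.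
split.
- move=> x; exact: differentiable_cst.
- by move=> x; rewrite normr0.
- by move=> j x; rewrite pd0 normr0.
- by move=> x y; rewrite subrr normr0 mul0r.
- by move=> j x y; rewrite !pd0 subrr normr0 mul0r.
Qed.

Lemma C1rho_sum c (f : 'I_m -> 'rV[R]_m -> R) : (forall i, C1rho c (f i)) ->
  C1rho (m%:R * c) (fun y => \sum_i f i y).
Proof.
move=> H; suff G (s : seq 'I_m) : C1rho ((size s)%:R * c) (fun y => \sum_(i <- s) f i y).
  rewrite (_ : (fun _ => _) = fun y => \sum_(i <- enum 'I_m) f i y).
    by have := G (enum 'I_m); rewrite size_enum_ord.
  by apply/funext => y; rewrite big_enum.
elim: s => [|i s IH].
  rewrite mul0r (_ : (fun _ => _) = fun=> 0); last by apply/funext => y; rewrite big_nil.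
  exact: C1rho0.
rewrite (_ : (fun _ => _) = fun y => f i y + \sum_(i <- s) f i y); last first.
  by apply/funext => y; rewrite big_cons.
by rewrite /= -nat1r mulrDl mul1r; exact: C1rhoD.
Qed.

End C1rho.

Section Classes.
Context {R : realType} {m : nat}.
Variable r : R.
Hypothesis r01 : 0 < r <= 1.

Lemma regular1_C1rho c (f : 'rV[R]_m -> R) : 0 <= c -> regular 1 r c f -> C1rho r (m.+2%:R * c) f.
Proof.
move=> c0 [sf bf hf].
have cc : c <= m.+2%:R * c by rewrite ler_peMl// ler1n.
have sf0 : smooth f by exact: (sf [::]).
have bf0 x : `|f x| <= c by exact: (bf [::]).
have bf1 j x : `|pd j f x| <= c by exact: (bf [:: j]).
split => //.
- by move=> x; apply: le_trans cc.
- by move=> j x; apply: le_trans cc.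
- exact: bounded_lip_holder.
- move=> j x y; apply: le_trans (hf [:: j] erefl x y) _.
  by rewrite ler_wpM2r// powR_ge0.
Qed.

Lemma regular2_C1rho c (f : 'rV[R]_m -> R) : 0 <= c -> regular 2 r c f ->
  C1rho r (m.+2%:R * c) f /\ forall j, C1rho r (m.+2%:R * c) (pd j f).
Proof.
move=> c0 [sf bf hf].
have cc : c <= m.+2%:R * c by rewrite ler_peMl// ler1n.
have sf0 : smooth f by exact: (sf [::]).
have bf0 x : `|f x| <= c by exact: (bf [::]).
have bf1 j x : `|pd j f x| <= c by exact: (bf [:: j]).
have sf1 j : smooth (pd j f) by exact: (sf [:: j]).
have bf2 i j x : `|pd i (pd j f) x| <= c by exact: (bf [:: i; j]).
have hd j : holder r (m.+2%:R * c) (pd j f) by exact: bounded_lip_holder.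
split; first split => //.
- by move=> x; apply: le_trans cc.
- by move=> j x; apply: le_trans cc.
- exact: bounded_lip_holder.
move=> j; split => //.
- by move=> x; apply: le_trans cc.
- by move=> i x; apply: le_trans cc.
- move=> i x y; apply: le_trans (hf [:: i; j] erefl x y) _.
  by rewrite ler_wpM2r// powR_ge0.
Qed.
End Classes.

(** * The defect of two consecutive steps *)

Section FieldBounds.
Context {R : realType} {m : nat}.
Variable r : R.
Hypothesis r01 : 0 < r <= 1.
Implicit Types (c : R) (G : vfield R m).

Definition field_C1rho c G := forall i, C1rho r c (fun x => G x 0 i).

Lemma field_C1rho_bound c G x : 0 <= c -> field_C1rho c G -> `|G x| <= c.
Proof. by move=> c0 H; apply: rV_norm_le => // i; have [_ bf _ _ _] := H i. Qed.

Lemma field_C1rho_lip c G x y : 0 <= c -> field_C1rho c G -> `|G x - G y| <= m%:R * (c * `|x - y|).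
Proof.
move=> c0 H; apply: rV_norm_le; first by rewrite !mulr_ge0.
move=> i; have [sf _ bdf _ _] := H i.
by rewrite !mxE; exact: (smooth_lip sf bdf).
Qed.

Lemma field_C1rho_4pt c G x y x' y' z : 0 <= c -> field_C1rho c G -> `|x - x'| <= z -> `|y - y'| <= z ->
  `|(G x - G y) - (G x' - G y')|
   <= m%:R * (c * `|(x - y) - (x' - y')|) + m%:R * (c * (z `^ r) * `|x - y|).
Proof.
move=> c0 H xz yz; have /andP[r0 _] := r01.
apply: rV_norm_le => [|i]; first by rewrite addr_ge0// !mulr_ge0// powR_ge0.
have [sf _ bdf _ hdf] := H i.
by rewrite !mxE; exact: (smooth_4pt sf bdf (ltW r0) c0 hdf).
Qed.

(** With [y] the [1/p]-th power of the length of the interval, the defect involves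
    [y ^+ 3] and [y ^+ 2 * y `^ r]; for lengths at most 1 both are at most the
    length to the power [3 * r / p]. *)
Lemma powR_small (y : R) : 0 <= y <= 1 -> y ^+ 2 * y `^ r <= y `^ (3 * r) /\ y ^+ 3 <= y `^ (3 * r).
Proof.
move=> /andP[y0 y1]; have /andP[r0 r1] := r01.
have [->|yn0] := eqVneq y 0.
  by rewrite !expr0n /= mul0r powR_ge0.
have yp : 0 < y <= 1 by rewrite lt_neqAle eq_sym yn0 y0.
split.
- rewrite -powR_mulrn// -powRD ?yn0 ?implybT//; apply: ger_powR => //; lra.
- rewrite -powR_mulrn//; apply: ger_powR => //; lra.
Qed.

Section Defect.
Variables (K y : R) (A B G Bs : vfield R m).
Hypotheses (K0 : 0 <= K) (y01 : 0 <= y <= 1).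
Hypotheses (HA : field_C1rho (K * y) A)
  (HdA : forall i j, C1rho r (K * y) (pd j (fun x => A x 0 i)))
  (HB : field_C1rho (K * y ^+ 2) B) (HG : field_C1rho (K * y) G) (HBs : field_C1rho (K * y ^+ 2) Bs).

(** For a step with fields [A], [B] of first and second order following a step of
    increment [G] and second order part [Bs], this is a coordinate of the amount
    by which the two steps miss the single step, once Chen's relation has
    cancelled the terms of order below 3. *)
Definition defect i x : R :=
  let f z := A z 0 i in
  (f (x + G x) - f x - grad f x (G x)) + grad f x (Bs x) + (B (x + G x) 0 i - B x 0 i).

Let y0 : 0 <= y. Proof. by case/andP: y01. Qed.
Let Ky0 : 0 <= K * y. Proof. exact: mulr_ge0. Qed.
Let Ky20 : 0 <= K * y ^+ 2. Proof. by rewrite mulr_ge0// exprn_ge0. Qed.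

Lemma defect_bound i x :
  `|defect i x| <= (2 * m%:R ^+ 2 * K ^+ 3 + 2 * m%:R * K ^+ 2) * y ^+ 3.
Proof.
have /andP[r0 r1] := r01.
have [sA _ bdA _ _] := HA i; have [sB _ bdB _ _] := HB i.
have GK : `|G x| <= K * y by exact: field_C1rho_bound.
have H1 := @taylor_rem_lip _ _ _ (K * y) (K * y) r sA
   (fun j => let: And5 s _ _ _ _ := HdA i j in s) Ky0
   (fun j k x => let: And5 _ _ b _ _ := HdA i j in b k x) (ltW r0) Ky0
   (fun j k => let: And5 _ _ _ _ h := HdA i j in h k) x (G x) x 0 (K * y) GK.
rewrite addr0 !subrr !normr0 !mulr0 !subr0 in H1.
have {}H1 := H1 Ky0.
have g0 : grad (fun z => A z 0 i) x 0 = 0.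
  by rewrite /grad big1// => j _; rewrite mxE mul0r.
rewrite g0 subrr subr0 add0r in H1.
have H1' : 2 * m%:R ^+ 2 * (K * y * (K * y) * `|G x|) <= 2 * m%:R ^+ 2 * K ^+ 3 * y ^+ 3.
  rewrite (_ : 2 * m%:R ^+ 2 * K ^+ 3 * y ^+ 3 = 2 * m%:R ^+ 2 * (K * y * (K * y) * (K * y))); last by ring.
  by rewrite ler_wpM2l ?mulr_ge0 ?exprn_ge0//; apply: ler_wpM2l => //; apply: mulr_ge0.
have H2 : `|grad (fun z => A z 0 i) x (Bs x)| <= m%:R * K ^+ 2 * y ^+ 3.
  apply: le_trans (grad_le _ (fun j => bdA j x)) _.
  rewrite (_ : m%:R * K ^+ 2 * y ^+ 3 = m%:R * (K * y * (K * y ^+ 2))); last by ring.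
  by rewrite ler_wpM2l//; apply: ler_wpM2l => //; exact: field_C1rho_bound.
have H3 : `|B (x + G x) 0 i - B x 0 i| <= m%:R * K ^+ 2 * y ^+ 3.
  apply: le_trans (smooth_lip sB bdB _ _) _.
  rewrite addrC addKr.
  rewrite (_ : m%:R * K ^+ 2 * y ^+ 3 = m%:R * (K * y ^+ 2 * (K * y))); last by ring.
  by rewrite ler_wpM2l//; apply: ler_wpM2l.
rewrite /defect.
apply: le_trans (ler_normD _ _) _; apply: le_trans (lerD (ler_normD _ _) (lexx _)) _.
apply: le_trans (lerD (lerD (le_trans H1 H1') H2) H3) _.
by rewrite le_eqVlt; apply/orP; left; apply/eqP; ring.
Qed.

(** The three terms are treated separately: the Taylor remainder by
    [taylor_rem_lip], the linear term by the product rule for differences, and the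
    last one by [smooth_4pt]. *)
Lemma defect_lip i x x' : `|defect i x - defect i x'| <=
  (m%:R ^+ 2 * K ^+ 2 * K `^ r + 2 * m%:R ^+ 3 * K ^+ 3 + 3 * m%:R ^+ 2 * K ^+ 2
   + m%:R * K * K `^ r) * y `^ (3 * r) * `|x - x'|.
Proof.
have /andP[r0 r1] := r01.
have [sA _ bdA _ _] := HA i; have [sB _ bdB _ hB] := HB i.
have [P1 P2] := powR_small y01.
set S := y `^ (3 * r) in P1 P2 *.
set M := `|x - x'|; have M0 : 0 <= M by exact: normr_ge0.
have GK w : `|G w| <= K * y by exact: field_C1rho_bound.
have GL : `|G x - G x'| <= m%:R * (K * y * M) by exact: field_C1rho_lip.
have Kr : (K * y) `^ r = K `^ r * y `^ r by rewrite powRM.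
have Kr0 : 0 <= K `^ r by exact: powR_ge0.
have H1 := @taylor_rem_lip _ _ _ (K * y) (K * y) r sA
   (fun j => let: And5 s _ _ _ _ := HdA i j in s) Ky0
   (fun j k x => let: And5 _ _ b _ _ := HdA i j in b k x) (ltW r0) Ky0
   (fun j k => let: And5 _ _ _ _ h := HdA i j in h k) x (G x) x' (G x') (K * y) (GK x) (GK x').
have H1' : m%:R ^+ 2 * (K * y * (K * y) `^ r * (K * y) * M)
      + 2 * m%:R ^+ 2 * (K * y * (K * y) * `|G x - G x'|) <=
   (m%:R ^+ 2 * K ^+ 2 * K `^ r + 2 * m%:R ^+ 3 * K ^+ 3) * S * M.
  rewrite Kr [leRHS](_ : _ = m%:R ^+ 2 * K ^+ 2 * K `^ r * S * M + 2 * m%:R ^+ 3 * K ^+ 3 * S * M); last by ring.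
  apply: lerD.
    rewrite (_ : _ * (K * y * _ * _ * M) = m%:R ^+ 2 * K ^+ 2 * K `^ r * (y ^+ 2 * y `^ r) * M); last by ring.
    by apply: ler_wpM2r => //; apply: ler_wpM2l => //; rewrite !mulr_ge0 ?exprn_ge0.
  apply: le_trans (_ : 2 * m%:R ^+ 2 * (K * y * (K * y) * (m%:R * (K * y * M))) <= _).
    by apply: ler_wpM2l; [rewrite mulr_ge0 ?exprn_ge0|apply: ler_wpM2l => //; apply: mulr_ge0].
  rewrite (_ : _ * (_ * _ * (_ * (_ * M))) = 2 * m%:R ^+ 3 * K ^+ 3 * y ^+ 3 * M); last by ring.
  by apply: ler_wpM2r => //; apply: ler_wpM2l => //; rewrite !mulr_ge0 ?exprn_ge0.
pose gA w := grad (fun z => A z 0 i) w.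
have H2 : `|gA x (Bs x) - gA x' (Bs x')| <= 2 * m%:R ^+ 2 * K ^+ 2 * S * M.
  rewrite (_ : _ - _ = gA x (Bs x - Bs x') + (gA x (Bs x') - gA x' (Bs x'))); last first.
    by rewrite /gA gradB; ring.
  apply: le_trans (ler_normD _ _) _.
  have h1 : `|gA x (Bs x - Bs x')| <= m%:R * (K * y * (m%:R * (K * y ^+ 2 * M))).
    apply: le_trans (grad_le _ (fun j => bdA j x)) _.
    by rewrite ler_wpM2l//; apply: ler_wpM2l => //; exact: field_C1rho_lip.
  have h2 : `|gA x (Bs x') - gA x' (Bs x')| <= m%:R * (m%:R * (K * y * M) * (K * y ^+ 2)).
    apply: le_trans (grad_sub_le (c := m%:R * (K * y * M)) _ _) _.
      by move=> j; have [s _ b _ _] := HdA i j; exact: smooth_lip.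
    rewrite ler_wpM2l//; apply: ler_wpM2l; first by rewrite !mulr_ge0.
    exact: field_C1rho_bound.
  apply: le_trans (lerD h1 h2) _.
  rewrite (_ : _ + _ = 2 * m%:R ^+ 2 * K ^+ 2 * y ^+ 3 * M); last by ring.
  by apply: ler_wpM2r => //; apply: ler_wpM2l => //; rewrite !mulr_ge0 ?exprn_ge0.
have H3 : `|(B (x + G x) 0 i - B x 0 i) - (B (x' + G x') 0 i - B x' 0 i)| <=
    (m%:R ^+ 2 * K ^+ 2 + m%:R * K * K `^ r) * S * M.
  have := @smooth_4pt _ _ _ _ _ r sB bdB (ltW r0) Ky20 hB x x' (x + G x) (x' + G x') (K * y).
  have -> w : w - (w + G w) = - G w by rewrite opprD addrA subrr add0r.
  have -> : x' - (x' + G x') = - G x' by rewrite opprD addrA subrr add0r.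
  rewrite !normrN => /(_ (GK x) (GK x')).
  rewrite (_ : x - x' - (x + G x - (x' + G x')) = - (G x - G x')); last first.
    by apply/rowP => k; rewrite !mxE; ring.
  rewrite normrN => H.
  rewrite (_ : _ - _ = - (B x 0 i - B x' 0 i - (B (x + G x) 0 i - B (x' + G x') 0 i))); last by ring.
  rewrite normrN; apply: le_trans H _.
  rewrite [leRHS](_ : _ = m%:R ^+ 2 * K ^+ 2 * S * M + m%:R * K * K `^ r * S * M); last by ring.
  apply: lerD.
    apply: le_trans (_ : m%:R * (K * y ^+ 2 * (m%:R * (K * y * M))) <= _).
      by rewrite ler_wpM2l//; apply: ler_wpM2l.
    rewrite (_ : _ * _ = m%:R ^+ 2 * K ^+ 2 * y ^+ 3 * M); last by ring.
    by apply: ler_wpM2r => //; apply: ler_wpM2l => //; rewrite !mulr_ge0 ?exprn_ge0.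
  rewrite Kr (_ : m%:R * (K * y ^+ 2 * (K `^ r * y `^ r) * M) =
    m%:R * K * K `^ r * (y ^+ 2 * y `^ r) * M); last by ring.
  by apply: ler_wpM2r => //; apply: ler_wpM2l => //; rewrite !mulr_ge0 ?exprn_ge0.
pose g1 w := A (w + G w) 0 i - A w 0 i - gA w (G w).
pose g3 w := B (w + G w) 0 i - B w 0 i.
rewrite (_ : _ - _ = (g1 x - g1 x') + (gA x (Bs x) - gA x' (Bs x')) + (g3 x - g3 x')); last first.
  by rewrite /defect /g1 /g3 /gA; ring.
apply: le_trans (ler_normD _ _) _; apply: le_trans (lerD (ler_normD _ _) (lexx _)) _.
apply: le_trans (lerD (lerD (le_trans H1 H1') H2) H3) _.
by rewrite le_eqVlt; apply/orP; left; apply/eqP; ring.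
Qed.

End Defect.
End FieldBounds.

(** * Drivers in coordinates *)

Section Coordinates.
Context {R : realType} {m : nat}.
Implicit Types (f : 'rV[R]_m -> R) (x h : 'rV[R]_m) (V : vfield R m).

Lemma smooth_coord (i : 'I_m) : smooth (fun y : 'rV[R]_m => y 0 i).
Proof. by move=> x; exact: differentiable_coord. Qed.

Lemma grad_coord i x h : grad (fun y => y 0 i) x h = h 0 i.
Proof.
rewrite -derive_grad; last exact: smooth_coord.
have := @derive_mx R _ 1 m (id : 'rV[R]_m -> 'rV[R]_m) x h (@derivable_id R _ x h).
by rewrite derive_id => /rowP/(_ i); rewrite mxE => <-.
Qed.

Lemma pd_coord i j : pd j (fun y : 'rV[R]_m => y 0 i) = fun=> (basis_vec j : 'rV[R]_m) 0 i.
Proof.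
apply/funext => x; rewrite -(grad_coord i x (basis_vec j)) -derive_grad//; exact: smooth_coord.
Qed.

(** Coordinate functions are admissible test functions, so that Chen's relation
    and second order operators can be evaluated on them. *)
Lemma coord_ndiff i : ndifferentiable 2 (fun y : 'rV[R]_m => y 0 i : R^o).
Proof.
case=> [|j [|//]] _ x; first exact: smooth_coord.
by have := pd_coord i j; rewrite /pd /= => ->; exact: differentiable_cst.
Qed.

Lemma vopE V f x : vop V f x = grad f x (V x).
Proof. by []. Qed.

Lemma vop_coord V i : vop V (fun y => y 0 i) = fun x => V x 0 i.
Proof. by apply/funext => x; rewrite vopE grad_coord. Qed.

Lemma smooth_sum (f : 'I_m -> 'rV[R]_m -> R) : (forall i, smooth (f i)) ->
  smooth (fun x => \sum_i f i x).
Proof.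
move=> sf x.
have -> : (fun x => \sum_i f i x : R^o) = \sum_i (f i : _ -> R^o).
  by apply/funext => z; rewrite fct_sumE.
by apply: differentiable_sum => i; exact: sf.
Qed.

Lemma gradM f g x h : smooth f -> smooth g ->
  grad (fun y => f y * g y) x h = f x * grad g x h + g x * grad f x h.
Proof.
move=> sf sg; rewrite /grad !mulr_sumr -big_split; apply: eq_bigr => j _ /=.
by rewrite pdM//; ring.
Qed.

Lemma grad_sum (f : 'I_m -> 'rV[R]_m -> R) x h : (forall i, smooth (f i)) ->
  grad (fun y => \sum_i f i y) x h = \sum_i grad (f i) x h.
Proof.
move=> sf; rewrite -derive_grad; last exact: smooth_sum.
have -> : (fun y => \sum_i f i y : R^o) = \sum_i (f i : _ -> R^o).
  by apply/funext => z; rewrite fct_sumE.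
rewrite derive_sum; last by move=> i; exact/diff_derivable/sf.
by apply: eq_bigr => i _; rewrite derive_grad//; exact: sf.
Qed.

Lemma vop_vop V f x : (forall i, smooth (fun y => V y 0 i)) -> (forall i, smooth (pd i f)) ->
  vop V (vop V f) x = grad f x (\row_i grad (fun y => V y 0 i) x (V x))
    + \sum_i V x 0 i * grad (pd i f) x (V x).
Proof.
move=> sV sf; rewrite vopE /vop grad_sum; last by move=> i; exact: (smoothM (sV i) (sf i)).
rewrite [X in _ = X + _]/grad -big_split; apply: eq_bigr => i _ /=.
by rewrite (gradM x (V x) (sV i) (sf i)) mxE; ring.
Qed.
End Coordinates.

Section DriverFormulas.
Context {R : realType} {m : nat}.
Variables (a b p rho : R) (D : driver R m).
Hypothesis wg : weak_geometric a b p rho D.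
Implicit Types (s t u : R) (x h : 'rV[R]_m).

Lemma inc_same s : a <= s -> s <= b -> inc D s s = fun=> 0.
Proof.
move=> as_ sb; have [[v vE] _ _ _] := wg.
by rewrite vE//; apply/funext => x; rewrite subrr.
Qed.

Lemma inc_add s u t x : a <= s -> s <= u -> u <= t -> t <= b ->
  inc D s t x = inc D s u x + inc D u t x.
Proof.
move=> as_ su ut tb; have [[v vE] _ _ _] := wg.
rewrite !vE//; [|exact: le_trans su|exact: le_trans tb|exact: le_trans ut].
by rewrite [RHS]addrC subrKA.
Qed.

Lemma inc2_coord s t i x : inc2 D s t (fun y => y 0 i) x =
  Wfield D s t x 0 i + 2^-1 * grad (fun y => inc D s t y 0 i) x (inc D s t x).
Proof. by rewrite /Wfield /field_of mxE /Wop vop_coord vopE subrK. Qed.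

Lemma inc2_chen s u t i x : a <= s -> s <= u -> u <= t -> t <= b ->
  inc2 D s t (fun y => y 0 i) x = inc2 D u t (fun y => y 0 i) x
   + grad (fun y => inc D u t y 0 i) x (inc D s u x) + inc2 D s u (fun y => y 0 i) x.
Proof.
move=> as_ su ut tb; have [_ _ _ chen] := wg.
by rewrite (chen s u t as_ su ut tb _ (coord_ndiff i) x) vop_coord vopE.
Qed.

(** Chen's relation at three equal times says that this value equals its double. *)
Lemma inc2_same s i x : a <= s -> s <= b -> inc2 D s s (fun y => y 0 i) x = 0.
Proof.
move=> as_ sb; have := inc2_chen i x as_ (lexx s) (lexx s) sb.
rewrite inc_same// [X in _ + X + _](_ : _ = 0); last first.
  by rewrite /grad big1// => j _; rewrite mxE mul0r.
lra.
Qed.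

Lemma Wfield_same s : a <= s -> s <= b -> Wfield D s s = fun=> 0.
Proof.
move=> as_ sb; apply/funext => x; apply/rowP => i; rewrite [RHS]mxE.
have := inc2_coord s s i x; rewrite inc2_same// inc_same//.
rewrite [X in _ + _ * X](_ : _ = 0); last first.
  by rewrite /grad big1// => j _; rewrite mxE mul0r.
by rewrite mulr0 addr0 => <-.
Qed.

(** Davie's scheme: one step applies the identity plus the first and second order
    operators of the driver to the coordinate functions. *)
Definition davie s t : vfield R m := fun x => x + (inc D s t x + field_of (inc2 D s t) x).

Lemma davie_same s x : a <= s -> s <= b -> davie s s x = x.
Proof.
move=> as_ sb; apply/rowP => i; rewrite /davie inc_same// !mxE inc2_same//.
by rewrite !addr0.
Qed.

End DriverFormulas.

Section Bounds.
Context {R : realType} {m : nat}.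
Implicit Types (F : R -> R -> vfield R m).

Lemma Calpha_norm0 (alpha : R) :
  (Calpha_norm alpha ((fun=> 0%R) : vfield R m) <= 0)%E.
Proof.
have pd0 (l : seq 'I_m) : pder l (fun=> 0 : 'rV[R]_m) = fun=> 0 :> 'rV[R]_m.
  by elim: l => //= j l ->; apply/funext => x; rewrite derive_cst.
rewrite /Calpha_norm -[leRHS]adde0.
apply: leeD; last first.
  by apply: sup0_le => // z [l [x [y [_ _ ->]]]]; rewrite pd0 subrr normr0 mul0r.
apply: sume_le0 => i _; apply: sup0_le => // z [l [x [_ ->]]].
by rewrite pd0 normr0.
Qed.

(** Intervals of length zero, on which the weighted supremum says nothing, are
    covered by the vanishing of the increments there. *)
Lemma sup_norm_bound (a b alpha : R) F (w : R -> R) :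
  (forall h, 0 < h -> 0 < w h) -> (forall h, 0 <= w h) ->
  (forall s, a <= s -> s <= b -> F s s = fun=> 0) ->
  (sup0 [set z | exists s t, [/\ (a <= s)%R, (s < t)%R, (t <= b)%R
    & z = (Calpha_norm alpha (F s t) * ((w `|(t - s)%R|)^-1)%:E)%E]] < +oo)%E ->
  exists2 N, 0 <= N & forall s t, a <= s -> s <= t -> t <= b ->
    (Calpha_norm alpha (F s t) <= (N * w (t - s))%:E)%E.
Proof.
move=> wp w0 F0; set S := [set z | _] => Sfin.
have S0 := sup0_ge0 S.
have Sf : sup0 S \is a fin_num by rewrite ge0_fin_numE.
exists (fine (sup0 S)); first exact: fine_ge0.
move=> s t as_ st tb.
have [stE|st'] := eqVneq s t.
  rewrite -stE F0//; last by rewrite stE.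
  by apply: le_trans (Calpha_norm0 _) _; rewrite lee_fin mulr_ge0// fine_ge0.
have {}st : s < t by rewrite lt_neqAle st'.
have ts0 : 0 < t - s by rewrite subr_gt0.
have H : (Calpha_norm alpha (F s t) * ((w (t - s))^-1)%:E <= sup0 S)%E.
  by apply: sup0_ub; exists s, t; rewrite (gtr0_norm ts0).
by rewrite EFinM fineK// -lee_pdivrMr// wp.
Qed.
End Bounds.

(** * A rough driver generates an almost flow *)

Section DavieFlow.
Context {R : realType} {m : nat}.
Variables (a b p rho : R) (D : driver R m).
Hypotheses (hp : 2 <= p < 3) (hrho : p / 3 < rho <= 1).
Hypothesis wg : weak_geometric a b p rho D.
Implicit Types (s t u : R) (x y : 'rV[R]_m).

Local Notation V s t i := (fun x => inc D s t x 0 i).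
Local Notation W s t i := (fun x => Wfield D s t x 0 i).

Let p0 : 0 < p. Proof. by case/andP: hp => h _; apply: lt_le_trans h. Qed.

Lemma rho01 : 0 < rho <= 1.
Proof.
case/andP: hrho => h ->; rewrite andbT; apply: lt_trans h; exact: divr_gt0.
Qed.

Lemma exponent_gt1 : 1 < 3 / p * rho.
Proof.
case/andP: hrho => h _; rewrite mulrAC ltr_pdivlMr// mul1r.
by move: h; rewrite ltr_pdivrMr// mulrC.
Qed.

Lemma powR2 h : h `^ (2 / p) = (h `^ p^-1) ^+ 2.
Proof. by rewrite mulrC powRrM powR_mulrn// powR_ge0. Qed.

Lemma powR3 h : h `^ (3 / p) = (h `^ p^-1) ^+ 3.
Proof. by rewrite mulrC powRrM powR_mulrn// powR_ge0. Qed.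

Lemma powR3rho h : h `^ (3 / p * rho) = (h `^ p^-1) `^ (3 * rho).
Proof. by rewrite -powRrM; congr (_ `^ _); ring. Qed.

(** The drift-like part of a step: the field [W] corrected by half the derivative
    of [V] along itself, see [inc2_coord]. *)
Definition lift2 s t : vfield R m := field_of (inc2 D s t).
Definition davie_incr s t : vfield R m := fun x => inc D s t x + lift2 s t x.

Lemma driver_regular : exists2 N, 0 <= N & forall s t, a <= s -> s <= t -> t <= b ->
  forall i, regular 2 rho (N * (t - s) `^ p^-1) (V s t i)
         /\ regular 1 rho (N * ((t - s) `^ p^-1) ^+ 2) (W s t i).
Proof.
have [_ [CV NV] [CW NW] _] := wg.
have [N1 N10 H1] := @sup_norm_bound R m a b (2 + rho) (inc D) (fun h => h `^ p^-1)
  (fun h h0 => powR_gt0 _ h0) (fun h => powR_ge0 _ _)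
  (fun s as_ sb => inc_same wg as_ sb) NV.
have [N2 N20 H2] := @sup_norm_bound R m a b (1 + rho) (Wfield D) (fun h => h `^ (2 / p))
  (fun h h0 => powR_gt0 _ h0) (fun h => powR_ge0 _ _)
  (fun s as_ sb => Wfield_same wg as_ sb) NW.
have reg_weaken k c c' f : c <= c' -> regular k rho c f -> @regular R m k rho c' f.
  move=> cc [h1 h2 h3]; split => //.
    by move=> l x lk; apply: le_trans cc; exact: h2.
  by move=> l lk x y; apply: le_trans (h3 l lk x y) _; rewrite ler_wpM2r// powR_ge0.
exists (m.+1%:R * (N1 + N2)); first by rewrite mulr_ge0// addr_ge0.
move=> s t as_ st tb i; set y := (t - s) `^ p^-1.
have y0 : 0 <= y by exact: powR_ge0.
split.
- apply: (reg_weaken _ (m.+1%:R * (N1 * y))).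
    by rewrite mulrA ler_wpM2r// ler_wpM2l// lerDl.
  apply: (@regular_vfield _ _ 2 rho (N1 * y) (inc D s t)) => //.
  + exact: rho01.
  + exact: mulr_ge0.
  + by have [] := CV s t as_ st tb.
  + exact: H1.
- apply: (reg_weaken _ (m.+1%:R * (N2 * y ^+ 2))).
    by rewrite mulrA ler_wpM2r ?exprn_ge0// ler_wpM2l// lerDr.
  apply: (@regular_vfield _ _ 1 rho (N2 * y ^+ 2) (Wfield D s t)) => //.
  + exact: rho01.
  + by rewrite mulr_ge0// exprn_ge0.
  + by have [_ []] := CW s t as_ st tb.
  + by rewrite /y -powR2; exact: H2.
Qed.

(** Closure of [C1rho] under products turns the bounds on [V] and [W] into a bound
    on the correction [lift2], which is of second order in [y]. *)
Lemma driver_classes : exists2 K, 0 <= K & forall s t, a <= s -> s <= t -> t <= b -> t - s <= 1 ->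
  let y := (t - s) `^ p^-1 in
  [/\ field_C1rho rho (K * y) (inc D s t),
      forall i j, C1rho rho (K * y) (pd j (V s t i)),
      field_C1rho rho (K * y ^+ 2) (lift2 s t),
      field_C1rho rho (K * y) (davie_incr s t)
    & forall i, C1rho rho (K * y ^+ 2) (W s t i)].
Proof.
have [N N0 H] := driver_regular; have r01 := rho01.
pose K1 := m.+2%:R * N.
have K10 : 0 <= K1 by exact: mulr_ge0.
pose K2 := K1 + 2 * m%:R * K1 ^+ 2.
have K12 : K1 <= K2 by rewrite lerDl !mulr_ge0 ?exprn_ge0.
have K20 : 0 <= K2 := le_trans K10 K12.
exists (K1 + K2); first exact: addr_ge0.
move=> s t as_ st tb ts1 y.
have y0 : 0 <= y by exact: powR_ge0.
have y1 : y <= 1 by apply: powR_le1; rewrite ?subr_ge0 ?invr_ge0 ?(ltW p0).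
have y20 : 0 <= y ^+ 2 by exact: exprn_ge0.
have yy : y ^+ 2 <= y by rewrite expr2 ler_piMr.
have HV i : C1rho rho (K1 * y) (V s t i) /\ forall j, C1rho rho (K1 * y) (pd j (V s t i)).
  have [h _] := H s t as_ st tb i.
  by rewrite /K1 -mulrA; apply: regular2_C1rho => //; exact: mulr_ge0.
have HW i : C1rho rho (K1 * y ^+ 2) (W s t i).
  have [_ h] := H s t as_ st tb i.
  by rewrite /K1 -mulrA; apply: regular1_C1rho => //; exact: mulr_ge0.
have HB i : C1rho rho (K2 * y ^+ 2) (fun x => lift2 s t x 0 i).
  have -> : (fun x => lift2 s t x 0 i) = fun x => W s t i x
     + 2^-1 * (\sum_(j < m) inc D s t x 0 j * pd j (V s t i) x).
    by apply/funext => x; rewrite /lift2 mxE inc2_coord.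
  have -> : K2 * y ^+ 2 = K1 * y ^+ 2 + `|2^-1| * (m%:R * (4 * (K1 * y * (K1 * y)))).
    by rewrite ger0_norm ?invr_ge0// /K2; field.
  apply: C1rhoD; first exact: HW.
  apply: C1rhoZ; apply: C1rho_sum => j; apply: C1rhoM; rewrite ?mulr_ge0//.
  - by have [] := HV j.
  - by have [] := HV i.
split.
- by move=> i; have [h _] := HV i; apply: C1rho_weaken h; rewrite ler_wpM2r// lerDl.
- by move=> i j; have [_ h] := HV i; apply: C1rho_weaken (h j); rewrite ler_wpM2r// lerDl.
- by move=> i; apply: C1rho_weaken (HB i); rewrite ler_wpM2r// lerDr.
- move=> i; have [h _] := HV i.
  rewrite (_ : (fun x => davie_incr s t x 0 i) = fun x => V s t i x + lift2 s t x 0 i); last first.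
    by apply/funext => x; rewrite mxE.
  apply: C1rho_weaken (C1rhoD h (HB i)); rewrite [leRHS]mulrDl lerD2l.
  exact: ler_wpM2l.
- by move=> i; apply: C1rho_weaken (HW i); rewrite ler_wpM2r// lerDl.
Qed.

(** Additivity of the increments and Chen's relation on coordinate functions
    remove everything except Taylor remainders. *)
Lemma davie_defect s u t x i : a <= s -> s <= u -> u <= t -> t <= b ->
  (davie D u t (davie D s u x) - davie D s t x) 0 i =
  defect (inc D u t) (lift2 u t) (davie_incr s u) (lift2 s u) i x.
Proof.
move=> as_ su ut tb.
have davieE s' t' z : davie D s' t' z = z + davie_incr s' t' z by [].
rewrite !davieE /defect /= /davie_incr !mxE (inc2_chen wg i x as_ su ut tb).
rewrite (inc_add wg x as_ su ut tb) !mxE gradD.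
set gA := grad _ x (inc D s u x); set gB := grad _ x (lift2 s u x).
rewrite -/(lift2 s u) -/(lift2 u t); ring.
Qed.

Lemma davie_almost_flow : exists2 K, 0 <= K &
  almost_flow a b p^-1 (3 / p) rho K (davie D).
Proof.
have [K K0 H] := driver_classes; have r01 := rho01.
pose cd := 2 * m%:R ^+ 2 * K ^+ 3 + 2 * m%:R * K ^+ 2.
pose cl := m%:R ^+ 2 * K ^+ 2 * K `^ rho + 2 * m%:R ^+ 3 * K ^+ 3 + 3 * m%:R ^+ 2 * K ^+ 2
   + m%:R * K * K `^ rho.
have Kr0 : 0 <= K `^ rho by exact: powR_ge0.
have cd0 : 0 <= cd by rewrite addr_ge0// !mulr_ge0// exprn_ge0.
have cl0 : 0 <= cl by rewrite !addr_ge0// !mulr_ge0// exprn_ge0.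
have mK0 : 0 <= m%:R * K by exact: mulr_ge0.
pose K' := K + m%:R * K + cd + cl.
have KK : K <= K' by rewrite /K'; lra.
have mKK : m%:R * K <= K' by rewrite /K'; lra.
have cdK : cd <= K' by rewrite /K'; lra.
have clK : cl <= K' by rewrite /K'; lra.
clearbody K'.
have y01 h : 0 <= h -> h <= 1 -> 0 <= h `^ p^-1 <= 1.
  by move=> h0 h1; rewrite powR_ge0 powR_le1// invr_ge0 ltW.
have ymono h h' : 0 <= h -> h <= h' -> h `^ p^-1 <= h' `^ p^-1.
  move=> h0 hh; apply: ge0_ler_powR; rewrite ?nnegrE ?invr_ge0 ?(ltW p0)//.
  exact: le_trans hh.
have davieE s t x : davie D s t x = x + davie_incr s t x by [].
exists K'; first exact: le_trans KK.
have davieB s t x y : davie D s t x - davie D s t y = (x - y) + (davie_incr s t x - davie_incr s t y).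
  by rewrite !davieE opprD addrACA.
split.
- by move=> s x as_ sb; apply: (davie_same wg).
- move=> s t x as_ st tb ts1; have [_ _ _ HG _] := H s t as_ st tb ts1.
  rewrite davieE addrC addKr.
  apply: le_trans (field_C1rho_bound x _ HG) _; first by rewrite mulr_ge0// powR_ge0.
  by rewrite ler_wpM2r// powR_ge0.
- move=> s t x y as_ st tb ts1; have [_ _ _ HG _] := H s t as_ st tb ts1.
  rewrite davieB; apply: le_trans (ler_normD _ _) _; rewrite mulrDl mul1r lerD2l.
  apply: le_trans (field_C1rho_lip x y _ HG) _; first by rewrite mulr_ge0// powR_ge0.
  rewrite (_ : m%:R * _ = m%:R * K * ((t - s) `^ p^-1 * `|x - y|)); last by ring.
  by rewrite -[leRHS]mulrA ler_wpM2r ?mulr_ge0 ?powR_ge0.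
- move=> s t x y x' y' z as_ st tb ts1 xz yz; have [_ _ _ HG _] := H s t as_ st tb ts1.
  have /andP[w0 w1] : 0 <= (t - s) `^ p^-1 <= 1 by apply: y01 => //; rewrite subr_ge0.
  set w := (t - s) `^ p^-1 in HG w0 w1 *.
  have z0 : 0 <= z by apply: le_trans xz.
  rewrite !davieB.
  rewrite (_ : x - y + _ - _ = ((x - y) - (x' - y'))
    + ((davie_incr s t x - davie_incr s t y) - (davie_incr s t x' - davie_incr s t y'))); last first.
    move: (davie_incr s t x) (davie_incr s t y) (davie_incr s t x') (davie_incr s t y') => g1 g2 g3 g4.
    by apply/rowP => i; rewrite !mxE; ring.
  apply: le_trans (ler_normD _ _) _.
  rewrite (_ : (1 + K' * w) * `|x - y - (x' - y')| + K' * `|x - y| * z `^ rho =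
    `|x - y - (x' - y')| + (K' * w * `|x - y - (x' - y')| + K' * `|x - y| * z `^ rho)); last by ring.
  rewrite lerD2l.
  apply: le_trans (field_C1rho_4pt r01 _ HG xz yz) _; first by rewrite mulr_ge0.
  apply: lerD.
    rewrite (_ : m%:R * _ = m%:R * K * (w * `|x - y - (x' - y')|)); last by ring.
    by rewrite -[leRHS]mulrA ler_wpM2r ?mulr_ge0.
  rewrite (_ : m%:R * _ = m%:R * K * w * (`|x - y| * z `^ rho)); last by ring.
  rewrite -[leRHS]mulrA; apply: ler_wpM2r; first by rewrite mulr_ge0// powR_ge0.
  by apply: le_trans mKK; rewrite ler_piMr.
- move=> s u t x as_ su ut tb ts1.
  have us1 : u - s <= 1 by lra.
  have tu1 : t - u <= 1 by lra.
  have [_ _ HBs HG _] := H s u as_ su (le_trans ut tb) us1.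
  have [HA HdA HB _ _] := H u t (le_trans as_ su) ut tb tu1.
  have ts0 : 0 <= t - s by lra.
  have w01 := y01 _ ts0 ts1; have /andP[w0 w1] := w01.
  have m1 : (u - s) `^ p^-1 <= (t - s) `^ p^-1 by apply: ymono; lra.
  have m2 : (t - u) `^ p^-1 <= (t - s) `^ p^-1 by apply: ymono; lra.
  have e1 : 0 <= (u - s) `^ p^-1 by exact: powR_ge0.
  have e2 : 0 <= (t - u) `^ p^-1 by exact: powR_ge0.
  rewrite powR3; set y := (t - s) `^ p^-1 in m1 m2 w0 w1 w01 *.
  apply: rV_norm_le => [|i]; first by rewrite mulr_ge0 ?exprn_ge0//; exact: le_trans KK.
  rewrite davie_defect//.
  apply: le_trans (@defect_bound _ _ rho r01 K y _ _ _ _ K0 w01 _ _ _ _ _ i x) _; last 1 first.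
  + by rewrite ler_wpM2r// exprn_ge0.
  + by move=> j; apply: C1rho_weaken (HA j); rewrite ler_wpM2l.
  + by move=> j k; apply: C1rho_weaken (HdA j k); rewrite ler_wpM2l.
  + by move=> j; apply: C1rho_weaken (HB j); rewrite ler_wpM2l// lerXn2r// nnegrE.
  + by move=> j; apply: C1rho_weaken (HG j); rewrite ler_wpM2l.
  + by move=> j; apply: C1rho_weaken (HBs j); rewrite ler_wpM2l// lerXn2r// nnegrE.
- move=> s u t x x' as_ su ut tb ts1.
  have us1 : u - s <= 1 by lra.
  have tu1 : t - u <= 1 by lra.
  have [_ _ HBs HG _] := H s u as_ su (le_trans ut tb) us1.
  have [HA HdA HB _ _] := H u t (le_trans as_ su) ut tb tu1.
  have ts0 : 0 <= t - s by lra.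
  have w01 := y01 _ ts0 ts1; have /andP[w0 w1] := w01.
  have m1 : (u - s) `^ p^-1 <= (t - s) `^ p^-1 by apply: ymono; lra.
  have m2 : (t - u) `^ p^-1 <= (t - s) `^ p^-1 by apply: ymono; lra.
  have e1 : 0 <= (u - s) `^ p^-1 by exact: powR_ge0.
  have e2 : 0 <= (t - u) `^ p^-1 by exact: powR_ge0.
  rewrite powR3rho; set y := (t - s) `^ p^-1 in m1 m2 w0 w1 w01 *.
  apply: rV_norm_le => [|i].
    by rewrite !mulr_ge0 ?powR_ge0//; exact: le_trans KK.
  rewrite mxE [X in _ + X]mxE !davie_defect//.
  apply: le_trans (@defect_lip _ _ rho r01 K y _ _ _ _ K0 w01 _ _ _ _ _ i x x') _; last 1 first.
  + by rewrite ler_wpM2r// ler_wpM2r ?powR_ge0.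
  + by move=> j; apply: C1rho_weaken (HA j); rewrite ler_wpM2l.
  + by move=> j k; apply: C1rho_weaken (HdA j k); rewrite ler_wpM2l.
  + by move=> j; apply: C1rho_weaken (HB j); rewrite ler_wpM2l// lerXn2r// nnegrE.
  + by move=> j; apply: C1rho_weaken (HG j); rewrite ler_wpM2l.
  + by move=> j; apply: C1rho_weaken (HBs j); rewrite ler_wpM2l// lerXn2r// nnegrE.
Qed.
End DavieFlow.

(** * Taylor expansions of the flow and arctangent test functions *)

Section Solves.
Context {R : realType} {m : nat}.
Variables (a b p rho : R) (D : driver R m).
Hypotheses (hp : 2 <= p < 3) (hrho : p / 3 < rho <= 1).
Hypothesis wg : weak_geometric a b p rho D.
Implicit Types (s t u : R) (x y : 'rV[R]_m).

(** Splitting the second order operator into its action on first and on second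
    derivatives; the vector field that acts on first derivatives is [lift2] again. *)
Lemma inc2E s t f x : a <= s -> s <= t -> t <= b -> ndifferentiable 2 (f : 'rV[R]_m -> R^o) ->
  inc2 D s t f x = grad f x (lift2 D s t x)
    + 2^-1 * \sum_i inc D s t x 0 i * grad (pd i f) x (inc D s t x).
Proof.
move=> as_ st tb df; have [_ _ [CW _] _] := wg.
have [N _ reg] := driver_regular hp hrho wg.
have sV i : smooth (fun z => inc D s t z 0 i).
  by have [[h _ _] _] := reg s t as_ st tb i; exact: (h [::]).
have sf i : smooth (pd i f) by exact: (df [:: i]).
have [Wv _] := CW s t as_ st tb.
have E : inc2 D s t f x = Wop D s t f x + 2^-1 * vop (inc D s t) (vop (inc D s t) f) x.
  by rewrite /Wop subrK.
rewrite E (Wv f df x) vop_vop// vopE -/(Wfield D s t) mulrDr addrA; congr (_ + _).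
rewrite -gradZ -gradD; congr (grad f x _); apply/rowP => i.
by rewrite [in RHS]/lift2 [RHS]mxE inc2_coord !mxE.
Qed.

(** Expanding at [x] along the full increment and along [V] alone gives remainders
    that differ at third order by [taylor_rem_lip], and the expansion along [V] is
    [taylor2]. *)
Lemma davie_taylor : exists2 C, 0 <= C & forall f N, 0 <= N -> regular 2 1 N f ->
  forall s t x, a <= s -> s <= t -> t <= b -> t - s <= 1 ->
  `|f (davie D s t x) - (f x + vop (inc D s t) f x + inc2 D s t f x)| <= C * N * (t - s) `^ (3 / p).
Proof.
have [K K0 H] := driver_classes hp hrho wg.
exists (2 * m%:R ^+ 2 * K ^+ 2 + m%:R ^+ 2 * K ^+ 3).
  by rewrite addr_ge0// !mulr_ge0// exprn_ge0.
move=> f N N0 [sf bf hf] s t x as_ st tb ts1.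
have [HV _ HB HG _] := H s t as_ st tb ts1.
have df : ndifferentiable 2 (f : 'rV[R]_m -> R^o) by move=> l l2; exact: sf.
rewrite inc2E// powR3 vopE.
have y0 : 0 <= (t - s) `^ p^-1 by exact: powR_ge0.
have y1 : (t - s) `^ p^-1 <= 1.
  have p0 : 0 <= p by case/andP: hp => h _; apply: le_trans h.
  by apply: powR_le1; rewrite ?subr_ge0 ?invr_ge0.
move: HV HB HG y0 y1; set y := (t - s) `^ p^-1 => HV HB HG y0 y1.
have Ky0 : 0 <= K * y by exact: mulr_ge0.
have Vb := field_C1rho_bound x Ky0 HV; have Gb := field_C1rho_bound x Ky0 HG.
have Bb : `|lift2 D s t x| <= K * y ^+ 2.
  by apply: field_C1rho_bound HB; rewrite mulr_ge0// exprn_ge0.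
have s0 : smooth f by exact: (sf [::]).
have s1 i : smooth (pd i f) by exact: (sf [:: i]).
have b2 i j z : `|pd j (pd i f) z| <= N by exact: (bf [:: j; i]).
have h2 i j : holder 1 N (pd j (pd i f)) by exact: (hf [:: j; i]).
have H1 := taylor_rem_lip s0 s1 N0 b2 ler01 N0 h2 x x Gb Vb.
have H2 := taylor2 s0 s1 N0 h2 x (inc D s t x).
rewrite -/(davie_incr D s t x) in H1 *.
have GV : davie_incr D s t x - inc D s t x = lift2 D s t x by rewrite /davie_incr addrC addKr.
rewrite GV subrr normr0 mulr0 mulr0 add0r in H1.
have {}H1 : `|(f (x + davie_incr D s t x) - f x - grad f x (davie_incr D s t x))
   - (f (x + inc D s t x) - f x - grad f x (inc D s t x))| <= 2 * m%:R ^+ 2 * K ^+ 2 * N * y ^+ 3.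
  apply: le_trans H1 _.
  rewrite (_ : 2 * m%:R ^+ 2 * K ^+ 2 * N * y ^+ 3 = 2 * m%:R ^+ 2 * (N * (K * y) * (K * y ^+ 2))); last by ring.
  by rewrite ler_wpM2l ?mulr_ge0 ?exprn_ge0//; apply: ler_wpM2l => //; exact: mulr_ge0.
have {}H2 : `|f (x + inc D s t x) - f x - grad f x (inc D s t x)
     - 2^-1 * (\sum_i inc D s t x 0 i * grad (pd i f) x (inc D s t x))| <= m%:R ^+ 2 * K ^+ 3 * N * y ^+ 3.
  apply: le_trans H2 _.
  rewrite (_ : m%:R ^+ 2 * K ^+ 3 * N * y ^+ 3 = m%:R ^+ 2 * (N * (K * y) ^+ 3)); last by ring.
  by rewrite ler_wpM2l ?exprn_ge0//; apply: ler_wpM2l => //; rewrite lerXn2r// nnegrE.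
have Gadd : grad f x (davie_incr D s t x) = grad f x (inc D s t x) + grad f x (lift2 D s t x).
  by rewrite -gradD.
rewrite Gadd in H1.
have -> : davie D s t x = x + davie_incr D s t x by [].
move: H1 H2; set S := \sum_i _; set q1 := f (x + davie_incr D s t x); set q2 := f (x + inc D s t x).
set gV := grad f x (inc D s t x); set gB := grad f x (lift2 D s t x) => H1 H2.
rewrite (_ : q1 - _ = ((q1 - f x - (gV + gB)) - (q2 - f x - gV)) + (q2 - f x - gV - 2^-1 * S)); last by ring.
apply: le_trans (ler_normD _ _) _; apply: le_trans (lerD H1 H2) _.
by rewrite le_eqVlt; apply/orP; left; apply/eqP; ring.
Qed.

Lemma davie_flow_near : exists delta C : R, [/\ 0 < delta, delta <= 1, 0 <= C & forall s t x,
  a <= s -> s <= t -> t <= b -> t - s <= delta ->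
  `|flow (davie D) s t x - davie D s t x| <= C * (t - s) `^ (3 / p)].
Proof.
have [K K0 AF] := davie_almost_flow hp hrho wg.
have p0 : 0 < p by case/andP: hp => h _; apply: lt_le_trans h.
have /andP[r0 r1] := rho01 hp hrho.
have q0 : 0 < p^-1 by rewrite invr_gt0.
have [d [C [d0 C0 H]]] := flow_near q0 r0 r1 (exponent_gt1 hp hrho) K0 AF.
exists (Num.min d 1), C; split => //; first by rewrite lt_min d0 ltr01.
  by rewrite ge_min lexx orbT.
by move=> s t x as_ st tb; rewrite le_min => /andP[ts _]; exact: H.
Qed.

Lemma davie_flow_solves : solves a b p D (fun t s => flow (davie D) s t).
Proof.
have [d [C [d0 d1 C0 H]]] := davie_flow_near.
have [C' C'0 HT] := davie_taylor.
pose C2 := m.+1%:R * (m%:R * C + C').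
have C20 : 0 <= C2 by rewrite mulr_ge0// addr_ge0// mulr_ge0.
exists d, C2; split => // f [df fN] s t as_ st tb ts.
have N0' : (0 <= Calpha_norm 3 (f : _ -> R^o))%E.
  by rewrite /Calpha_norm adde_ge0 ?sup0_ge0// sume_ge0// => i _; exact: sup0_ge0.
have Nf : Calpha_norm 3 (f : _ -> R^o) \is a fin_num by rewrite ge0_fin_numE.
move: (fineK Nf) (fine_ge0 N0'); set N := fine _ => NE N0; rewrite -NE.
have E3 : 2%:R + 1 = 3 :> R by lra.
have rf : regular 2 1 (m.+1%:R * N) f.
  apply: (@regular_scalar R m 2 1 N f) => //; rewrite ?ltr01 ?lexx//.
    by rewrite E3.
  by rewrite E3 NE.
have MN0 : 0 <= m.+1%:R * N by exact: mulr_ge0.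
have [sf bf _] := rf.
have w0 : 0 <= (t - s) `^ (3 / p) by exact: powR_ge0.
have ts0 : 0 <= t - s by rewrite subr_ge0.
rewrite (ger0_norm ts0) -!EFinM.
apply: sup0_le; first by rewrite lee_fin mulr_ge0// mulr_ge0.
move=> _ [x ->]; rewrite lee_fin.
have H1 := HT f _ MN0 rf s t x as_ st tb (le_trans ts d1).
have H2 : `|f (flow (davie D) s t x) - f (davie D s t x)| <=
    m%:R * (m.+1%:R * N * (C * (t - s) `^ (3 / p))).
  apply: le_trans (smooth_lip (c := m.+1%:R * N) (sf [::] isT) _ _ _) _.
    by move=> j z; exact: (bf [:: j]).
  by rewrite ler_wpM2l//; apply: ler_wpM2l => //; exact: H.
rewrite -(subrKA (f (davie D s t x))).
apply: le_trans (ler_normD _ _) _; apply: le_trans (lerD H2 H1) _.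
by rewrite le_eqVlt; apply/orP; left; apply/eqP; rewrite /C2; ring.
Qed.

End Solves.

Section Arctan.
Context {R : realType}.
Implicit Types u : R.

Lemma atan_norm_le1 u : `|atan u| <= 2^-1 -> `|u| <= 1.
Proof.
have pi4 : 2^-1 <= pi / 4 :> R by have := @pi_ge2 R; lra.
move=> /ler_normlP[a1 a2]; rewrite ler_norml; apply/andP; split; rewrite leNgt; apply/negP => u1.
  by have := @lt_atan R _ _ u1; rewrite atanN atan1; lra.
by have := @lt_atan R _ _ u1; rewrite atan1; lra.
Qed.

(** By the mean value theorem [atan u = u / (1 + (c * u)^2)] for some [c] in the
    unit interval; boundedness of [u] comes from [1 / 2 <= pi / 4 = atan 1]. *)
Lemma atan_small u : `|atan u| <= 2^-1 -> `|u - atan u| <= 4 * `|atan u| ^+ 3.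
Proof.
move=> /atan_norm_le1 u1.
have [|c /andP[c0 c1]] := @MVT_unit R (fun t => atan (t * u)) (fun t => u * (1 + (t * u) ^+ 2)^-1).
  move=> t; rewrite mulrC.
  have H : is_derive t 1 (fun t : R => 0 + t * u : R^o) u by exact: is_derive_affine.
  have -> : (fun t : R => atan (t * u)) = atan \o (fun t => 0 + t * u).
    by apply/funext => z /=; rewrite add0r.
  apply: is_derive1_comp.
  by rewrite add0r; exact: is_derive1_atan.
rewrite mul1r mul0r atan0 subr0 => E.
have D0 : 0 < 1 + (c * u) ^+ 2 by rewrite ltr_wpDr ?ltr01// sqr_ge0.
have uE : u = atan u * (1 + (c * u) ^+ 2) by rewrite E mulfVK// gt_eqF.
have cu : (c * u) ^+ 2 <= u ^+ 2.
  by rewrite exprMn ler_piMl ?sqr_ge0// exprn_ile1.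
have uu : u ^+ 2 <= 1.
  by rewrite -real_normK ?num_real// exprn_ile1.
have u2 : `|u| <= 2 * `|atan u|.
  rewrite [in leLHS]uE normrM mulrC ler_wpM2r// ger0_norm; last exact: ltW.
  lra.
rewrite (_ : u - atan u = atan u * (c * u) ^+ 2); last first.
  by apply/eqP; rewrite subr_eq; apply/eqP; rewrite {1}uE; ring.
rewrite normrM (ger0_norm (sqr_ge0 _)).
rewrite (_ : 4 * `|atan u| ^+ 3 = `|atan u| * (2 * `|atan u|) ^+ 2); last by ring.
apply: ler_wpM2l => //; apply: le_trans cu _.
by rewrite -real_normK ?num_real// lerXn2r// nnegrE mulr_ge0.
Qed.

Definition datan (k : nat) (u : R) : R :=
  let w := (1 + u ^+ 2)^-1 in
  match k with
  | 0 => atan u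
  | 1 => w
  | 2 => - (2 * u) * w ^+ 2
  | _ => - 2 * w ^+ 2 + 8 * u ^+ 2 * w ^+ 3
  end.

Lemma den_gt0 u : 0 < 1 + u ^+ 2.
Proof. by rewrite ltr_wpDr ?ltr01// sqr_ge0. Qed.

Lemma is_derive_den u : is_derive u 1 (fun u : R => (1 + u ^+ 2)^-1 : R^o) (- (2 * u) * (1 + u ^+ 2)^-1 ^+ 2).
Proof.
have d0 := den_gt0 u.
have H : is_derive u 1 (fun u : R => 1 + u * u : R^o) (u + u).
  have Hid : is_derive u 1 (fun s : R => 0 + s * 1 : R^o) 1 by exact: is_derive_affine.
  have Hs := is_deriveD (is_derive_cst (1 : R^o) u 1) (is_derive_mul_fun Hid Hid).
  have -> : (fun u : R => 1 + u * u : R^o)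
    = cst 1 + (fun s : R => (0 + s * 1) * (0 + s * 1) : R^o).
    apply/funext => s; transitivity (1 + (0 + s * 1) * (0 + s * 1)) => //.
    by rewrite add0r mulr1.
  by apply: (is_derive_eq Hs); ring.
have -> : (fun u : R => (1 + u ^+ 2)^-1 : R^o) = (fun u : R => (1 + u * u)^-1 : R^o).
  by apply/funext => z; rewrite expr2.
have [dH dE] := H.
have n0 : 1 + u * u != 0 by rewrite -expr2 gt_eqF.
split; first exact: (@derivableV _ _ (fun u : R => 1 + u * u)).
have := @deriveV R _ (fun u : R => 1 + u * u) u 1 n0 dH.
rewrite dE => ->; rewrite /GRing.scale /=; by field; rewrite -?expr2 gt_eqF.
Qed.

Lemma is_derive_datan k u : (k < 3)%N -> is_derive u 1 (datan k : R -> R^o) (datan k.+1 u).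
Proof.
have d0 := den_gt0 u.
have H := is_derive_den u.
have Hu : is_derive u 1 (fun u : R => 0 + u * (-2) : R^o) (-2) by exact: is_derive_affine.
case: k => [|[|[|//]]] _.
- exact: is_derive1_atan.
- exact: H.
- have H2 := is_derive_mul_fun H H.
  have H3 := is_derive_mul_fun Hu H2.
  have -> : (datan 2 : R -> R^o) = (fun u : R => (0 + u * (-2)) * ((1 + u ^+ 2)^-1 * (1 + u ^+ 2)^-1) : R^o).
    by apply/funext => z; rewrite /datan expr2; ring.
  apply: (is_derive_eq H3); rewrite /datan; ring.
Qed.

Lemma datan_bound k u : (k <= 3)%N -> `|datan k u| <= pi + 10.
Proof.
have d0 := den_gt0 u; have p2 := @pi_ge2 R.
set w := (1 + u ^+ 2)^-1.
have w0 : 0 < w by rewrite invr_gt0.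
have w1 : w <= 1 by rewrite invf_le1// lerDl sqr_ge0.
have uw : u ^+ 2 * w <= 1.
  by rewrite /w ler_pdivrMr// mul1r lerDr.
have u20 : 0 <= u ^+ 2 by exact: sqr_ge0.
have ww : w ^+ 2 <= 1 by rewrite exprn_ile1// ltW.
have ww0 : 0 <= w ^+ 2 by exact: sqr_ge0.
case: k => [|[|[|[|//]]]] _.
- rewrite /datan; have := atan_gtNpi2 u; have := atan_ltpi2 u.
  rewrite ler_norml => h1 h2; apply/andP; split; lra.
- rewrite /datan -/w ger0_norm; lra.
- rewrite /datan -/w normrM normrN normrM (ger0_norm ww0) (ger0_norm (ler0n _ 2)).
  have : `|u| * w ^+ 2 <= 1.
    have h : `|u| * w <= 1.
      rewrite /w ler_pdivrMr// mul1r -[u ^+ 2]real_normK ?num_real//.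
      by have := sqr_ge0 (`|u| - 1); have := normr_ge0 u; rewrite sqrrB1; lra.
    rewrite expr2 mulrA; apply: le_trans (_ : 1 * w <= _); last by lra.
    by rewrite ler_wpM2r// ltW.
  lra.
- rewrite /datan -/w.
  have h : 0 <= u ^+ 2 * w ^+ 3 <= 1.
    apply/andP; split; first by rewrite mulr_ge0// exprn_ge0// ltW.
    rewrite (_ : u ^+ 2 * w ^+ 3 = u ^+ 2 * w * w ^+ 2); last by ring.
    by apply: le_trans (_ : 1 * w ^+ 2 <= _); [rewrite ler_wpM2r|rewrite mul1r].
  rewrite -mulrA ler_norml; case/andP: h => h1 h2; apply/andP; split; lra.
Qed.
End Arctan.

Section TestFunction.
Context {R : realType} {m : nat}.
Variables (i : 'I_m) (x0 : 'rV[R]_m).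

(** Solutions are tested against bounded functions only. The arctangent of a
    coordinate centred at the starting point is bounded with its derivatives,
    uniformly in that point, is injective, and has the 2-jet of the coordinate
    there; it thus recovers the displacement up to third order. *)
Definition atan_test (k : nat) (y : 'rV[R]_m) : R := datan k (y 0 i - x0 0 i).

Lemma differentiable_test k : (k < 3)%N -> smooth (atan_test k).
Proof.
move=> k3 x.
have H : differentiable (fun y : 'rV[R]_m => y 0 i - x0 0 i : R^o) x.
  apply: (@differentiableD _ _ _ (fun y : 'rV[R]_m => y 0 i : R^o) (cst (- x0 0 i))) => //.
  exact: differentiable_coord.
apply: (@differentiable_comp _ _ _ _ (fun y : 'rV[R]_m => y 0 i - x0 0 i : R^o) (datan k : R -> R^o)) => //.
by apply/derivable1_diffP; have [] := is_derive_datan (x 0 i - x0 0 i) k3.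
Qed.

Lemma pd_test k j x : (k < 3)%N -> pd j (atan_test k) x = (basis_vec j : 'rV[R]_m) 0 i * atan_test k.+1 x.
Proof.
move=> k3; have sk := differentiable_test k3.
have H := is_derive_seg x (basis_vec j) (0:R) sk.
have E : grad (atan_test k) (x + 0 *: basis_vec j) (basis_vec j) = pd j (atan_test k) x.
  by rewrite seg0 -derive_grad.
rewrite E in H.
have A : is_derive (0:R) 1 (fun s : R => (x 0 i - x0 0 i) + s * (basis_vec j : 'rV[R]_m) 0 i : R^o)
   ((basis_vec j : 'rV[R]_m) 0 i) by exact: is_derive_affine.
have B : is_derive (0:R) 1 (fun s : R => atan_test k (x + s *: basis_vec j) : R^o)
   (atan_test k.+1 x * (basis_vec j : 'rV[R]_m) 0 i).
  have -> : (fun s : R => atan_test k (x + s *: basis_vec j) : R^o) =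
    (datan k : R -> R^o) \o (fun s : R => (x 0 i - x0 0 i) + s * (basis_vec j : 'rV[R]_m) 0 i).
    by apply/funext => s; rewrite /atan_test /= !mxE addrAC.
  apply: is_derive1_comp.
  by rewrite mul0r addr0; exact: is_derive_datan.
by have [_ <-] := H; have [_ ->] := B; rewrite mulrC.
Qed.

Lemma pder_test l : (size l <= 3)%N -> exists2 c : R, `|c| <= 1 &
  pderR l (atan_test 0) = fun y => c * atan_test (size l) y.
Proof.
elim: l => [_|j l IH l3]; first by exists 1; rewrite ?normr1//; apply/funext => y; rewrite mul1r.
have [c c1 E] := IH (ltnW l3).
exists (c * (basis_vec j : 'rV[R]_m) 0 i).
  rewrite normrM mulr_ile1// /basis_vec mxE; case: (_ && _); rewrite ?normr1 ?normr0//.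
apply/funext => x; transitivity (pd j (pderR l (atan_test 0)) x) => //.
by rewrite E pdZ ?pd_test ?mulrA//; exact: differentiable_test.
Qed.

Lemma test_Cb : Cb 3 (atan_test 0 : _ -> R^o) /\
  (Calpha_norm 3 (atan_test 0 : _ -> R^o) <= (4 * (pi + 10) + 2 * (pi + 10))%:E)%E.
Proof.
have n3 : Num.truncn (3 : R) = 3%N by rewrite natrK.
have B l x : (size l <= 3)%N -> `|pderR l (atan_test 0) x| <= pi + 10.
  move=> l3; have [c c1 ->] := pder_test l3; rewrite normrM.
  apply: le_trans (_ : 1 * (pi + 10) <= _); last by rewrite mul1r.
  by apply: ler_pM => //; exact: datan_bound.
have NB : (Calpha_norm 3 (atan_test 0 : _ -> R^o) <= (4 * (pi + 10) + 2 * (pi + 10))%:E)%E.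
  have p0 : 0 <= pi + 10 :> R by have := @pi_ge2 R; lra.
  rewrite /Calpha_norm n3 EFinD; apply: leeD.
    apply: le_trans (_ : \sum_(k < 4) (pi + 10)%:E <= _)%E.
      apply: lee_sum => k _; apply: sup0_le; first by rewrite lee_fin.
      move=> _ [l [x [lk ->]]]; rewrite lee_fin; apply: B; rewrite lk.
      by have := ltn_ord k; rewrite ltnS.
    by rewrite sumEFin lee_fin sumr_const card_ord mulr_natl.
  apply: sup0_le; first by rewrite lee_fin mulr_ge0.
  move=> _ [l [x [y [l3 xy ->]]]]; rewrite lee_fin subrr powRr0 divr1.
  apply: le_trans (ler_normB _ _) _.
  have := B l x (eq_leq l3); have := B l y (eq_leq l3); rewrite /pderR; lra.
split => //; split; last exact: le_lt_trans NB (ltry _).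
rewrite n3 => l l3 x; have [c c1 E] := pder_test (ltnW l3).
have := smoothZ c (differentiable_test l3); rewrite -E; exact.
Qed.

Lemma grad_test k x h : (k < 3)%N -> grad (atan_test k) x h = h 0 i * atan_test k.+1 x.
Proof.
move=> k3; rewrite -[h 0 i](grad_coord i x) /grad mulr_suml; apply: eq_bigr => j _.
by rewrite pd_test// pd_coord mulrA.
Qed.

Lemma test_x0 : [/\ atan_test 0 x0 = 0, atan_test 1 x0 = 1 & atan_test 2 x0 = 0].
Proof.
rewrite /atan_test subrr /datan atan0; split => //.
  by rewrite expr0n /= addr0 invr1.
by rewrite mulr0 oppr0 mul0r.
Qed.
End TestFunction.

(** * Uniqueness of the solution flow *)

Section Uniqueness.
Context {R : realType} {m : nat}.
Variables (a b p rho : R) (D : driver R m).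
Hypotheses (hp : 2 <= p < 3) (hrho : p / 3 < rho <= 1).
Hypothesis wg : weak_geometric a b p rho D.
Implicit Types (s t u : R) (x y : 'rV[R]_m).

(** The second derivative of [atan] vanishes at 0, so no term quadratic in [V] is left. *)
Lemma generator_test s t i x : a <= s -> s <= t -> t <= b ->
  atan_test i x 0 x + vop (inc D s t) (atan_test i x 0) x + inc2 D s t (atan_test i x 0) x = davie_incr D s t x 0 i.
Proof.
move=> as_ st tb; have [T0 T1 T2] := test_x0 i x.
rewrite (inc2E hp hrho wg) //; last first.
  by move=> l l2; have [[h _] _] := test_Cb i x; apply: h; rewrite natrK; exact: leq_trans l2 _.
rewrite vopE !grad_test// T0 T1 !mulr1 add0r [X in _ * X]big1; last first.
  move=> k _; have -> : pd k (atan_test i x 0) = fun y => (basis_vec k : 'rV[R]_m) 0 i * atan_test i x 1 y.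
    by apply/funext => y; rewrite pd_test.
  rewrite -derive_grad; last by apply: smoothZ; exact: differentiable_test.
  rewrite derive_grad; last by apply: smoothZ; exact: differentiable_test.
  have sm := @differentiable_test R m i x 1 isT.
  rewrite (_ : grad _ x _ = (basis_vec k : 'rV[R]_m) 0 i * grad (atan_test i x 1) x (inc D s t x)); last first.
    by rewrite /grad mulr_sumr; apply: eq_bigr => j _; rewrite pdZ//; ring.
  by rewrite grad_test// T2 !mulr0.
by rewrite mulr0 addr0 [RHS]mxE.
Qed.

(** The test functions give the estimate for the arctangent of the displacement.
    This forces the arctangent to be small for short times, hence the displacement
    too, and [atan_small] exchanges the two at third order. *)
Lemma solves_near psi : solves a b p D psi -> exists d C : R, [/\ 0 < d, 0 <= C &
  forall s t x, a <= s -> s <= t -> t <= b -> t - s <= d ->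
  `|psi t s x - davie D s t x| <= C * (t - s) `^ (3 / p)].
Proof.
move=> [delta [C [d0 H]]].
have [K K0 HK] := driver_classes hp hrho wg.
have p0 : 0 < p by case/andP: hp => h _; apply: lt_le_trans h.
have q0 : 0 < p^-1 by rewrite invr_gt0.
pose N : R := 4 * (pi + 10) + 2 * (pi + 10).
have N0 : 0 <= N by have := @pi_ge2 R; rewrite /N; lra.
pose C1 := `|C| * N.
have C10 : 0 <= C1 by rewrite mulr_ge0.
have h20 : (0 : R) < 2^-1 by rewrite invr_gt0.
have [d1 /andP[d10 d11] H1] := small_powR (addr_ge0 K0 C10) q0 h20.
exists (Num.min delta d1), (4 * (K + C1) ^+ 3 + C1).
split; first by rewrite lt_min d0.
  by rewrite addr_ge0// mulr_ge0// exprn_ge0// addr_ge0.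
move=> s t x as_ st tb; rewrite le_min => /andP[tsd tsd1].
have ts0 : 0 <= t - s by rewrite subr_ge0.
have ts1 : t - s <= 1 by exact: le_trans d11.
have [_ _ _ HG _] := HK s t as_ st tb ts1.
rewrite powR3; move: HG (H1 (t - s)); rewrite ts0 tsd1 => HG /(_ isT).
have y0 : 0 <= (t - s) `^ p^-1 by exact: powR_ge0.
have E3 : `|t - s| `^ (3 / p) = ((t - s) `^ p^-1) ^+ 3 by rewrite ger0_norm// powR3.
have y1 : (t - s) `^ p^-1 <= 1 by apply: powR_le1; rewrite ?invr_ge0 ?(ltW p0).
move: HG y0 y1 E3; set y := (t - s) `^ p^-1 => HG y0 y1 E3 Hs.
have y30 : 0 <= y ^+ 3 by exact: exprn_ge0.
apply: rV_norm_le => [|i].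
  by rewrite mulr_ge0// addr_ge0// mulr_ge0// exprn_ge0// addr_ge0.
have [TC TN] := test_Cb i x.
have A1 : `|atan_test i x 0 (psi t s x) - davie_incr D s t x 0 i| <= C1 * y ^+ 3.
  have Hf := H (atan_test i x 0) TC s t as_ st tb tsd.
  have Hx := le_trans (sup0_ub (_ : [set y | exists x : 'rV[R]_m, _] _)) Hf.
  have {}Hx := Hx _ (ex_intro _ x erefl).
  rewrite generator_test// E3 in Hx.
  move: TN Hx; have n0 : (0 <= Calpha_norm 3 (atan_test i x 0 : _ -> R^o))%E.
    by rewrite /Calpha_norm adde_ge0 ?sup0_ge0// sume_ge0// => k _; exact: sup0_ge0.
  case: (Calpha_norm 3 (atan_test i x 0 : _ -> R^o)) n0 => [n| |] //.
  rewrite -!EFinM !lee_fin => n0 nN Hx; apply: le_trans Hx _.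
  rewrite ler_wpM2r// /C1; apply: le_trans (_ : `|C| * n <= _).
    by rewrite ler_wpM2r// ler_norm.
  by rewrite ler_wpM2l.
have A2 : `|davie_incr D s t x 0 i| <= K * y by have [_ h _ _ _] := HG i.
set u := psi t s x 0 i - x 0 i.
have A1' : `|atan u - davie_incr D s t x 0 i| <= C1 * y ^+ 3 by exact: A1.
have A3 : `|atan u| <= (K + C1) * y.
  rewrite -(subrK (davie_incr D s t x 0 i) (atan u)).
  apply: le_trans (ler_normD _ _) _; apply: le_trans (lerD A1' A2) _.
  rewrite mulrDl addrC lerD2l ler_wpM2l//.
  by rewrite exprS ler_piMr// exprn_ile1.
have A4 := atan_small (le_trans A3 Hs).
have -> : (psi t s x - davie D s t x) 0 i = (u - atan u) + (atan u - davie_incr D s t x 0 i).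
  by rewrite /u /davie !mxE; ring.
apply: le_trans (ler_normD _ _) _; apply: le_trans (lerD A4 A1') _.
rewrite (_ : (_ + C1) * _ = 4 * ((K + C1) * y) ^+ 3 + C1 * y ^+ 3); last by ring.
by rewrite lerD2r ler_wpM2l// lerXn2r// nnegrE// mulr_ge0// addr_ge0.
Qed.

Lemma solution_flow_unique psi s t x : solution_flow a b p D psi ->
  a <= s -> s <= t -> t <= b -> psi t s x = flow (davie D) s t x.
Proof.
move=> [[psi_id psi_comp] psi_s] as_ st tb.
have [d [C [d0 C0 H]]] := solves_near psi_s.
have [K K0 AF] := davie_almost_flow hp hrho wg.
have p0 : 0 < p by case/andP: hp => h _; apply: lt_le_trans h.
have /andP[r0 r1] := rho01 hp hrho.
have q0 : 0 < p^-1 by rewrite invr_gt0.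
rewrite (@flow_unique _ _ a b p^-1 (3 / p) rho K (davie D) q0 r0 r1 (exponent_gt1 hp hrho)
   K0 AF d C (fun v => psi v s x) s t d0 C0 as_ st tb); last first.
  move=> u v su uv vt vu; rewrite -(psi_comp s u v as_ su uv (le_trans vt tb)) /=.
  by apply: H => //; [exact: le_trans su|exact: le_trans tb].
by rewrite psi_id// as_ (le_trans st).
Qed.

End Uniqueness.

(** * Joint measurability *)

Section BorelLimit.
Context {R : realType} {m : nat} {d : measure_display} {T : measurableType d}.

Lemma open_measurable_rV (U : set 'rV[R]_m) : open U -> measurable (U : set (borel_rV R m)).
Proof. by move=> oU; exact: sub_sigma_algebra. Qed.

(** A limit lies in an open set exactly when the sequence eventually stays at a
    fixed positive distance from its complement. *)
Lemma measurable_lim_rV (f_ : nat -> T -> borel_rV R m) (f : T -> borel_rV R m) :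
  (forall n, measurable_fun [set: T] (f_ n)) ->
  (forall z, (f_ n z : 'rV[R]_m) @[n --> \oo] --> (f z : 'rV[R]_m)) ->
  measurable_fun [set: T] f.
Proof.
move=> mf fc; apply: (@measurability _ _ _ (borel_rV R m) _ f (@open 'rV[R]_m)) => // _ [U oU <-]; rewrite setTI.
pose r (k : nat) : R := k.+1%:R^-1.
have r0 k : 0 < r k by rewrite invr_gt0 ltr0n.
pose Fk k : set 'rV[R]_m := ~` \bigcup_(y in ~` U) ball y (r k).
have mF k : measurable (Fk k : set (borel_rV R m)).
  apply: measurableC; apply: open_measurable_rV; apply: bigcup_open => y _.
  exact: ball_open.
have -> : f @^-1` U = \bigcup_k \bigcup_N \bigcap_(n in [set n | (N <= n)%N]) f_ n @^-1` (Fk k).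
  apply/seteqP; split => z.
  - move=> Uz; have : nbhs (f z : 'rV[R]_m) U by apply: open_nbhs_nbhs.
    move=> /nbhs_ballP[e /= e0 eU].
    have [k ke] : exists k, r k < e / 2.
      have e20 : 0 < e / 2 by rewrite divr_gt0.
      have [k] := @ltr_add_invr R 0 (e / 2) e20; rewrite add0r => ke.
      by exists k.
    have /cvgrPdist_lt/(_ _ (r0 k))[N _ HN] := fc z.
    exists k => //; exists N => // n /= Nn [y /= nUy].
    rewrite mx_norm_ball /ball_ /= => yn; apply: nUy; apply: eU.
    rewrite mx_norm_ball /ball_ /= -(subrKA (f_ n z : 'rV[R]_m)).
    apply: le_lt_trans (ler_normD _ _) _.
    have := HN n Nn; rewrite /= distrC in yn *; lra.
  - move=> [k _ [N _ H]].
    have /cvgrPdist_lt/(_ _ (r0 k))[M _ HM] := fc z.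
    have Fn := H (maxn N M) (leq_maxl _ _).
    apply: contrapT => nU; apply: Fn; exists (f z) => //.
    by rewrite mx_norm_ball /ball_ /=; apply: HM; exact: leq_maxr.
apply: bigcup_measurable => k _; apply: bigcup_measurable => N _.
apply: bigcap_measurable => [|n _]; first by exists N => /=.
rewrite -[X in measurable X]setTI; exact: mf.
Qed.
End BorelLimit.

Section Caratheodory.
Context {R : realType} {m : nat} {d : measure_display} {Omega : measurableType d}.

(** Rounding to a grid takes countably many values, each of them on a Borel set. *)
Definition round_down (n : nat) (u : R) : R := (Num.floor (n.+1%:R * u))%:~R / n.+1%:R.

Lemma round_down_close n u : `|u - round_down n u| <= n.+1%:R^-1.
Proof.
have N0 : 0 < n.+1%:R :> R by rewrite ltr0n.
have /andP[h1 h2] := floor_itv (n.+1%:R * u).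
have E : u - round_down n u = (n.+1%:R * u - (Num.floor (n.+1%:R * u))%:~R) / n.+1%:R.
  by rewrite /round_down mulrBl mulrAC divff ?gt_eqF// mul1r.
rewrite E normrM (gtr0_norm (_ : 0 < n.+1%:R^-1)) ?invr_gt0//.
rewrite ler_piMl ?invr_ge0// ger0_norm ?subr_ge0//.
by move: h2; rewrite intrD; lra.
Qed.

Definition round_down_rV (n : nat) (x : 'rV[R]_m) : 'rV[R]_m := \row_i round_down n (x 0 i).

Lemma round_down_cvg u : round_down n u @[n --> \oo] --> u.
Proof.
apply/cvgrPdist_le => e e0; have := @near_infty_natSinv_lt R (PosNum e0).
apply: filterS => n /= ne; apply: le_trans (round_down_close n u) (ltW ne).
Qed.

Lemma round_down_rV_cvg x : round_down_rV n x @[n --> \oo] --> x.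
Proof.
apply/cvgrPdist_le => e e0; have := @near_infty_natSinv_lt R (PosNum e0).
apply: filterS => n /= ne; apply: rV_norm_le => [|i]; first exact: ltW.
by rewrite !mxE; apply: le_trans (round_down_close n _) (ltW ne).
Qed.

Lemma measurable_floor_slab n (k : int) :
  measurable ([set u | Num.floor (n.+1%:R * u) = k] : set (measurableTypeR R)).
Proof.
have N0 : 0 < n.+1%:R :> R by rewrite ltr0n.
rewrite [X in measurable X](_ : _ = `[k%:~R / n.+1%:R, (k + 1)%:~R / n.+1%:R[%classic); last first.
  apply/seteqP; split => u /=.
    move=> <-; have := floor_itv (n.+1%:R * u).
    by rewrite in_itv /= ler_pdivrMr// ltr_pdivlMr// ![u * _]mulrC.
  rewrite in_itv /= ler_pdivrMr// ltr_pdivlMr// ![u * _]mulrC => ku.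
  exact: floor_def.
exact: measurable_itv.
Qed.

Lemma measurable_floor_box n (K : 'rV[int]_m) :
  measurable ([set x | forall i, Num.floor (n.+1%:R * x 0 i) = K 0 i] : set (borel_rV R m)).
Proof.
rewrite [X in measurable X](_ : _ = \bigcap_(i in [set: 'I_m])
   [set x : 'rV[R]_m | Num.floor (n.+1%:R * x 0 i) = K 0 i]); last first.
  by apply/seteqP; split => x /= H i; [move=> _|]; exact: H.
apply: fin_bigcap_measurable => // i _.
have mc (c : R) : measurable ([set x : 'rV[R]_m | x 0 i < c] : set (borel_rV R m)).
  apply: open_measurable_rV.
  rewrite [X in open X](_ : _ = (fun x : 'rV[R]_m => x 0 i) @^-1` [set u | u < c])//.
  apply: open_comp; last exact: open_lt.
  by move=> x _; exact: coord_continuous.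
have N0 : 0 < n.+1%:R :> R by rewrite ltr0n.
rewrite [X in measurable X](_ : _ = ~` [set x : 'rV[R]_m | x 0 i < (K 0 i)%:~R / n.+1%:R]
     `&` [set x : 'rV[R]_m | x 0 i < (K 0 i + 1)%:~R / n.+1%:R]).
  by apply: measurableI => //; exact: measurableC.
apply/seteqP; split => x /=.
  move=> <-; have /andP[h1 h2] := floor_itv (n.+1%:R * x 0 i); split.
    by apply/negP; rewrite -leNgt ler_pdivrMr// [x 0 i * _]mulrC.
  by rewrite ltr_pdivlMr// [x 0 i * _]mulrC.
move=> [/negP]; rewrite -leNgt ler_pdivrMr// ltr_pdivlMr// ![x 0 i * _]mulrC => h1 h2.
by apply: floor_def; rewrite h1.
Qed.

(** Rounding the time and space arguments leaves a function with countably many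
    time-space values, measurable because each section is; continuity in these
    arguments gives convergence. *)
Lemma caratheodory (f : R -> Omega -> 'rV[R]_m -> 'rV[R]_m) :
  (forall t x, measurable_fun [set: Omega] (fun w => f t w x : borel_rV R m)) ->
  (forall w, continuous (fun z : R * 'rV[R]_m => f z.1 w z.2)) ->
  measurable_fun [set: measurableTypeR R * Omega * borel_rV R m]
    (fun z : measurableTypeR R * Omega * borel_rV R m =>
       f z.1.1 z.1.2 z.2 : borel_rV R m).
Proof.
move=> mf cf.
apply: (@measurable_lim_rV R m _ (measurableTypeR R * Omega * borel_rV R m)%type
  (fun n z => f (round_down n z.1.1) z.1.2 (round_down_rV n z.2) : borel_rV R m)); last first.
  move=> [[t w] x] /=.
  have C : ((round_down n t, round_down_rV n x) : R * 'rV[R]_m) @[n --> \oo] --> ((t, x) : R * 'rV[R]_m).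
    exact: (@cvg_pair nat R 'rV[R]_m \oo (nbhs t) (nbhs x) _ _ _ (round_down^~ t) (round_down_rV^~ x)
      (@round_down_cvg t) (@round_down_rV_cvg x)).
  exact: (cvg_comp _ _ C (cf w (t, x))).
move=> n _ B mB; rewrite setTI.
rewrite (_ : _ @^-1` B = \bigcup_(kK : int * 'rV[int]_m)
  (([set u : R | Num.floor (n.+1%:R * u) = kK.1] `*`
    [set w | B (f (kK.1%:~R / n.+1%:R) w (\row_i ((kK.2 0 i)%:~R / n.+1%:R)))]) `*`
   [set x : 'rV[R]_m | forall i, Num.floor (n.+1%:R * x 0 i) = kK.2 0 i])); last first.
  apply/seteqP; split => -[[t w] x] /=.
    move=> Bf; exists (Num.floor (n.+1%:R * t), \row_i Num.floor (n.+1%:R * x 0 i)) => //=.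
    split; last by move=> i; rewrite mxE.
    split => //.
    rewrite (_ : \row_i _ = round_down_rV n x)//; apply/rowP => i; by rewrite !mxE.
  move=> [[k K] _ /= [[tk Bf] xK]].
  rewrite /round_down tk (_ : round_down_rV n x = \row_i ((K 0 i)%:~R / n.+1%:R))//.
  by apply/rowP => i; rewrite !mxE /round_down xK.
apply: countable_bigcupT_measurable => [|[k K]]; first exact: countableP.
apply: measurableX; last exact: measurable_floor_box.
apply: measurableX; first exact: measurable_floor_slab.
have := mf (k%:~R / n.+1%:R) (\row_i ((K 0 i)%:~R / n.+1%:R)) measurableT B mB.
by rewrite setTI.
Qed.
End Caratheodory.

(** * Continuity of the scheme in the driver *)

Section DriverTopology.
Context {R : realType} {m : nat}.
Variables (p rho : R).
Hypotheses (hp : 2 <= p < 3) (hrho : p / 3 < rho <= 1).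
Implicit Types (D : driver R m) (s t : R) (x y : 'rV[R]_m).

Lemma driver_dist_on_ge0 a b D D' : (0 <= driver_dist_on a b p rho D D')%E.
Proof. exact: sup0_ge0. Qed.

Lemma geometric_weak k D : geometric_drivers p rho D -> weak_geometric (- k%:R) k%:R p rho D.
Proof.
move=> gD; have [||//] := gD (- k%:R) k%:R.
  by rewrite oppr_le0.
by [].
Qed.

(** The summand of index [k] is at most the whole sum; the truncation at 1 is
    harmless because [c <= 1]. *)
Lemma driver_dist_on_lt (k : nat) (c : R) : (0 < k)%N -> 0 < c <= 1 ->
  exists2 e : R, 0 < e & forall D D', (driver_dist p rho D D' < e%:E)%E ->
    (driver_dist_on (- k%:R) k%:R p rho D D' < c%:E)%E.
Proof.
move=> k0 /andP[c0 c1]; exists (2^-1 ^+ k * c); first by rewrite mulr_gt0// exprn_gt0// invr_gt0.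
move=> D D' H.
have term j : (0 <= (2^-1 ^+ j)%:E * mine (driver_dist_on (- j%:R) j%:R p rho D D') 1%:E)%E.
  apply: mule_ge0; first by rewrite lee_fin exprn_ge0// invr_ge0.
  by rewrite le_min driver_dist_on_ge0 lee_fin ler01.
have Hk : ((2^-1 ^+ k)%:E * mine (driver_dist_on (- k%:R) k%:R p rho D D') 1%:E
    <= driver_dist p rho D D')%E.
  rewrite /driver_dist.
  apply: le_trans (@nneseries_lim_ge R _ xpredT 1%N k.+1 (fun j _ _ => term j)).
  rewrite big_nat_recr//= leeDr// sume_ge0// => j _; exact: term.
have {H} := le_lt_trans Hk H.
rewrite EFinM lte_pmul2l ?lte_fin ?exprn_gt0 ?invr_gt0//.
rewrite /mine; case: ifPn => // _; rewrite lte_fin => c1'.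
by move: c1; rewrite leNgt c1'.
Qed.

Lemma dist_on_bounds a b (c : R) D D' s t : 0 <= c -> a <= s -> s < t -> t <= b ->
  (driver_dist_on a b p rho D D' < c%:E)%E ->
  (Calpha_norm (2 + rho) (fun x => (inc D s t x - inc D' s t x)%R) <= (c * (t - s) `^ p^-1)%:E)%E /\
  (Calpha_norm (1 + rho) (fun x => (Wfield D s t x - Wfield D' s t x)%R)
     <= (c ^+ 2 * (t - s) `^ (2 / p))%:E)%E.
Proof.
move=> c0 as_ st tb H.
have ts : 0 < t - s by rewrite subr_gt0.
have w1 : 0 < (t - s) `^ p^-1 by rewrite powR_gt0.
have w2 : 0 < (t - s) `^ (2 / p) by rewrite powR_gt0.
have [] : (Calpha_norm (2 + rho) (fun x => (inc D s t x - inc D' s t x)%R)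
          * ((`|t - s| `^ p^-1)^-1)%:E < c%:E)%E /\
       (poweR (Calpha_norm (1 + rho) (fun x => (Wfield D s t x - Wfield D' s t x)%R)
            * ((`|t - s| `^ (2 / p))^-1)%:E) 2^-1 < c%:E)%E.
  apply/andP; rewrite -gt_max; apply: le_lt_trans H.
  by apply: sup0_ub; exists s, t.
rewrite (gtr0_norm ts) => /ltW h1 /ltW h2; split.
  by move: h1; rewrite lee_pdivrMr.
suff : (Calpha_norm (1 + rho) (fun x => (Wfield D s t x - Wfield D' s t x)%R)
            * (((t - s) `^ (2 / p))^-1)%:E <= (c ^+ 2)%:E)%E by rewrite lee_pdivrMr.
move: h2; set X := (_ * _)%E.
have X0 : (0 <= X)%E.
  rewrite mule_ge0 ?lee_fin ?invr_ge0 ?powR_ge0//.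
  by rewrite /Calpha_norm adde_ge0 ?sup0_ge0// sume_ge0// => i _; exact: sup0_ge0.
case: X X0 => [r| |] //=; last by rewrite /poweR /= invr_eq0 pnatr_eq0.
rewrite !lee_fin => r0; rewrite powR12_sqrt// => h.
rewrite -(sqr_sqrtr r0); by rewrite lerXn2r ?nnegrE ?sqrtr_ge0.
Qed.

Lemma pdB j (f g : 'rV[R]_m -> R) x : smooth f -> smooth g ->
  pd j (fun y => f y - g y) x = pd j f x - pd j g x.
Proof.
move=> sf sg; rewrite /pd (@deriveB R _ _ (f : _ -> R^o) g) //; exact/diff_derivable.
Qed.

Lemma truncn_ge (n : nat) (z : R) : n%:R <= z -> (n <= Num.truncn z)%N.
Proof. by move=> nz; rewrite -(@natrK R n); apply: le_truncn. Qed.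

(** A step depends on the driver through [V], its first derivatives and [W] only,
    all controlled by the distance. *)
Lemma davie_cont k D s t eps : (0 < k)%N -> geometric_drivers p rho D ->
  - k%:R <= s -> s <= t -> t <= k%:R -> t - s <= 1 -> 0 < eps ->
  exists2 e : R, 0 < e & forall D', geometric_drivers p rho D' ->
    (driver_dist p rho D D' < e%:E)%E ->
    forall x, `|davie D' s t x - davie D s t x| <= eps.
Proof.
move=> k0 gD ks st tk ts1 eps0.
have wD := geometric_weak k gD.
have [stE|st'] := eqVneq s t.
  exists 1 => // D' gD' _ x; rewrite -stE.
  have sk : s <= k%:R by exact: le_trans tk.
  rewrite (davie_same wD)// (davie_same (geometric_weak k gD'))//.
  by rewrite subrr normr0 ltW.
have {}st' : s < t by rewrite lt_neqAle st'.
have [K K0 HK] := driver_classes hp hrho wD.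
have [HV HdV _ _ _] := HK s t ks st tk ts1.
move: HV HdV; set M := K * _ => HV HdV.
have M0 : 0 <= M by rewrite mulr_ge0// powR_ge0.
have Z0 : 0 < 2 + m%:R * (M + 1).
  by have : 0 <= m%:R * (M + 1) by [rewrite mulr_ge0// addr_ge0]; lra.
pose c : R := Num.min 1 (eps / (2 + m%:R * (M + 1))).
have c01 : 0 < c <= 1 by rewrite lt_min ltr01 divr_gt0//= ge_min lexx.
have ce : c * (2 + m%:R * (M + 1)) <= eps.
  by rewrite -ler_pdivlMr// /c ge_min lexx orbT.
have [e e0 He] := driver_dist_on_lt k0 c01.
have /andP[c0 c1] := c01.
exists e => // D' gD' /He dist x.
have wD' := geometric_weak k gD'.
have [B1 B2] := dist_on_bounds (ltW c0) ks st' tk dist.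
have ts0 : 0 <= t - s by rewrite subr_ge0.
have p0 : 0 < p by case/andP: hp => h _; apply: lt_le_trans h.
have w1 (q : R) : 0 <= q -> (t - s) `^ q <= 1 by exact: powR_le1.
have q1 : 0 <= p^-1 by rewrite invr_ge0 ltW.
have q2 : 0 <= 2 / p by rewrite divr_ge0// ltW.
have N1 : (Calpha_norm (2 + rho) (fun x => (inc D s t x - inc D' s t x)%R) <= c%:E)%E.
  by apply: le_trans B1 _; rewrite lee_fin ler_piMr ?w1// ltW.
have N2 : (Calpha_norm (1 + rho) (fun x => (Wfield D s t x - Wfield D' s t x)%R) <= c%:E)%E.
  apply: le_trans B2 _; rewrite lee_fin; apply: le_trans (_ : c ^+ 2 <= _).
    by rewrite ler_piMr ?w1// exprn_ge0// ltW.
  by rewrite expr2 ler_piMr// ltW.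
have /andP[rh0 rh1] := rho01 hp hrho.
have [_ [CV _] _ _] := wD; have [_ [CV' _] _ _] := wD'.
have n2 : (2 <= Num.truncn (2 + rho))%N by apply: truncn_ge; lra.
have dV z : differentiable (inc D s t) z.
  by have [h _] := CV s t ks st tk; apply: (h [::]); exact: leq_trans n2.
have dV' z : differentiable (inc D' s t) z.
  by have [h _] := CV' s t ks st tk; apply: (h [::]); exact: leq_trans n2.
have dB z : differentiable (fun x => inc D s t x - inc D' s t x) z.
  by apply: (@differentiableB _ _ _ (inc D s t) (inc D' s t)).
have V0 i : `|inc D s t x 0 i - inc D' s t x 0 i| <= c.
  have h := Calpha_pder_le (l := [::]) N1 x (leq0n _).
  apply: le_trans h; rewrite /=.
  rewrite (_ : _ 0 i - _ = (inc D s t x - inc D' s t x) 0 i); last by rewrite !mxE.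
  exact: rV_coord_le.
have W0 i : `|Wfield D s t x 0 i - Wfield D' s t x 0 i| <= c.
  have h := Calpha_pder_le (l := [::]) N2 x (leq0n _).
  apply: le_trans h; rewrite /=.
  rewrite (_ : _ 0 i - _ = (Wfield D s t x - Wfield D' s t x) 0 i); last by rewrite !mxE.
  exact: rV_coord_le.
have V1 i j : `|pd j (fun z => inc D s t z 0 i) x - pd j (fun z => inc D' s t z 0 i) x| <= c.
  rewrite -pdB; last 2 first.
  - by move=> z; exact: differentiable_coord_fun.
  - by move=> z; exact: differentiable_coord_fun.
  have nd : ndifferentiable 1 (fun x => inc D s t x - inc D' s t x) by case.
  have fE : (fun z => (inc D s t z - inc D' s t z) 0 i) = (fun z => inc D s t z 0 i - inc D' s t z 0 i).
    by apply/funext => z; rewrite mxE [X in _ + X]mxE.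
  have := pder_coord (l := [:: j]) i nd (leqnn _); rewrite fE => E.
  have {}E : pder [:: j] (fun x => inc D s t x - inc D' s t x) x 0 i
     = pd j (fun z => inc D s t z 0 i - inc D' s t z 0 i) x by exact: (congr1 (fun F => F x) E).
  rewrite -E; apply: le_trans (rV_coord_le _ _) _.
  by apply: (Calpha_pder_le N1); exact: leq_trans n2.
apply: rV_norm_le => [|i]; first exact: ltW.
rewrite /davie; set A := inc D s t in V0 V1 HV HdV *; set A' := inc D' s t in V0 V1 *.
pose S := \sum_j (A' x 0 j * pd j (fun z => A' z 0 i) x - A x 0 j * pd j (fun z => A z 0 i) x).
rewrite (_ : _ 0 i = (A' x 0 i - A x 0 i) + (Wfield D' s t x 0 i - Wfield D s t x 0 i) + 2^-1 * S); last first.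
  have -> : S = grad (fun z => A' z 0 i) x (A' x) - grad (fun z => A z 0 i) x (A x).
    by rewrite /S sumrB.
  set w' := Wfield D' s t x 0 i; set w := Wfield D s t x 0 i.
  by rewrite !mxE !inc2_coord -/A -/A' -/w -/w'; ring.
have Sb : `|S| <= m%:R * (c * (M + 1) + M * c).
  apply: sum_const_le => j.
  have [_ bA _ _ _] := HV j; have [_ bdA _ _ _] := HdV i j.
  set v' := A' x 0 j; set v := A x 0 j; set w' := pd j _ x; set w := pd j _ x.
  rewrite (_ : _ - _ = (v' - v) * w' + v * (w' - w)); last by ring.
  apply: le_trans (ler_normD _ _) _; rewrite !normrM.
  have hw : `|w' - w| <= c by rewrite distrC; exact: V1.
  have hv : `|v' - v| <= c by rewrite distrC; exact: V0.
  have w'b : `|w'| <= M + 1.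
    rewrite -(subrK w w'); apply: le_trans (ler_normD _ _) _.
    by have : `|w| <= M by [exact: bdA]; lra.
  by apply: lerD; apply: ler_pM => //; exact: bA.
have h1 : `|A' x 0 i - A x 0 i| <= c by rewrite distrC.
have h2 : `|Wfield D' s t x 0 i - Wfield D s t x 0 i| <= c by rewrite distrC.
apply: le_trans ce.
apply: le_trans (ler_normD _ _) _; apply: le_trans (lerD (ler_normD _ _) (lexx _)) _.
rewrite normrM (ger0_norm (_ : 0 <= 2^-1)) ?invr_ge0//.
apply: le_trans (lerD (lerD h1 h2) (ler_wpM2l _ Sb)) _; first by rewrite invr_ge0.
have mc : 0 <= m%:R * c by rewrite mulr_ge0// ltW.
have mcM : 0 <= m%:R * c * M by rewrite mulr_ge0.
lra.
Qed.

(** The initial point is allowed to move for the sake of the induction on the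
    partition. *)
Lemma compose_davie_cont k D l s x eps : (0 < k)%N -> geometric_drivers p rho D ->
  - k%:R <= s -> path (step 1) s l -> last s l <= k%:R -> 0 < eps ->
  exists e eta : R, [/\ 0 < e, 0 < eta & forall D', geometric_drivers p rho D' ->
    (driver_dist p rho D D' < e%:E)%E -> forall x', `|x' - x| <= eta ->
    `|compose (davie D') s l x' - compose (davie D) s l x| <= eps].
Proof.
move=> k0 gD; elim: l s x eps => [|u l IH] s x eps ks /=.
  by move=> _ _ eps0; exists 1, eps.
move=> /andP[/andP[su us1] pl] lk eps0.
have ku : - k%:R <= u by exact: le_trans su.
have uk : u <= k%:R by apply: le_trans lk; exact: path_le_last (step_path_le pl).
have [e1 [eta1 [e10 eta10 H1]]] := IH u (davie D s u x) eps ku pl lk eps0.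
have eta20 : 0 < eta1 / 2 by rewrite divr_gt0.
have [e2 e20 H2] := davie_cont k0 gD ks su uk us1 eta20.
have [K K0 AF] := davie_almost_flow hp hrho (geometric_weak k gD).
pose L := 1 + K * (u - s) `^ p^-1.
have L0 : 0 < L by rewrite /L; have : 0 <= K * (u - s) `^ p^-1 by [rewrite mulr_ge0// powR_ge0]; lra.
exists (Num.min e1 e2), (eta1 / 2 / L); split.
- by rewrite lt_min e10.
- by rewrite divr_gt0.
move=> D' gD' dist x' xx; apply: H1 => //.
  by apply: lt_le_trans dist _; rewrite lee_fin ge_min lexx.
have h1 : `|davie D' s u x' - davie D s u x'| <= eta1 / 2.
  by apply: H2 => //; apply: lt_le_trans dist _; rewrite lee_fin ge_min lexx orbT.
have h2 : `|davie D s u x' - davie D s u x| <= eta1 / 2.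
  apply: le_trans (af_lip AF x' x ks su uk us1) _.
  by rewrite -/L mulrC -ler_pdivlMr.
rewrite -(subrKA (davie D s u x')).
apply: le_trans (ler_normD _ _) _; lra.
Qed.

(** Since solutions are pointwise limits of schemes, their measurability is
    reduced to this continuity in the driver. *)
Lemma compose_davie_open l s x (O : set 'rV[R]_m) : path (step 1) s l -> open O ->
  driver_open p rho [set D | geometric_drivers p rho D /\ O (compose (davie D) s l x)].
Proof.
move=> pl oO; split=> [D []//|D [gD OD]].
have : nbhs (compose (davie D) s l x) O by apply: open_nbhs_nbhs.
move=> /nbhs_ballP[e /= e0 eO].
have e20 : 0 < e / 2 by rewrite divr_gt0.
pose k := (Num.truncn (`|s| + `|last s l|)).+1.
have Bk : `|s| + `|last s l| < k%:R by exact: truncnS_gt.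
have ks : - k%:R <= s by have := ler_normlW (lexx `|- s|); rewrite normrN; have := normr_ge0 (last s l); lra.
have kl : last s l <= k%:R by have := ler_norm (last s l); have := normr_ge0 s; lra.
have [e1 [eta [e10 eta0 H]]] := compose_davie_cont x (isT : (0 < k)%N) gD ks pl kl e20.
exists e1 => // D' gD' dist; split => //; apply: eO.
rewrite mx_norm_ball /ball_ /= distrC.
apply: le_lt_trans (H D' gD' dist x _) _; first by rewrite subrr normr0 ltW.
lra.
Qed.

End DriverTopology.

(** * The random dynamical system *)

Section Shift.
Context {R : realType} {m : nat}.
Local Notation E := 'rV[R]_m.

Lemma compose_shift (mu mu' : R -> R -> E -> E) s u l x :
  (forall u v, u <= v -> mu u v = mu' (s + u) (s + v)) -> path <=%R u l ->
  compose mu u l x = compose mu' (s + u) [seq s + v | v <- l] x.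
Proof.
move=> H; elim: l u x => //= v l IH u x /andP[uv vl].
by rewrite IH// H.
Qed.

Lemma uniform_part_shift (s t : R) n : uniform_part s t n = [seq s + v | v <- uniform_part 0 (t - s) n].
Proof. by rewrite /uniform_part -map_comp; apply: eq_map => k /=; rewrite add0r subr0. Qed.

(** Uniform partitions are compatible with translation of time, so the two limits
    are taken along equal sequences. *)
Lemma flow_shift (mu mu' : R -> R -> E -> E) s t x :
  (forall u v, u <= v -> mu u v = mu' (s + u) (s + v)) -> s <= t ->
  flow mu 0 (t - s) x = flow mu' s t x.
Proof.
move=> H st; rewrite /flow; congr (lim (_ @ \oo)); apply/funext => n.
rewrite (uniform_part_shift s t) (compose_shift x H); first by rewrite addr0.
have ts0 : 0 <= t - s by rewrite subr_ge0.
exact: step_path_le (uniform_part_path n ts0).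
Qed.
End Shift.

Lemma max0_lip (R : realDomainType) (a b : R) :
  `|Num.max 0 a - Num.max 0 b| <= `|a - b|.
Proof.
have k1 := ler_norm (a - b); have k2 := ler_norm (b - a); rewrite distrC in k2.
rewrite /Num.max; case: ltP => h1; case: ltP => h2; rewrite ?subrr ?normr0//;
  rewrite ler_norml; apply/andP; split; lra.
Qed.

Section SolutionFlow.
Context {R : realType} {m : nat}.
Variables (p rho : R).
Hypotheses (hp : 2 <= p < 3) (hrho : p / 3 < rho <= 1).
Implicit Types (D : driver R m).

Let p0 : 0 < p. Proof. by case/andP: hp => h _; apply: lt_le_trans h. Qed.

Lemma flow_davie_near_id a b D eps : weak_geometric a b p rho D -> 0 < eps ->
  exists2 d : R, 0 < d & forall s t x, a <= s -> s <= t -> t <= b -> t - s <= d ->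
    `|flow (davie D) s t x - x| <= eps.
Proof.
move=> wg eps0.
have [d [C [d0 d1 C0 H]]] := davie_flow_near hp hrho wg.
have [K K0 AF] := davie_almost_flow hp hrho wg.
have e20 : 0 < eps / 2 by rewrite divr_gt0.
have q0 : 0 < p^-1 by rewrite invr_gt0.
have al0 : 0 < 3 / p by rewrite divr_gt0.
have [c1 /andP[c10 _] H1] := small_powR C0 al0 e20.
have [c2 /andP[c20 _] H2] := small_powR K0 q0 e20.
exists (Num.min d (Num.min c1 c2)); first by rewrite !lt_min d0 c10 c20.
move=> s t x as_ st tb; rewrite !le_min => /and3P[td tc1 tc2].
have ts0 : 0 <= t - s by rewrite subr_ge0.
rewrite -(subrKA (davie D s t x)); apply: le_trans (ler_normD _ _) _.
have h1 := H s t x as_ st tb td.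
have h2 := af_near AF x as_ st tb (le_trans td d1).
have := H1 (t - s); rewrite ts0 tc1 => /(_ isT) h3.
have := H2 (t - s); rewrite ts0 tc2 => /(_ isT) h4.
lra.
Qed.

Lemma davie_flow_facts a b D : weak_geometric a b p rho D ->
  [/\ forall s x, a <= s -> s <= b -> flow (davie D) s s x = x,
      forall s u t x, a <= s -> s <= u -> u <= t -> t <= b ->
        flow (davie D) u t (flow (davie D) s u x) = flow (davie D) s t x,
      exists2 L, 0 <= L & forall s t x y, a <= s -> s <= t -> t <= b ->
        `|flow (davie D) s t x - flow (davie D) s t y| <= L * `|x - y|
    & forall s t x, a <= s -> s <= t -> t <= b ->
        compose (davie D) s (uniform_part s t n) x @[n --> \oo] --> flow (davie D) s t x].
Proof.
move=> wg; have [K K0 AF] := davie_almost_flow hp hrho wg.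
have /andP[r0 r1] := rho01 hp hrho.
have q0 : 0 < p^-1 by rewrite invr_gt0.
have be1 := exponent_gt1 hp hrho.
split.
- exact: (flow_id q0 r0 r1 be1 K0 AF).
- exact: (flow_comp q0 r0 r1 be1 K0 AF).
- exact: (flow_lip q0 r0 r1 be1 K0 AF).
- by move=> s t x; exact: (flow_cvg q0 r0 r1 be1 K0 AF).
Qed.

(** Freezing the solution for negative times makes it continuous on the whole
    line, as the joint measurability argument wants. *)
Definition flow_from0 D (t : R) (x : 'rV[R]_m) : 'rV[R]_m := flow (davie D) 0 (Num.max 0 t) x.

Lemma geometric_weak0 T D : 0 <= T -> geometric_drivers p rho D -> weak_geometric 0 T p rho D.
Proof. by move=> T0 gD; have [] := gD 0 T (lexx _) T0. Qed.

Lemma solution_continuous D : geometric_drivers p rho D ->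
  continuous (fun z : R * 'rV[R]_m => flow_from0 D z.1 z.2).
Proof.
move=> gD [t0 x0]; apply/cvgrPdist_le => eps eps0.
pose T := `|t0| + 1.
have T0 : 0 <= T by rewrite addr_ge0.
have wg := geometric_weak0 T0 gD.
have [_ fc [L L0 lip] _] := davie_flow_facts wg.
have e20 : 0 < eps / 2 by rewrite divr_gt0.
have [d d0 H] := flow_davie_near_id wg e20.
have L10 : 0 < eps / 2 / (L + 1) by rewrite divr_gt0//; lra.
have dd0 : 0 < Num.min d 1 by rewrite lt_min d0 ltr01.
have C1 : z.1 @[z --> ((t0, x0) : R * 'rV[R]_m)] --> t0 by exact: cvg_fst.
have C2 : z.2 @[z --> ((t0, x0) : R * 'rV[R]_m)] --> x0 by exact: cvg_snd.
move/cvgrPdist_le/(_ _ dd0) : C1 => C1; move/cvgrPdist_le/(_ _ L10) : C2 => C2.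
near=> z.
have z1 : `|t0 - z.1| <= Num.min d 1 by near: z.
have z2 : `|x0 - z.2| <= eps / 2 / (L + 1) by near: z.
move: z1; rewrite le_min => /andP[z1d z11].
set t := z.1 in z1d z11 *; set x := z.2 in z2 *.
rewrite /flow_from0 /=.
set u := Num.max 0 t0; set v := Num.max 0 t.
have uv : `|u - v| <= `|t0 - t| by exact: max0_lip.
have u0 : 0 <= u by rewrite le_max lexx.
have v0 : 0 <= v by rewrite le_max lexx.
have uT : u <= T by rewrite ge_max T0 /T; have := ler_norm t0; lra.
have vT : v <= T.
  rewrite ge_max T0 /=; rewrite distrC in z11; have := ler_norm (t - t0); have := ler_norm t0.
  by rewrite /T; lra.
have time : `|flow (davie D) 0 u x0 - flow (davie D) 0 v x0| <= eps / 2.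
  have [uv'|vu'] := leP u v.
    rewrite distrC -(fc 0 u v x0)//; apply: H => //.
    by apply: le_trans z1d; apply: le_trans uv; rewrite distrC ler_norm.
  rewrite -(fc 0 v u x0)//; last exact: ltW.
  apply: H => //; first exact: ltW.
  by apply: le_trans z1d; apply: le_trans uv; exact: ler_norm.
have space : `|flow (davie D) 0 v x0 - flow (davie D) 0 v x| <= eps / 2.
  apply: le_trans (lip 0 v x0 x (lexx _) v0 vT) _.
  apply: le_trans (ler_wpM2l L0 z2) _.
  have LL : L / (L + 1) <= 1 by rewrite ler_pdivrMr ?mul1r ?lerDl// ltr_wpDl.
  by rewrite mulrCA ler_piMr// ltW.
rewrite -(subrKA (flow (davie D) 0 v x0)).
by apply: le_trans (ler_normD _ _) _; rewrite (splitr eps) lerD.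
Unshelve. all: by end_near. Qed.

Lemma measurable_solution d (Omega : measurableType d) (V : Omega -> driver R m) t x :
  (forall w, geometric_drivers p rho (V w)) ->
  (forall B, driver_borel p rho B -> measurable (V @^-1` B)) ->
  measurable_fun [set: Omega] (fun w => flow_from0 (V w) t x : borel_rV R m).
Proof.
move=> gV mV; rewrite /flow_from0; set T := Num.max 0 t.
have T0 : 0 <= T by rewrite le_max lexx.
(* The first [N] partitions are skipped so that all steps have length at most 1. *)
pose N := Num.truncn T.
apply: (@measurable_lim_rV R m _ Omega
  (fun n w => compose (davie (V w)) 0 (uniform_part 0 T (n + N)) x : borel_rV R m)).
  move=> n; set f := (X in measurable_fun _ X).
  apply: (@measurability _ _ _ (borel_rV R m) _ f (@open 'rV[R]_m)) => // _ [U oU <-].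
  have P : path (step 1) 0 (uniform_part 0 T (n + N)).
    apply: step_path_weaken (uniform_part_path _ T0); rewrite subr0 ler_pdivrMr ?ltr0n// mul1r.
    have : T < (Num.truncn T).+1%:R by exact: truncnS_gt.
    move/ltW => h; apply: le_trans h _; rewrite ler_nat ltnS; exact: leq_addl.
  rewrite setTI.
  have := mV _ (sub_sigma_algebra (compose_davie_open hp hrho x P oU)).
  congr (measurable _); apply/seteqP; split => w /=; first by case.
  by move=> Ow; split => //; exact: gV.
move=> w; have [_ _ _ cv] := davie_flow_facts (geometric_weak0 T0 (gV w)).
have := cv 0 T x (lexx _) T0 (lexx _).
by rewrite -(cvg_shiftn N).
Qed.

End SolutionFlow.

Section Cocycle.
Context {R : realType} {m : nat} {d : measure_display} {Omega : measurableType d}.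
Variables (p rho : R) (theta : R -> Omega -> Omega) (V : Omega -> driver R m).
Hypothesis theta_add : forall s t, theta (s + t) = theta s \o theta t.
Hypothesis hV : driver_cocycle p rho theta V.

(** The cocycle relation is only given for increments from time 0; it is used at
    the base points [theta s w] and [w] and the two are compared. *)
Lemma davie_cocycle s w u v : u <= v ->
  davie (V (theta s w)) u v = davie (V w) (s + u) (s + v).
Proof.
move=> uv; have [_ _ coc] := hV; have vu0 : 0 <= v - u by rewrite subr_ge0.
have [I1 J1] := coc (theta s w) u (v - u) vu0.
have [I2 J2] := coc w (s + u) (v - u) vu0.
have E : theta u (theta s w) = theta (s + u) w by rewrite addrC theta_add.
rewrite subrKC E in I1 J1; rewrite -addrA subrKC in I2 J2.
apply/funext => x; rewrite /davie I1 I2; congr (x + (_ + _)); apply/rowP => i.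
by rewrite !mxE (J1 _ (coord_ndiff i)) (J2 _ (coord_ndiff i)).
Qed.
End Cocycle.

Theorem theorem20 (R : realType) (m : nat) (d : measure_display)
    (Omega : measurableType d) (P : probability Omega R)
    (theta : R -> Omega -> Omega) (p rho : R) (V : Omega -> driver R m)
    (hp : 2 <= p < 3) (hrho : p / 3 < rho <= 1)
    (htheta : measurable_metric_DS P theta)
    (hV : driver_cocycle p rho theta V) :
  exists phi : R -> Omega -> 'rV[R]_m -> 'rV[R]_m,
    [/\ continuous_RDS theta phi,
        induces_solution_flow p theta V phi
      & forall phi' : R -> Omega -> 'rV[R]_m -> 'rV[R]_m,
          continuous_RDS theta phi' ->
          induces_solution_flow p theta V phi' ->
          forall (t : R) (omega : Omega) (x : 'rV[R]_m),
            0 <= t -> phi' t omega x = phi t omega x].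
Proof.
have [_ theta0 theta_add _] := htheta; have [gV mV _] := hV.
pose phi t w := flow_from0 (V w) t.
have phi_pos t w x : 0 <= t -> phi t w x = flow (davie (V w)) 0 t x.
  by move=> t0; rewrite /phi /flow_from0 max_r.
have phi_shift s t w x : s <= t -> phi (t - s) (theta s w) x = flow (davie (V w)) s t x.
  move=> st; rewrite phi_pos ?subr_ge0//; apply: flow_shift => // u v uv.
  exact: (davie_cocycle theta_add hV).
exists phi; split.
- split.
  + have mphi : measurable_fun [set: measurableTypeR R * Omega * borel_rV R m]
      (fun z : measurableTypeR R * Omega * borel_rV R m => phi z.1.1 z.1.2 z.2 : borel_rV R m).
      apply: (@caratheodory R m _ Omega phi) => [t x|w].
        exact: (measurable_solution hp hrho t x gV mV).
      exact: (solution_continuous hp hrho (gV w)).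
    exact: (measurable_funTS mphi).
  + move=> w; apply/funext => x; rewrite phi_pos//.
    by have [-> //] := davie_flow_facts hp hrho (geometric_weak0 (lexx 0) (gV w)).
  + move=> s t w s0 t0; apply/funext => x /=.
    have ts0 : 0 <= t + s by rewrite addr_ge0.
    have [_ fc _ _] := davie_flow_facts hp hrho (geometric_weak0 ts0 (gV w)).
    rewrite -[X in phi X (theta s w)](addrK s t) phi_shift ?lerDr//.
    by rewrite !phi_pos// fc// lerDr.
  + move=> w; apply: continuous_subspaceT.
    exact: (solution_continuous hp hrho (gV w)).
- move=> w T T0; have wg := geometric_weak0 (ltW T0) (gV w).
  have [fi fc _ _] := davie_flow_facts hp hrho wg.
  split; first split.
  + move=> s /andP[s0 sT]; apply/funext => x; rewrite phi_shift//; exact: fi.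
  + move=> s u t s0 su ut tT; apply/funext => x /=.
    by rewrite !phi_shift ?fc//; exact: le_trans ut.
  + have [delta [C [delta0 H]]] := davie_flow_solves hp hrho wg.
    exists delta, C; split; first exact: delta0.
    move=> f fC s t s0 st tT ts.
    have -> : phi (t - s) (theta s w) = flow (davie (V w)) s t.
      by apply/funext => x; exact: phi_shift.
    exact: H.
- move=> phi' _ sol' t w x t0; have t10 : 0 < t + 1 by lra.
  have wg := geometric_weak0 (ltW t10) (gV w).
  have tt : t <= t + 1 by lra.
  have := solution_flow_unique hp hrho wg x (sol' w _ t10) (lexx _) t0 tt.
  by rewrite subr0 theta0 phi_pos.
Qed.
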